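(* Let $0<\alpha\le0.8439$ and $d_1,d_2,d_\alpha>0$. Consider the initial-boundary value problem for the Riesz space fractional turbulent diffusion equation $$\frac{\partial u}{\partial t}=-d_1\frac{\partial u}{\partial x}+d_2\frac{\partial^2u}{\partial x^2}+d_\alpha\frac{\partial^\alpha u}{\partial|x|^\alpha}+s(x,t),\quad x\in(a,b),\ t\in(0,T],$$ with $u(x,0)=\varphi(x)$ for $x\in[a,b]$ and $u(a,t)=u(b,t)=0$, and the numerical scheme $$\left(\frac{2a_1}{\tau}-b_1\right)u_{j-1}^{k+1}+\left(\frac{2a_2}{\tau}-b_2\right)u_{j}^{k+1}+\left(\frac{2a_3}{\tau}-b_3\right)u_{j+1}^{k+1}$$ $$+\nu\left[\sum_{\ell=0}^{j}\varpi_{4,\ell}^{(\alpha)}\left(a_1u_{j-\ell-1}^{k+1}+a_2u_{j-\ell}^{k+1}+a_3u_{j-\ell+1}^{k+1}\right)+\sum_{\ell=0}^{M-j}\varpi_{4,\ell}^{(\alpha)}\left(a_1u_{j+\ell-1}^{k+1}+a_2u_{j+\ell}^{k+1}+a_3u_{j+\ell+1}^{k+1}\right)\right]$$ $$=\left(\frac{2a_1}{\tau}+b_1\right)u_{j-1}^{k}+\left(\frac{2a_2}{\tau}+b_2\right)u_{j}^{k}+\left(\frac{2a_3}{\tau}+b_3\right)u_{j+1}^{k}$$ $$-\nu\left[\sum_{\ell=0}^{j}\varpi_{4,\ell}^{(\alpha)}\left(a_1u_{j-\ell-1}^{k}+a_2u_{j-\ell}^{k}+a_3u_{j-\ell+1}^{k}\right)+\sum_{\ell=0}^{M-j}\varpi_{4,\ell}^{(\alpha)}\left(a_1u_{j+\ell-1}^{k}+a_2u_{j+\ell}^{k}+a_3u_{j+\ell+1}^{k}\right)\right]$$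 $$+2a_1s_{j-1}^{k+\frac12}+2a_2s_{j}^{k+\frac12}+2a_3s_{j+1}^{k+\frac12}$$ for $j=1,\dots,M-1$, $k=0,1,\dots,N-1$, with $u_j^0=\varphi(x_j)$ and $u_j^k=0$ for $j\le0$ and $j\ge M$, where $$\nu=\frac{d_\alpha}{2\cos(\pi\alpha/2)h^\alpha},\quad a_1=\frac1{12}+\frac{d_1h}{24d_2},\quad a_2=\frac56,\quad a_3=\frac1{12}-\frac{d_1h}{24d_2},$$ $$b_1=\frac{d_2}{h^2}+\frac{d_1^2}{12d_2}+\frac{d_1}{2h},\quad b_2=-2\left(\frac{d_2}{h^2}+\frac{d_1^2}{12d_2}\right),\quad b_3=\frac{d_2}{h^2}+\frac{d_1^2}{12d_2}-\frac{d_1}{2h}.$$ This scheme is unconditionally stable and convergent with order $\mathcal O(\tau^2+h^4)$.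
   Context: Grid: $T>0$, $\tau=T/N$, $t_k=k\tau$, $h=(b-a)/M$, $x_j=a+jh$; $u_j^k$ is the numerical approximation of $u(x_j,t_k)$ and $s_j^{k+1/2}=s(x_j,t_k+\tau/2)$. Riesz derivative ($0<\alpha<1$): $$\frac{\partial^\alpha u(x,t)}{\partial|x|^\alpha}=-\frac{1}{2\cos(\pi\alpha/2)}\left({}_{RL}D_{a,x}^\alpha+{}_{RL}D_{x,b}^\alpha\right)u(x,t),$$ where ${}_{RL}D_{a,x}^\alpha f(x)=\frac{1}{\Gamma(1-\alpha)}\frac{d}{dx}\int_a^x(x-\xi)^{-\alpha}f(\xi)\,d\xi$ and ${}_{RL}D_{x,b}^\alpha f(x)=\frac{-1}{\Gamma(1-\alpha)}\frac{d}{dx}\int_x^b(\xi-x)^{-\alpha}f(\xi)\,d\xi$. Coefficients: $\left(\frac{25}{12}-4z+3z^2-\frac43z^3+\frac14z^4\right)^\alpha=\sum_{\ell\ge0}\varpi_{4,\ell}^{(\alpha)}z^\ell$ (branch positive at $z=0$). Unconditional stability (Fourier/von Neumann sense): the solution is extended by zero to the whole real line, so the error $\mathcal E_j^k$ satisfies the scheme with $s=0$ and with both sums over $\ell$ extended to $\infty$. For all $\tau,h>0$ and all $\theta\in[-\pi,\pi]$, every mode $\mathcal E_j^k=\xi^k e^{ij\theta}$ ($i=\sqrt{-1}$ in the exponent) solving this error equation has amplification factor $\xi=\xi(\theta)$ with $|\xi(\theta)|\le1$. Convergence of order $\mathcal O(\tau^2+h^4)$: suppose the exact solution $u$, extended by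 zero outside $[a,b]$, is regular enough that the following hold uniformly on the grid: the Crank–Nicolson time discretization at $t_{k+1/2}$ has error $\mathcal O(\tau^2)$; with $\delta_x^2v_j=(v_{j+1}-2v_j+v_{j-1})/h^2$, $\mu_x\delta_xv_j=(v_{j+1}-v_{j-1})/(2h)$ and $g=d_2u_{xx}-d_1u_x$, $$\left[\left(d_2+\tfrac{d_1^2h^2}{12d_2}\right)\delta_x^2-d_1\mu_x\delta_x\right]u(x_j,t)=\left[I+\tfrac{h^2}{12}\left(\delta_x^2-\tfrac{d_1}{d_2}\mu_x\delta_x\right)\right]g(x_j,t)+\mathcal O(h^4);$$ and $$\frac{\partial^\alpha u}{\partial|x|^\alpha}(x,t)=-\frac{1}{2\cos(\pi\alpha/2)h^\alpha}\sum_{\ell=0}^\infty\varpi_{4,\ell}^{(\alpha)}\left(u(x-\ell h,t)+u(x+\ell h,t)\right)+\mathcal O(h^4).$$ Then there is a constant $C$ independent of $\tau,h$ such that $\left(h\sum_{j=1}^{M-1}|u(x_j,t_k)-u_j^k|^2\right)^{1/2}\le C(\tau^2+h^4)$ for all $0\le k\le N$.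
   Formalization: The range 0<α≤0.8439 is replaced by 0<α≤π/(2(π−arctan(699√6/512)))=0.843895…, of which 0.8439 is a rounding up; for α strictly between the two values unconditional stability fails (take cos θ=1/5 and h large). *)

(* Defs.v *)
From Stdlib Require Import Reals ZArith Lra Lia.
From Coquelicot Require Import Coquelicot.
Open Scope R_scope.

(** * The admissible range of the fractional order

    [alpha_max] is the exact value of the constant 0.8439 (four decimals).  With
    [delta z = 25/12 - 4 z + 3 z^2 - 4/3 z^3 + 1/4 z^4], the symbol
    [delta (e^{i theta})] takes values in the sector
    [|arg| <= PI - atan (699 sqrt 6 / 512)] (the fourth-order backward
    differentiation formula is A(73.35 degrees)-stable), so that
    [Re (delta (e^{i theta}) ^ alpha) >= 0] for every theta exactly when
    [alpha <= alpha_max].  The decimal 0.8439 is rounded up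
    ([alpha_max = 0.843895...], see [alpha_max_approx]), and for
    [alpha_max < alpha <= 0.8439] von Neumann stability fails for suitable
    [d1, d2, da, tau, h]. *)
Definition alpha_max : R := PI / (2 * (PI - atan (699 * sqrt 6 / 512))).

Fact alpha_max_approx : 0.84389 < alpha_max < 0.8439.
Proof.
assert (HPI : 3.14159 < PI < 3.1416).
{ destruct (PI_2_3_7_ineq 2) as [H1 _]; destruct (PI_2_3_7_ineq 3) as [_ H2].
  revert H1 H2; unfold tg_alt, PI_2_3_7_tg, Ratan_seq; simpl; lra. }
assert (Hd : forall c x, 0 <= x -> exists z,
  x - x^3/3 + x^5/5 - x^7/7 + c * x^9/9 - atan x
  = (1 - z^2 + z^4 - z^6 + c * z^8 - / (1 + z^2)) * x).
{ intros c x Hx.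
  destruct (MVT_gen (fun y => y - y^3/3 + y^5/5 - y^7/7 + c * y^9/9 - atan y) 0 x
    (fun z => 1 - z^2 + z^4 - z^6 + c * z^8 - / (1 + z^2))) as [z [_ E]].
  - intros y _. auto_derive; [exact I|]. unfold Rsqr. field. nra.
  - intros y _. apply continuity_pt_filterlim.
    refine (ex_derive_continuous (V := R_NormedModule)
      (fun y => y - y^3/3 + y^5/5 - y^7/7 + c * y^9/9 - atan y) _ _).
    auto_derive. exact I.
  - exists z. rewrite atan_0, Rminus_0_r in E. cbv beta in E. lra. }
assert (Hq : forall z, 0 < / (1 + z^2)) by (intro z; apply Rinv_0_lt_compat; nra).
assert (Hat : forall x, 0 <= x ->
  x - x^3/3 + x^5/5 - x^7/7 <= atan x <= x - x^3/3 + x^5/5 - x^7/7 + x^9/9).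
{ intros x Hx; split.
  - destruct (Hd 0 x Hx) as [z E].
    replace (1 - z^2 + z^4 - z^6 + 0 * z^8 - / (1 + z^2))
      with (- ((z^4)^2 * / (1 + z^2))) in E by (field; nra).
    assert (0 <= (z^4)^2 * / (1 + z^2) * x)
      by (apply Rmult_le_pos; [apply Rmult_le_pos; [apply pow2_ge_0|left; apply Hq]|exact Hx]).
    lra.
  - destruct (Hd 1 x Hx) as [z E].
    replace (1 - z^2 + z^4 - z^6 + 1 * z^8 - / (1 + z^2))
      with ((z^5)^2 * / (1 + z^2)) in E by (field; nra).
    assert (0 <= (z^5)^2 * / (1 + z^2) * x)
      by (apply Rmult_le_pos; [apply Rmult_le_pos; [apply pow2_ge_0|left; apply Hq]|exact Hx]).
    lra. }
assert (H6 : 2.449489 < sqrt 6 < 2.44949).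
{ split.
  - rewrite <- (sqrt_Rsqr 2.449489) by lra. apply sqrt_lt_1; unfold Rsqr; lra.
  - rewrite <- (sqrt_Rsqr 2.44949) by lra. apply sqrt_lt_1; unfold Rsqr; lra. }
set (y := 512 / 4194 * sqrt 6).
assert (Hy : 0.299031 < y < 0.299032) by (unfold y; lra).
assert (Ht : 699 * sqrt 6 / 512 = / y).
{ assert (S : sqrt 6 * sqrt 6 = 6) by (apply sqrt_sqrt; lra).
  unfold y. apply (Rmult_eq_reg_r (512 / 4194 * sqrt 6)); [|lra].
  rewrite Rinv_l by lra.
  replace (699 * sqrt 6 / 512 * (512 / 4194 * sqrt 6))
    with (699 / 4194 * (sqrt 6 * sqrt 6)) by field.
  rewrite S. lra. }
assert (Hy1 : 0.290562 < atan y < 0.290575).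
{ split.
  - apply Rlt_trans with (atan 0.299031); [|apply atan_increasing; lra].
    destruct (Hat 0.299031); lra.
  - apply Rlt_trans with (atan 0.299032); [apply atan_increasing; lra|].
    destruct (Hat 0.299032); lra. }
unfold alpha_max. rewrite Ht, atan_inv by lra.
split.
- apply -> Rlt_div_r; lra.
- apply <- Rlt_div_l; lra.
Qed.

(** * The continuous problem *)

Definition Gamma (p : R) : R :=
  RInt_gen (fun t => Rpower t (p - 1) * exp (- t))
           (at_right 0) (Rbar_locally p_infty).

(** The kernels are singular at [y], so the integrals are improper there.
    For [f] vanishing outside [(a, b)] the formulas also make sense for [y]
    outside [[a, b]], so that the derivatives below may be taken at [a] and [b]. *)
Definition frac_int_left (alpha a : R) (f : R -> R) (y : R) : R :=
  RInt_gen (fun xi => Rpower (y - xi) (- alpha) * f xi) (at_point a) (at_left y).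

Definition frac_int_right (alpha b : R) (f : R -> R) (y : R) : R :=
  RInt_gen (fun xi => Rpower (xi - y) (- alpha) * f xi) (at_right y) (at_point b).

Definition RL_left (alpha a : R) (f : R -> R) (x : R) : R :=
  1 / Gamma (1 - alpha) * Derive (frac_int_left alpha a f) x.

Definition RL_right (alpha b : R) (f : R -> R) (x : R) : R :=
  - 1 / Gamma (1 - alpha) * Derive (frac_int_right alpha b f) x.

Definition riesz (alpha a b : R) (f : R -> R) (x : R) : R :=
  - (1 / (2 * cos (PI * alpha / 2))) * (RL_left alpha a f x + RL_right alpha b f x).

Definition ex_riesz (alpha a b : R) (f : R -> R) (x : R) : Prop :=
  locally x (fun y =>
    ex_RInt_gen (fun xi => Rpower (y - xi) (- alpha) * f xi) (at_point a) (at_left y)) /\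
  locally x (fun y =>
    ex_RInt_gen (fun xi => Rpower (xi - y) (- alpha) * f xi) (at_right y) (at_point b)) /\
  ex_derive (frac_int_left alpha a f) x /\
  ex_derive (frac_int_right alpha b f) x.

(** Derivative relative to the time interval [[0, T]]: one-sided at [t = T]. *)
Definition is_time_derive (T : R) (f : R -> R) (t l : R) : Prop :=
  filterlim (fun r => (f r - f t) / (r - t))
            (within (fun r => 0 <= r <= T /\ r <> t) (locally t)) (locally l).

Definition g_flux (d1 d2 : R) (u : R -> R -> R) (x t : R) : R :=
  d2 * Derive_n (fun y => u y t) 2 x - d1 * Derive (fun y => u y t) x.

Definition space_op (alpha d1 d2 da a b : R) (u : R -> R -> R) (x t : R) : R :=
  - d1 * Derive (fun y => u y t) x + d2 * Derive_n (fun y => u y t) 2 x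
  + da * riesz alpha a b (fun y => u y t) x.

Definition exact_solution (alpha d1 d2 da a b T : R) (phi : R -> R)
    (s u : R -> R -> R) : Prop :=
  (forall x t, a < x < b -> 0 < t <= T ->
     ex_derive_n (fun y => u y t) 2 x /\
     ex_riesz alpha a b (fun y => u y t) x /\
     is_time_derive T (u x) t (space_op alpha d1 d2 da a b u x t + s x t)) /\
  (forall x, a <= x <= b -> u x 0 = phi x) /\
  (forall t, 0 <= t <= T -> u a t = 0 /\ u b t = 0).

Definition zero_extended (a b T : R) (u : R -> R -> R) : Prop :=
  forall x t, 0 <= t <= T -> x < a \/ b < x -> u x t = 0.

(** * The scheme *)

(** Maclaurin coefficients of [(25/12 - 4 z + 3 z^2 - 4/3 z^3 + 1/4 z^4)^alpha];
    near [z = 0] the base is positive, so [Rpower] is the branch positive at 0. *)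
Definition varpi4 (alpha : R) (l : nat) : R :=
  Derive_n (fun z => Rpower (25/12 - 4 * z + 3 * z^2 - 4/3 * z^3 + 1/4 * z^4) alpha) l 0
  / INR (fact l).

Definition nu (alpha da h : R) : R := da / (2 * cos (PI * alpha / 2) * Rpower h alpha).

Definition a1 (d1 d2 h : R) : R := 1/12 + d1 * h / (24 * d2).
Definition a2 : R := 5/6.
Definition a3 (d1 d2 h : R) : R := 1/12 - d1 * h / (24 * d2).
Definition b1 (d1 d2 h : R) : R := d2 / h^2 + d1^2 / (12 * d2) + d1 / (2 * h).
Definition b2 (d1 d2 h : R) : R := -2 * (d2 / h^2 + d1^2 / (12 * d2)).
Definition b3 (d1 d2 h : R) : R := d2 / h^2 + d1^2 / (12 * d2) - d1 / (2 * h).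

Definition node (a h : R) (j : Z) : R := a + IZR j * h.

Definition avg (d1 d2 h : R) (v : Z -> R) (j : Z) : R :=
  a1 d1 d2 h * v (j - 1)%Z + a2 * v j + a3 d1 d2 h * v (j + 1)%Z.

Definition frac_sum (alpha d1 d2 h : R) (M : nat) (v : Z -> R) (j : nat) : R :=
  sum_f_R0 (fun l => varpi4 alpha l *
              avg d1 d2 h v (Z.of_nat j - Z.of_nat l)) j
  + sum_f_R0 (fun l => varpi4 alpha l *
              avg d1 d2 h v (Z.of_nat j + Z.of_nat l)) (M - j).

(** [U k j] is [u_j^k]; [tau = T / N] and [h = (b - a) / M]. *)
Definition scheme_solution (alpha d1 d2 da a b T : R) (phi : R -> R)
    (s : R -> R -> R) (M N : nat) (U : nat -> Z -> R) : Prop :=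
  let tau := T / INR N in
  let h := (b - a) / INR M in
  let A1 := a1 d1 d2 h in let A2 := a2 in let A3 := a3 d1 d2 h in
  let B1 := b1 d1 d2 h in let B2 := b2 d1 d2 h in let B3 := b3 d1 d2 h in
  (forall j k : nat, (1 <= j <= M - 1)%nat -> (k < N)%nat ->
     let J := Z.of_nat j in
     let shalf := fun i : Z => s (node a h i) (INR k * tau + tau / 2) in
     (2 * A1 / tau - B1) * U (S k) (J - 1)%Z + (2 * A2 / tau - B2) * U (S k) J
     + (2 * A3 / tau - B3) * U (S k) (J + 1)%Z
     + nu alpha da h * frac_sum alpha d1 d2 h M (U (S k)) j
     =
     (2 * A1 / tau + B1) * U k (J - 1)%Z + (2 * A2 / tau + B2) * U k J
     + (2 * A3 / tau + B3) * U k (J + 1)%Z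
     - nu alpha da h * frac_sum alpha d1 d2 h M (U k) j
     + 2 * A1 * shalf (J - 1)%Z + 2 * A2 * shalf J + 2 * A3 * shalf (J + 1)%Z) /\
  (forall j : nat, (1 <= j <= M - 1)%nat ->
     U 0%nat (Z.of_nat j) = phi (node a h (Z.of_nat j))) /\
  (forall (k : nat) (j : Z), (k <= N)%nat ->
     (j <= 0)%Z \/ (Z.of_nat M <= j)%Z -> U k j = 0).

(** * Stability in the von Neumann sense *)

Definition Cavg (d1 d2 h : R) (v : Z -> C) (j : Z) : C :=
  (RtoC (a1 d1 d2 h) * v (j - 1)%Z + RtoC a2 * v j
   + RtoC (a3 d1 d2 h) * v (j + 1)%Z)%C.

Definition is_frac_series (alpha d1 d2 h : R) (v : Z -> C) (j : Z) (S : C) : Prop :=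
  exists Sl Sr : C,
    is_series (V := C_R_NormedModule)
      (fun l : nat => (RtoC (varpi4 alpha l) * Cavg d1 d2 h v (j - Z.of_nat l)%Z)%C) Sl /\
    is_series (V := C_R_NormedModule)
      (fun l : nat => (RtoC (varpi4 alpha l) * Cavg d1 d2 h v (j + Z.of_nat l)%Z)%C) Sr /\
    S = (Sl + Sr)%C.

Definition error_equation (alpha d1 d2 da tau h : R) (E : nat -> Z -> C) : Prop :=
  let A1 := a1 d1 d2 h in let A2 := a2 in let A3 := a3 d1 d2 h in
  let B1 := b1 d1 d2 h in let B2 := b2 d1 d2 h in let B3 := b3 d1 d2 h in
  forall (k : nat) (j : Z), exists S1 S0 : C,
    is_frac_series alpha d1 d2 h (E (S k)) j S1 /\
    is_frac_series alpha d1 d2 h (E k) j S0 /\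
    (RtoC (2 * A1 / tau - B1) * E (S k) (j - 1)%Z
     + RtoC (2 * A2 / tau - B2) * E (S k) j
     + RtoC (2 * A3 / tau - B3) * E (S k) (j + 1)%Z
     + RtoC (nu alpha da h) * S1
     =
     RtoC (2 * A1 / tau + B1) * E k (j - 1)%Z
     + RtoC (2 * A2 / tau + B2) * E k j
     + RtoC (2 * A3 / tau + B3) * E k (j + 1)%Z
     - RtoC (nu alpha da h) * S0)%C.

Definition mode (xi : C) (theta : R) (k : nat) (j : Z) : C :=
  (Cpow xi k * (cos (IZR j * theta), sin (IZR j * theta)))%C.

Definition unconditionally_stable (alpha d1 d2 da : R) : Prop :=
  forall (tau h theta : R) (xi : C),
    0 < tau -> 0 < h -> - PI <= theta <= PI ->
    error_equation alpha d1 d2 da tau h (mode xi theta) ->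
    Cmod xi <= 1.

(** * Consistency of the discretizations, uniformly over all grids *)

Definition crank_nicolson_consistent (alpha d1 d2 da a b T : R)
    (s u : R -> R -> R) : Prop :=
  exists K : R, forall M N j k : nat,
    (1 <= M)%nat -> (1 <= N)%nat -> (j <= M)%nat -> (k < N)%nat ->
    let tau := T / INR N in
    let h := (b - a) / INR M in
    let x := node a h (Z.of_nat j) in
    let t0 := INR k * tau in
    let t1 := INR (S k) * tau in
    Rabs ((u x t1 - u x t0) / tau
          - (space_op alpha d1 d2 da a b u x t1
             + space_op alpha d1 d2 da a b u x t0) / 2
          - s x (t0 + tau / 2)) <= K * tau^2.

Definition delta2 (h : R) (v : R -> R) (x : R) : R :=
  (v (x + h) - 2 * v x + v (x - h)) / h^2.

Definition mu_delta (h : R) (v : R -> R) (x : R) : R :=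
  (v (x + h) - v (x - h)) / (2 * h).

Definition compact_consistent (d1 d2 a b T : R) (u : R -> R -> R) : Prop :=
  exists K : R, forall M N j k : nat,
    (1 <= M)%nat -> (1 <= N)%nat -> (1 <= j <= M - 1)%nat -> (k <= N)%nat ->
    let h := (b - a) / INR M in
    let x := node a h (Z.of_nat j) in
    let t := INR k * (T / INR N) in
    let ut := fun y => u y t in
    let g := fun y => g_flux d1 d2 u y t in
    Rabs ((d2 + d1^2 * h^2 / (12 * d2)) * delta2 h ut x - d1 * mu_delta h ut x
          - (g x + h^2 / 12 * (delta2 h g x - d1 / d2 * mu_delta h g x)))
    <= K * h^4.

(** The end points [j = 0] and [j = M] are included: the three-point average in
    the scheme at [j = 1] and [j = M - 1] uses the Riesz derivative there. *)
Definition riesz_consistent (alpha a b T : R) (u : R -> R -> R) : Prop :=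
  exists K : R, forall M N j k : nat,
    (1 <= M)%nat -> (1 <= N)%nat -> (j <= M)%nat -> (k <= N)%nat ->
    let h := (b - a) / INR M in
    let x := node a h (Z.of_nat j) in
    let t := INR k * (T / INR N) in
    Rabs (riesz alpha a b (fun y => u y t) x
          - (- (1 / (2 * cos (PI * alpha / 2) * Rpower h alpha)))
            * Series (fun l => varpi4 alpha l *
                        (u (x - INR l * h) t + u (x + INR l * h) t)))
    <= K * h^4.

Definition convergent_2_4 (alpha d1 d2 da a b T : R) (phi : R -> R)
    (s u : R -> R -> R) : Prop :=
  exists K : R, forall (M N : nat) (U : nat -> Z -> R),
    (1 <= M)%nat -> (1 <= N)%nat ->
    scheme_solution alpha d1 d2 da a b T phi s M N U ->
    let tau := T / INR N in
    let h := (b - a) / INR M in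
    forall k : nat, (k <= N)%nat ->
      sqrt (h * sum_n_m (fun j : nat =>
              (Rabs (u (node a h (Z.of_nat j)) (INR k * tau) - U k (Z.of_nat j)))^2)
              1 (M - 1))
      <= K * (tau^2 + h^4).

(* Main.v *)
Require Import Defs.
From Stdlib Require Import Reals ZArith Lra Lia Psatz.
From Coquelicot Require Import Coquelicot.
Open Scope R_scope.

(** Let [delta z = 25/12 - 4 z + 3 z^2 - 4/3 z^3 + 1/4 z^4], let [c_l] be the
    coefficients of [delta^alpha], and let [W] be the convolution operator with
    symbol [delta (e^{i theta})^alpha + delta (e^{-i theta})^alpha].  Everything
    rests on one fact: [Re (delta z)^alpha >= 0] for [|z| < 1]
    ([ray_re_delta_coefs_nonneg]).

    This holds because [delta] maps the disc into the sector
    [|arg| <= PI - atan k], [k = 699 sqrt 6 / 512], and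
    [alpha_max * (PI - atan k) = PI / 2].  In the half disc above the real axis
    the sector condition is [k Re delta + |Im delta| >= 0]; along vertical chords
    the left side is concave, so it is enough to look at the real axis and at the
    unit circle, where the condition is a polynomial inequality in
    [1 - cos theta] with a double root at [4/5] ([sector_disc],
    [sector_circle]).  To know that [c_l] really are the coefficients of
    [delta^alpha] throughout the disc, write [delta = P1 P2 / P3] with three
    polynomials whose constant terms dominate.  The recurrence that comes from
    [p f' = alpha p' f] keeps the coefficients of each power bounded
    ([power_coefs_bounded]), and the same differential equation identifies the
    sum of the series along each ray ([power_series_polar]).

    Integrating the nonnegative real part against a nonnegative trigonometric
    polynomial shows that the Toeplitz forms built from [c_l] are nonnegative
    ([toeplitz_nonneg]) and that [|c_l| <= 2 c_0] ([caratheodory_bound]).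

    Stability.  Let [p] be the symbol of the three-point average, [q] that of the
    local part and [omega] that of [W], nonnegative by Abel's theorem.  A mode satisfies
    [(2 p / tau + Q) xi = 2 p / tau - Q] with [Q = - q + nu omega p], and
    [Re (p conj Q) >= 0] gives [|xi| <= 1] ([von_neumann_stable]).

    Convergence.  The consistency hypotheses say that the error satisfies the
    scheme up to a residual of size [tau^2 + h^4] ([truncation_error]).  The
    operators of the finite grid do not commute, so the Fourier argument is
    replaced by energy estimates.  With [d] and [w] the difference and the sum of
    the errors at two consecutive levels, testing the error equation with [w]
    would give the decay of the energy of the average if the average were
    symmetric.  Its antisymmetric part has size [h], and testing with [d] bounds
    [d / tau] by the discrete gradient of [w]; since [alpha < 1] the contribution
    of the antisymmetric part is absorbed by the diffusion as soon as [h] is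
    small ([skew_absorbed], [energy_growth_of_step]).  Only finitely many grids
    in space remain; on each of them a discrete Gronwall argument, uniform in
    [tau], gives a constant ([norm_growth_of_step]). *)

(** * Power series on rays of the unit disc *)

Definition on_disc (c : nat -> R) : Prop :=
  forall x, Rabs x < 1 -> Rbar_lt (Rabs x) (CV_radius c).

(** If the radius were at most [|x| < 1], the terms of the series at a point
    between [|x|] and 1 could not tend to zero. *)
Lemma on_disc_of_ex_pseries c :
  (forall x, Rabs x < 1 -> ex_pseries c x) -> on_disc c.
Proof.
intros H x Hx.
destruct (Rbar_lt_le_dec (Rabs x) (CV_radius c)) as [h|h]; [exact h|exfalso].
set (y := (1 + Rabs x) / 2).
assert (0 <= Rabs x) by apply Rabs_pos.
assert (Hy : Rabs y = y) by (apply Rabs_right; unfold y; lra).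
apply (CV_disk_outside c y).
- apply Rbar_le_lt_trans with (1 := h). simpl. rewrite Hy. unfold y. lra.
- apply ex_series_lim_0. apply ex_series_ext with (fun n => scal (pow_n y n) (c n)).
  + intro n. rewrite pow_n_pow. unfold scal; simpl; unfold mult; simpl. ring.
  + apply H. rewrite Hy. unfold y. lra.
Qed.

Lemma ex_pseries_le_abs a b x :
  (forall n, Rabs (b n) <= Rabs (a n)) ->
  Rbar_lt (Rabs x) (CV_radius a) -> ex_pseries b x.
Proof.
intros H Hx.
apply (ex_series_le (V := R_CompleteNormedModule)) with (fun n => Rabs (a n * x ^ n)).
- intro n. rewrite pow_n_pow. unfold scal, norm; simpl; unfold mult, abs; simpl.
  rewrite !Rabs_mult, Rmult_comm. apply Rmult_le_compat_r; [apply Rabs_pos|apply H].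
- apply CV_disk_inside, Hx.
Qed.

Lemma on_disc_le a b :
  (forall n, Rabs (b n) <= Rabs (a n)) -> on_disc a -> on_disc b.
Proof.
intros H Ha; apply on_disc_of_ex_pseries; intros x Hx.
apply (ex_pseries_le_abs a); auto.
Qed.

Lemma on_disc_bounded c B : (forall n, Rabs (c n) <= B) -> on_disc c.
Proof.
intros H x Hx.
apply Rbar_lt_le_trans with 1; [exact Hx|].
apply (CV_radius_bounded c).
exists B. intro n. rewrite pow1, Rmult_1_r. apply H.
Qed.

Lemma on_disc_mult a b : on_disc a -> on_disc b -> on_disc (PS_mult a b).
Proof.
intros Ha Hb; apply on_disc_of_ex_pseries; intros x Hx.
apply ex_pseries_mult; auto.
Qed.

(** The coefficients of [z f'(z)].  Unlike [f'], this operator commutes with the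
    restriction to a ray [t e^{i th}]. *)
Definition theta_coefs (c : nat -> R) (n : nat) : R := INR n * c n.

Lemma theta_coefs_incr c n : PS_incr_1 (PS_derive c) n = theta_coefs c n.
Proof. destruct n; unfold theta_coefs, PS_derive; simpl; [unfold zero; simpl; ring|reflexivity]. Qed.

Lemma on_disc_theta_coefs c : on_disc c -> on_disc (theta_coefs c).
Proof.
intros H x Hx. rewrite <- (CV_radius_ext _ _ (theta_coefs_incr c)).
rewrite CV_radius_incr_1, CV_radius_derive. auto.
Qed.

(** On the ray [z = t e^{i th}] a power series with real coefficients splits into
    two real power series in [t], its real and imaginary parts. *)
Definition twist_cos (th : R) (c : nat -> R) (n : nat) : R := c n * cos (INR n * th).
Definition twist_sin (th : R) (c : nat -> R) (n : nat) : R := c n * sin (INR n * th).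

Lemma on_disc_twist_cos th c : on_disc c -> on_disc (twist_cos th c).
Proof.
apply on_disc_le. intro n. unfold twist_cos. rewrite Rabs_mult.
rewrite <- (Rmult_1_r (Rabs (c n))) at 2.
apply Rmult_le_compat_l; [apply Rabs_pos|]. apply Rabs_le. destruct (COS_bound (INR n * th)); lra.
Qed.

Lemma on_disc_twist_sin th c : on_disc c -> on_disc (twist_sin th c).
Proof.
apply on_disc_le. intro n. unfold twist_sin. rewrite Rabs_mult.
rewrite <- (Rmult_1_r (Rabs (c n))) at 2.
apply Rmult_le_compat_l; [apply Rabs_pos|]. apply Rabs_le. destruct (SIN_bound (INR n * th)); lra.
Qed.

Lemma twist_cos_mult th a b n :
  twist_cos th (PS_mult a b) n = PS_mult (twist_cos th a) (twist_cos th b) n - PS_mult (twist_sin th a) (twist_sin th b) n.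
Proof.
unfold twist_cos at 1, PS_mult. rewrite Rmult_comm, scal_sum, <- minus_sum. apply sum_eq. intros i Hi.
unfold twist_cos, twist_sin. replace (INR n * th) with (INR i * th + INR (n - i) * th).
- rewrite cos_plus. ring.
- rewrite minus_INR by exact Hi. ring.
Qed.

Lemma twist_sin_mult th a b n :
  twist_sin th (PS_mult a b) n = PS_mult (twist_cos th a) (twist_sin th b) n + PS_mult (twist_sin th a) (twist_cos th b) n.
Proof.
unfold twist_sin at 1, PS_mult. rewrite Rmult_comm, scal_sum, <- plus_sum. apply sum_eq. intros i Hi.
unfold twist_cos, twist_sin. replace (INR n * th) with (INR i * th + INR (n - i) * th).
- rewrite sin_plus. ring.
- rewrite minus_INR by exact Hi. ring.
Qed.

Definition ray_re (th : R) (c : nat -> R) (t : R) : R := PSeries (twist_cos th c) t.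
Definition ray_im (th : R) (c : nat -> R) (t : R) : R := PSeries (twist_sin th c) t.

Lemma ray_re_mult th a b t : on_disc a -> on_disc b -> Rabs t < 1 ->
  ray_re th (PS_mult a b) t = ray_re th a t * ray_re th b t - ray_im th a t * ray_im th b t.
Proof.
intros Ha Hb Ht. unfold ray_re, ray_im.
assert (Hac := on_disc_twist_cos th a Ha). assert (Has := on_disc_twist_sin th a Ha).
assert (Hbc := on_disc_twist_cos th b Hb). assert (Hbs := on_disc_twist_sin th b Hb).
rewrite (PSeries_ext _ _ t (twist_cos_mult th a b)).
rewrite <- !PSeries_mult by auto.
rewrite <- PSeries_minus; [reflexivity| |]; apply ex_pseries_mult; auto.
Qed.

Lemma ray_im_mult th a b t : on_disc a -> on_disc b -> Rabs t < 1 ->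
  ray_im th (PS_mult a b) t = ray_re th a t * ray_im th b t + ray_im th a t * ray_re th b t.
Proof.
intros Ha Hb Ht. unfold ray_re, ray_im.
assert (Hac := on_disc_twist_cos th a Ha). assert (Has := on_disc_twist_sin th a Ha).
assert (Hbc := on_disc_twist_cos th b Hb). assert (Hbs := on_disc_twist_sin th b Hb).
rewrite (PSeries_ext _ _ t (twist_sin_mult th a b)).
rewrite <- !PSeries_mult by auto.
rewrite <- PSeries_plus; [reflexivity| |]; apply ex_pseries_mult; auto.
Qed.

Lemma ray_re_ext th a b t : (forall n, a n = b n) -> ray_re th a t = ray_re th b t.
Proof. intro H. apply PSeries_ext. intro n. unfold twist_cos. now rewrite H. Qed.
Lemma ray_im_ext th a b t : (forall n, a n = b n) -> ray_im th a t = ray_im th b t.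
Proof. intro H. apply PSeries_ext. intro n. unfold twist_sin. now rewrite H. Qed.

Lemma ray_re_scal th al a t : ray_re th (fun n => al * a n) t = al * ray_re th a t.
Proof.
unfold ray_re. rewrite <- PSeries_scal. apply PSeries_ext. intro n.
unfold twist_cos, PS_scal, scal; simpl; unfold mult; simpl. ring.
Qed.
Lemma ray_im_scal th al a t : ray_im th (fun n => al * a n) t = al * ray_im th a t.
Proof.
unfold ray_im. rewrite <- PSeries_scal. apply PSeries_ext. intro n.
unfold twist_sin, PS_scal, scal; simpl; unfold mult; simpl. ring.
Qed.

Lemma ray_re_at_0 th c : ray_re th c 0 = c 0%nat.
Proof. unfold ray_re, twist_cos. rewrite PSeries_0. simpl. rewrite Rmult_0_l, cos_0. ring. Qed.
Lemma ray_im_at_0 th c : ray_im th c 0 = 0.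
Proof. unfold ray_im, twist_sin. rewrite PSeries_0. simpl. rewrite Rmult_0_l, sin_0. ring. Qed.

(** Only [t] times the derivative has a convenient form, so the derivative is
    left anonymous. *)
Lemma is_derive_ray_re th c t : on_disc c -> Rabs t < 1 ->
  exists l, is_derive (ray_re th c) t l /\ t * l = ray_re th (theta_coefs c) t.
Proof.
intros Hc Ht. exists (PSeries (PS_derive (twist_cos th c)) t). split.
- apply is_derive_PSeries, on_disc_twist_cos; auto.
- rewrite <- PSeries_incr_1. apply PSeries_ext. intro n. rewrite theta_coefs_incr.
  unfold theta_coefs, twist_cos. ring.
Qed.
Lemma is_derive_ray_im th c t : on_disc c -> Rabs t < 1 ->
  exists l, is_derive (ray_im th c) t l /\ t * l = ray_im th (theta_coefs c) t.
Proof.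
intros Hc Ht. exists (PSeries (PS_derive (twist_sin th c)) t). split.
- apply is_derive_PSeries, on_disc_twist_sin; auto.
- rewrite <- PSeries_incr_1. apply PSeries_ext. intro n. rewrite theta_coefs_incr.
  unfold theta_coefs, twist_sin. ring.
Qed.

(** Coefficient form of [z f'(z) p(z) = al z p'(z) f(z)], the equation that
    characterizes the multiples of [p^al]. *)
Definition power_rec (al : R) (p c : nat -> R) : Prop :=
  forall n, PS_mult p (theta_coefs c) n = al * PS_mult (theta_coefs p) c n.

(** * Powers of polynomials with dominating constant term *)

Definition log_mod (x y : R) : R := ln (x * x + y * y) / 2.

(** The function differentiated here is the real part of
    [(U + i V) (x + i y)^(- al)].  Both brackets vanish when [U + i V] solves the
    differential equation of [(x + i y)^al]; the imaginary part is obtained by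
    putting [(V, - U)] for [(U, V)]. *)
Lemma rotation_derivative al (x y U V : R -> R) t x' y' U' V' :
  is_derive x t x' -> is_derive y t y' -> is_derive U t U' -> is_derive V t V' ->
  0 < x t ->
  is_derive (fun s => exp (- al * log_mod (x s) (y s)) *
      (U s * cos (al * atan (y s / x s)) + V s * sin (al * atan (y s / x s)))) t
   (exp (- al * log_mod (x t) (y t)) / (x t * x t + y t * y t) *
    (cos (al * atan (y t / x t)) *
       ((U' * (x t * x t + y t * y t) - al * ((x t * x' + y t * y') * U t - (x t * y' - y t * x') * V t)))
    + sin (al * atan (y t / x t)) *
       ((V' * (x t * x t + y t * y t) - al * ((x t * x' + y t * y') * V t + (x t * y' - y t * x') * U t))))).
Proof.
intros Hx Hy HU HV Hpos.
assert (Hn : x t * x t + y t * y t > 0) by nra.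
assert (Ex : ex_derive x t) by (exists x'; exact Hx).
assert (Ey : ex_derive y t) by (exists y'; exact Hy).
assert (EU : ex_derive U t) by (exists U'; exact HU).
assert (EV : ex_derive V t) by (exists V'; exact HV).
unfold log_mod. auto_derive.
- repeat split; auto; lra.
- change (fun x0 : R => x x0) with x. change (fun x0 : R => y x0) with y.
  change (fun x0 : R => U x0) with U. change (fun x0 : R => V x0) with V.
  rewrite (is_derive_unique _ _ _ Hx), (is_derive_unique _ _ _ Hy), (is_derive_unique _ _ _ HU),
    (is_derive_unique _ _ _ HV).
  unfold Rsqr, Rdiv. field. split; nra.
Qed.

(** The equation [power_rec] carries a factor [t] and says nothing about the
    derivative at [t = 0]. *)
Lemma constant_off_0 (f : R -> R) :
  (forall t, Rabs t < 1 -> exists l, is_derive f t l /\ (t <> 0 -> l = 0)) ->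
  forall t, Rabs t < 1 -> f t = f 0.
Proof.
intros H t Ht.
assert (Hin : forall z, Rmin 0 t <= z <= Rmax 0 t -> Rabs z < 1).
{ intros z. unfold Rmin, Rmax. destruct (Rle_dec 0 t); intro; apply Rabs_lt_between;
  apply Rabs_lt_between in Ht; lra. }
destruct (MVT_gen f 0 t (fun _ => 0)) as [z [_ E]].
- intros z Hz. destruct (H z) as [l [Hl E]]; [apply Hin; lra|].
  rewrite <- E; [exact Hl|]. unfold Rmin, Rmax in Hz. destruct (Rle_dec 0 t); lra.
- intros z Hz. destruct (H z) as [l [Hl _]]; [apply Hin; exact Hz|].
  apply continuity_pt_filterlim. apply (ex_derive_continuous (V := R_NormedModule) f). now exists l.
- lra.
Qed.

Lemma Rpower_log_mod x al : 0 < x -> Rpower x al = exp (al * log_mod x 0).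
Proof.
intro H. unfold Rpower, log_mod. do 2 f_equal.
replace (x * x + 0 * 0) with (x * x) by ring. rewrite ln_mult by lra. field.
Qed.

(** As long as [p] stays in the right half-plane, [atan (Im p / Re p)] is its
    argument, and the product of the series with [p^(- al)] is constant along the
    ray because both factors obey the same differential equation. *)
Lemma power_series_polar al p c th t :
  on_disc p -> on_disc c -> power_rec al p c ->
  (forall s, Rabs s < 1 -> 0 < ray_re th p s) ->
  c 0%nat = Rpower (p 0%nat) al -> Rabs t < 1 ->
  let L := log_mod (ray_re th p t) (ray_im th p t) in
  let phi := atan (ray_im th p t / ray_re th p t) in
  ray_re th c t = exp (al * L) * cos (al * phi) /\
  ray_im th c t = exp (al * L) * sin (al * phi).
Proof.
intros Hp Hc Hrec Hpos H0 Ht L phi.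
assert (Hpe := on_disc_theta_coefs p Hp). assert (Hce := on_disc_theta_coefs c Hc).
set (x := ray_re th p) in *. set (y := ray_im th p) in *.
set (U := ray_re th c) in *. set (V := ray_im th c) in *.
set (K := fun (F G : R -> R) s => exp (- al * log_mod (x s) (y s)) *
      (F s * cos (al * atan (y s / x s)) + G s * sin (al * atan (y s / x s)))).
assert (Hode : forall s, Rabs s < 1 -> exists x' y' U' V',
   is_derive x s x' /\ is_derive y s y' /\ is_derive U s U' /\ is_derive V s V' /\
   (s <> 0 ->
    U' * (x s * x s + y s * y s) = al * ((x s * x' + y s * y') * U s - (x s * y' - y s * x') * V s) /\
    V' * (x s * x s + y s * y s) = al * ((x s * x' + y s * y') * V s + (x s * y' - y s * x') * U s))).
{ intros s Hs.
  destruct (is_derive_ray_re th p s Hp Hs) as [x' [Hx Ex]].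
  destruct (is_derive_ray_im th p s Hp Hs) as [y' [Hy Ey]].
  destruct (is_derive_ray_re th c s Hc Hs) as [U' [HU EU]].
  destruct (is_derive_ray_im th c s Hc Hs) as [V' [HV EV]].
  exists x', y', U', V'. do 4 (split; [assumption|]). intro Hs0. split.
  all: assert (E1 := ray_re_ext th _ _ s Hrec); assert (E2 := ray_im_ext th _ _ s Hrec).
  all: rewrite ray_re_scal, !ray_re_mult, <- Ex, <- Ey, <- EU, <- EV in E1 by auto.
  all: rewrite ray_im_scal, !ray_im_mult, <- Ex, <- Ey, <- EU, <- EV in E2 by auto.
  all: fold x y U V in E1, E2.
  all: assert (F1 : x s * U' - y s * V' = al * (x' * U s - y' * V s))
    by (apply (Rmult_eq_reg_l s); [lra|exact Hs0]).
  all: assert (F2 : x s * V' + y s * U' = al * (x' * V s + y' * U s))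
    by (apply (Rmult_eq_reg_l s); [lra|exact Hs0]).
  - transitivity (x s * (x s * U' - y s * V') + y s * (x s * V' + y s * U')); [ring|].
    rewrite F1, F2. ring.
  - transitivity (x s * (x s * V' + y s * U') - y s * (x s * U' - y s * V')); [ring|].
    rewrite F1, F2. ring. }
assert (KR : forall s, Rabs s < 1 -> K U V s = K U V 0).
{ apply constant_off_0. intros s Hs.
  destruct (Hode s Hs) as (x' & y' & U' & V' & Hx & Hy & HU & HV & E).
  eexists; split; [apply (rotation_derivative al x y U V s x' y' U' V'); auto; now apply Hpos|].
  intro Hs0. destruct (E Hs0) as [E1 E2]. rewrite E1, E2. unfold Rdiv. match goal with |- ?a = ?b => change (@eq R a b) end. ring. }
assert (KI : forall s, Rabs s < 1 -> K V (fun z => - U z) s = K V (fun z => - U z) 0).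
{ apply constant_off_0. intros s Hs.
  destruct (Hode s Hs) as (x' & y' & U' & V' & Hx & Hy & HU & HV & E).
  eexists; split.
  - apply (rotation_derivative al x y V (fun z => - U z) s x' y' V' (- U')); auto.
    apply (is_derive_opp U). exact HU.
  - intro Hs0. destruct (E Hs0) as [E1 E2]. rewrite E2.
    replace (- U' * (x s * x s + y s * y s)) with (- (U' * (x s * x s + y s * y s))) by ring.
    rewrite E1. unfold Rdiv. match goal with |- ?a = ?b => change (@eq R a b) end. ring. }
assert (Hp0 : 0 < p 0%nat).
{ rewrite <- (ray_re_at_0 th p). apply Hpos. rewrite Rabs_R0. lra. }
specialize (KR t Ht). specialize (KI t Ht). unfold K in KR, KI.
assert (X0 : x 0 = p 0%nat) by apply ray_re_at_0. assert (Y0 : y 0 = 0) by apply ray_im_at_0.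
assert (U0 : U 0 = c 0%nat) by apply ray_re_at_0. assert (V0 : V 0 = 0) by apply ray_im_at_0.
rewrite X0, Y0, U0, V0, H0, Rpower_log_mod in KR by exact Hp0.
rewrite X0, Y0, U0, V0, H0, Rpower_log_mod in KI by exact Hp0.
replace (0 / p 0%nat) with 0 in KR, KI by (field; lra).
rewrite atan_0, Rmult_0_r, cos_0, sin_0 in KR, KI.
replace (- al * log_mod (p 0%nat) 0) with (- (al * log_mod (p 0%nat) 0)) in KR, KI by ring.
rewrite exp_Ropp in KR, KI.
assert (Hexp := exp_pos (al * log_mod (p 0%nat) 0)).
change (log_mod (x t) (y t)) with L in KR, KI.
change (atan (y t / x t)) with phi in KR, KI.
replace (- al * L) with (- (al * L)) in KR, KI by ring.
rewrite exp_Ropp in KR, KI.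
assert (HL := exp_pos (al * L)).
set (e := exp (al * L)) in *. set (e0 := exp (al * log_mod (p 0%nat) 0)) in *.
assert (KR' : U t * cos (al * phi) + V t * sin (al * phi) = e).
{ apply (Rmult_eq_reg_l (/ e)); [|apply Rinv_neq_0_compat; lra].
  rewrite KR. field. lra. }
assert (KI' : V t * cos (al * phi) - U t * sin (al * phi) = 0).
{ apply (Rmult_eq_reg_l (/ e)); [|apply Rinv_neq_0_compat; lra].
  transitivity (/ e * (V t * cos (al * phi) + - U t * sin (al * phi))); [ring|].
  rewrite KI. field. lra. }
assert (CS := sin2_cos2 (al * phi)). unfold Rsqr in CS.
set (C := cos (al * phi)) in *. set (S := sin (al * phi)) in *.
split.
- transitivity (U t * (S * S + C * C)); [rewrite CS; ring|].
  transitivity ((U t * C + V t * S) * C - (V t * C - U t * S) * S); [ring|]. rewrite KR', KI'. ring.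
- transitivity (V t * (S * S + C * C)); [rewrite CS; ring|].
  transitivity ((U t * C + V t * S) * S + (V t * C - U t * S) * C); [ring|]. rewrite KR', KI'. ring.
Qed.

(** Course-of-values recursion: stage [n] is a function that holds the
    coefficients with index at most [n]. *)
Fixpoint power_coefs_upto (al : R) (p : nat -> R) (n : nat) : nat -> R :=
  match n with
  | O => fun _ => Rpower (p O) al
  | S n' => fun m =>
      if Nat.leb m n' then power_coefs_upto al p n' m
      else - sum_f_R0 (fun i => p (S i) * ((INR (n' - i) - al * INR (S i))
                                   * power_coefs_upto al p n' (n' - i))) n'
           / (p O * INR (S n'))
  end.

Definition power_coefs al p n := power_coefs_upto al p n n.

Lemma power_coefs_upto_eq al p n m : (m <= n)%nat ->
  power_coefs_upto al p n m = power_coefs al p m.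
Proof.
induction n as [|n IH]; intro H.
- now replace m with O by lia.
- destruct (Nat.eq_dec m (S n)) as [->|Hm]; [reflexivity|].
  simpl. rewrite (proj2 (Nat.leb_le m n)) by lia. apply IH. lia.
Qed.

Lemma power_coefs_S al p n :
  power_coefs al p (S n) =
  - sum_f_R0 (fun i => p (S i) * ((INR (n - i) - al * INR (S i)) * power_coefs al p (n - i))) n
           / (p O * INR (S n)).
Proof.
unfold power_coefs at 1. cbn [power_coefs_upto]. rewrite (proj2 (Nat.leb_gt (S n) n)) by lia.
do 2 f_equal. apply sum_eq. intros i Hi. rewrite power_coefs_upto_eq by lia. reflexivity.
Qed.

Lemma power_coefs_rec al p : p O <> 0 -> power_rec al p (power_coefs al p).
Proof.
intros Hp n. unfold PS_mult, theta_coefs.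
apply Rminus_diag_uniq. rewrite scal_sum, <- minus_sum.
destruct n as [|n].
- simpl. ring.
- rewrite decomp_sum by lia. simpl pred. rewrite Nat.sub_0_r, power_coefs_S.
  match goal with |- ?a + ?b = 0 => replace b with
   (sum_f_R0 (fun i => p (S i) * ((INR (n - i) - al * INR (S i)) * power_coefs al p (n - i))) n) end.
  + set (s := sum_f_R0 _ _). assert (INR (S n) <> 0) by (apply not_0_INR; lia).
    simpl (INR 0). field. auto.
  + apply sum_eq. intros i Hi. change (S n - S i)%nat with (n - i)%nat. ring.
Qed.

(** In the recurrence for [n p_0 c_n] the coefficient [p_i c_{n-i}] carries the
    weight [|n - i - al i|], which is at most [n] when [|al| <= 1].  Hence the
    dominance of [p_0] keeps every coefficient below the largest earlier one. *)
Lemma power_coefs_bounded al p :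
  -1 <= al <= 1 -> 0 < p O ->
  (forall n, sum_f_R0 (fun i => Rabs (p (S i))) n <= p O) ->
  forall n, Rabs (power_coefs al p n) <= Rpower (p O) al.
Proof.
intros Ha Hp Hs n. induction n as [n IH] using (well_founded_induction lt_wf).
assert (HR : 0 < Rpower (p O) al) by apply exp_pos.
destruct n as [|n].
- unfold power_coefs; simpl. rewrite Rabs_right; lra.
- rewrite power_coefs_S. assert (Hn : 0 < INR (S n)) by (apply lt_0_INR; lia).
  unfold Rdiv. rewrite Rabs_mult, Rabs_Ropp, Rabs_inv, (Rabs_right (_ * _)) by nra.
  apply Rmult_le_reg_r with (p O * INR (S n)); [nra|].
  rewrite Rmult_assoc, Rinv_l, Rmult_1_r by nra.
  apply Rle_trans with (sum_f_R0 (fun i => Rabs (p (S i)) * (INR (S n) * Rpower (p O) al)) n).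
  + apply Rle_trans with (1 := Rsum_abs _ _). apply sum_Rle. intros i Hi.
    rewrite !Rabs_mult. apply Rmult_le_compat_l; [apply Rabs_pos|].
    apply Rmult_le_compat; try apply Rabs_pos; [|apply IH; lia].
    replace (INR (S n)) with (INR (n - i) + INR (S i)) by (rewrite <- plus_INR; f_equal; lia).
    assert (0 <= INR (n - i)) by apply pos_INR. assert (0 <= INR (S i)) by apply pos_INR.
    apply Rabs_le. split; nra.
  + rewrite <- scal_sum. specialize (Hs n).
    assert (0 < INR (S n) * Rpower (p O) al) by nra. nra.
Qed.

(** * The sector containing the values of the symbol *)

(** With [z = 1 - w] one has [delta z = w + w^2/2 + w^3/3 + w^4/4].  For
    [w = A - i v] the real part is [delta_re A (v^2)] and the imaginary part is
    [- v * delta_im A (v^2)]. *)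
Definition delta_re (A w : R) : R :=
  A + (A^2 - w)/2 + (A^3 - 3*A*w)/3 + (A^4 - 6*A^2*w + w^2)/4.
Definition delta_im (A w : R) : R := 1 + A + A^2 + A^3 - (1/3 + A) * w.

(** On the unit circle both terms become polynomials in [A = 1 - cos theta] up
    to the factor [v].  The difference of their squares has a double root at
    [A = 4/5], the point where the boundary curve touches the sector; this is
    what fixes [k^2 = 699^2 * 6 / 512^2]. *)
Lemma sector_circle k A v : 0 <= k -> k^2 = 2931606/262144 -> 0 <= v -> 0 <= A ->
  v^2 = 2 * A - A^2 -> 0 <= k * delta_re A (v^2) + v * delta_im A (v^2).
Proof.
intros Hk Hk2 Hv HA Hv2. unfold delta_re, delta_im. rewrite Hv2.
set (Y := 1 + A/3 - 2/3*A^2 + 2*A^3).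
assert (HY : 0 < Y) by (unfold Y; assert (0 <= A^3) by (apply pow_le; lra);
  assert (0 <= A * (3*A - 1)^2) by (apply Rmult_le_pos; [lra|apply pow2_ge_0]); nra).
set (X := A^3 * (8/3 - 2*A)).
replace (k * _ + v * _) with (v * Y - k * X) by (unfold X, Y; field).
destruct (Rle_lt_dec (4/3) A) as [h|h].
{ assert (X <= 0) by (unfold X; assert (0 <= A^3) by (apply pow_le; lra); nra). nra. }
assert (HX : 0 <= X) by (unfold X; apply Rmult_le_pos; [apply pow_le|]; lra).
assert (E : (v * Y)^2 - (k * X)^2 = A * ((A - 4/5)^2 *
  (25/8 + 25/3*A + 12775/1152*A^2 + 63875/2304*A^3 + 319375/6144*A^4 - 1596875/32768*A^5))).
{ rewrite !Rpow_mult_distr, Hk2, Hv2. unfold X, Y. field. }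
assert (0 <= 25/8 + 25/3*A + 12775/1152*A^2 + 63875/2304*A^3 + 319375/6144*A^4 - 1596875/32768*A^5).
{ assert (0 <= A^2) by apply pow2_ge_0. assert (0 <= A^3) by (apply pow_le; lra).
  assert (A^5 <= 4/3 * A^4) by (assert (0 <= A^4) by (apply pow_le; lra); simpl in *; nra).
  assert (A^4 <= 4/3 * A^3) by (simpl in *; nra). lra. }
assert (0 <= (v*Y)^2 - (k*X)^2).
{ rewrite E. apply Rmult_le_pos; [lra|]. apply Rmult_le_pos; [apply pow2_ge_0|assumption]. }
assert (0 <= v * Y) by nra. assert (0 <= k * X) by nra.
apply Rnot_lt_le. intro. nra.
Qed.

Lemma delta_im_nonneg A v : 0 <= A -> v^2 <= 2 * A - A^2 -> 0 <= delta_im A (v^2).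
Proof.
intros HA Hv. unfold delta_im. set (w := v^2) in *.
assert (0 <= A^3) by (apply pow_le; lra).
assert (0 <= A * (3*A - 1)^2) by (apply Rmult_le_pos; [lra|apply pow2_ge_0]).
assert ((1/3 + A) * w <= (1/3 + A) * (2 * A - A^2)) by (apply Rmult_le_compat_l; lra). nra.
Qed.

(** For fixed [A] the expression is concave in [v] between the real axis
    ([v = 0]) and the unit circle ([v = m]), hence at least the smaller of its
    values at these two points. *)
Lemma sector_disc k A v : 0 <= k -> k^2 = 2931606/262144 -> 0 <= v -> 0 <= A ->
  v^2 <= 2 * A - A^2 -> 0 <= k * delta_re A (v^2) + v * delta_im A (v^2).
Proof.
intros Hk Hk2 Hv HA Hv2.
assert (H0 : 0 <= 2 * A - A^2) by (assert (0 <= v^2) by apply pow2_ge_0; lra).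
set (m := sqrt (2 * A - A^2)).
assert (Hm : m^2 = 2 * A - A^2) by (unfold m; rewrite <- Rsqr_pow2; apply Rsqr_sqrt; exact H0).
assert (Hm0 : 0 <= m) by apply sqrt_pos.
assert (Hvm : v <= m) by (apply Rsqr_incr_0; [rewrite !Rsqr_pow2; lra|lra|lra]).
assert (Harc := sector_circle k A m Hk Hk2 Hm0 HA Hm).
destruct (Req_dec m 0) as [E|E].
{ replace v with m by lra. exact Harc. }
assert (0 < m) by lra.
assert (Hseg : 0 <= k * delta_re A 0).
{ unfold delta_re. apply Rmult_le_pos; [exact Hk|].
  assert (0 <= A^2) by apply pow2_ge_0. assert (0 <= A^3) by (apply pow_le; lra).
  assert (0 <= A^4) by (apply pow_le; lra). lra. }
set (h := fun x => k * delta_re A (x^2) + x * delta_im A (x^2)).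
fold (h m) in Harc. change (0 <= h v).
(* [m] times the distance of the graph to its chord *)
assert (Hchord : m * h v - ((m - v) * (k * delta_re A 0) + v * h m) =
  m * v * (m - v) * (k * (1/2 + A + 3/2*A^2 - (m^2 + m * v + v^2)/4) + (1/3 + A) * (m + v))).
{ unfold h, delta_re, delta_im. field. }
assert (0 <= 1/2 + A + 3/2*A^2 - (m^2 + m * v + v^2)/4) by (assert (0 <= A^2) by apply pow2_ge_0; nra).
assert (0 <= m * v * (m - v) * (k * (1/2 + A + 3/2*A^2 - (m^2 + m * v + v^2)/4) + (1/3 + A) * (m + v))).
{ apply Rmult_le_pos; [apply Rmult_le_pos; [apply Rmult_le_pos|]; lra|].
  apply Rplus_le_le_0_compat; apply Rmult_le_pos; lra. }
assert (0 <= (m - v) * (k * delta_re A 0) + v * h m)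
  by (apply Rplus_le_le_0_compat; apply Rmult_le_pos; lra).
apply (Rmult_le_reg_l m); [lra|]. lra.
Qed.

Lemma atan_polar x y : 0 < x ->
  x = exp (log_mod x y) * cos (atan (y / x)) /\ y = exp (log_mod x y) * sin (atan (y / x)).
Proof.
intro Hx. set (phi := atan (y / x)).
assert (Hc : 0 < cos phi).
{ destruct (atan_bound (y / x)). apply cos_gt_0; unfold phi; lra. }
assert (Ht : sin phi = y / x * cos phi).
{ rewrite <- (tan_atan (y / x)). fold phi. unfold tan. field. lra. }
assert (Hn : x * x + y * y > 0) by nra.
assert (He : exp (log_mod x y) * exp (log_mod x y) = x * x + y * y).
{ rewrite <- exp_plus. unfold log_mod. replace (_ / 2 + _ / 2) with (ln (x * x + y * y)) by field.
  apply exp_ln. lra. }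
assert (He0 := exp_pos (log_mod x y)). set (e := exp (log_mod x y)) in *.
assert (CS := sin2_cos2 phi). unfold Rsqr in CS. rewrite Ht in CS.
assert (Hxc : x = e * cos phi).
{ assert (x * x = (e * cos phi) * (e * cos phi)).
  { transitivity ((x * x + y * y) * (cos phi * cos phi)); [|rewrite <- He; ring].
    apply (Rmult_eq_reg_l (/ (x * x))); [|apply Rinv_neq_0_compat; nra].
    transitivity (y / x * cos phi * (y / x * cos phi) + cos phi * cos phi); [|field; lra].
    rewrite CS. field. lra. }
  assert (0 < e * cos phi) by nra. nra. }
split; [exact Hxc|]. rewrite Ht.
transitivity (y / x * x); [field; lra|]. rewrite Hxc at 2. ring.
Qed.

Lemma atan_lt_PI4 x y : 0 < x -> Rabs y < x -> Rabs (atan (y / x)) < PI / 4.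
Proof.
intros Hx Hy. apply Rabs_lt_between in Hy. rewrite <- atan_1.
apply Rabs_lt_between. rewrite <- atan_opp. split; apply atan_increasing.
- apply (Rmult_lt_reg_r x); [lra|]. unfold Rdiv. rewrite Rmult_assoc, Rinv_l; lra.
- apply (Rmult_lt_reg_r x); [lra|]. unfold Rdiv. rewrite Rmult_assoc, Rinv_l; lra.
Qed.

(** Since [k = tan (atan k)], the hypothesis says that
    [sin (|phi| + atan k) >= 0]. *)
Lemma arg_bound k phi : 0 < k -> Rabs phi < PI -> 0 <= k * cos phi + Rabs (sin phi) ->
  Rabs phi <= PI - atan k.
Proof.
intros Hk Hphi H.
assert (E : k * cos (Rabs phi) + sin (Rabs phi) = k * cos phi + Rabs (sin phi)).
{ destruct (Rle_lt_dec 0 phi) as [h|h].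
  - rewrite (Rabs_right phi) in * by lra. rewrite (Rabs_right (sin phi)); [reflexivity|].
    apply Rle_ge, sin_ge_0; lra.
  - rewrite (Rabs_left phi) in * by lra. rewrite cos_neg, sin_neg, Rabs_left1; [ring|].
    assert (0 <= sin (- phi)) by (apply sin_ge_0; lra). rewrite sin_neg in *. lra. }
rewrite <- E in H. assert (H0 := Rabs_pos phi). set (q := Rabs phi) in *.
apply Rnot_lt_le. intro Hq.
assert (B := atan_bound k). assert (0 < atan k) by (rewrite <- atan_0; apply atan_increasing; lra).
assert (Hc : 0 < cos (atan k)) by (apply cos_gt_0; lra).
assert (Ht : sin (atan k) = k * cos (atan k)).
{ rewrite <- (tan_atan k) at 2. unfold tan. field. lra. }
assert (sin (q + atan k) < 0) by (apply sin_lt_0; lra).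
rewrite sin_plus, Ht in *. nra.
Qed.

(** * Positivity of the real part of the symbol *)

(** [delta = factor1 * factor2 / factor3].  The cubic
    [delta / (1 - z) = (25 - 23 z + 13 z^2 - 3 z^3) / 12] does not have a
    dominating constant term, but its product [factor2] with [2 + z] does. *)
Definition factor1 (n : nat) : R := match n with 0 => 1 | 1 => -1 | _ => 0 end.
Definition factor2 (n : nat) : R :=
  match n with 0 => 50/12 | 1 => -21/12 | 2 => 3/12 | 3 => 7/12 | 4 => -3/12 | _ => 0 end.
Definition factor3 (n : nat) : R := match n with 0 => 2 | 1 => 1 | _ => 0 end.

Lemma on_disc_factor1 : on_disc factor1.
Proof. apply (on_disc_bounded _ 1). intros [|[|n]]; simpl; apply Rabs_le; lra. Qed.
Lemma on_disc_factor2 : on_disc factor2.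
Proof. apply (on_disc_bounded _ 5). intros [|[|[|[|[|n]]]]]; simpl; apply Rabs_le; lra. Qed.
Lemma on_disc_factor3 : on_disc factor3.
Proof. apply (on_disc_bounded _ 2). intros [|[|n]]; simpl; apply Rabs_le; lra. Qed.

Lemma Series_finite a d : (forall n, (d < n)%nat -> a n = 0) -> Series a = sum_f_R0 a d.
Proof.
intro H. apply is_series_unique. rewrite <- sum_n_Reals.
apply (is_lim_seq_ext_loc (fun _ => sum_n a d) _ (Finite (sum_n a d))).
- exists d. intros n Hn. induction Hn; [reflexivity|].
  rewrite sum_Sn, <- IHHn, H by lia. unfold plus; simpl. rewrite Rplus_0_r. reflexivity.
- apply is_lim_seq_const.
Qed.

Lemma PSeries_finite a d t : (forall n, (d < n)%nat -> a n = 0) ->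
  PSeries a t = sum_f_R0 (fun k => a k * t ^ k) d.
Proof. intro H. apply Series_finite. intros n Hn. rewrite H by exact Hn. ring. Qed.

Lemma ray_re_finite th p t : (forall n, (4 < n)%nat -> p n = 0) ->
  ray_re th p t = sum_f_R0 (fun k => p k * (t ^ k * cos (INR k * th))) 4.
Proof.
intro H. unfold ray_re. rewrite (PSeries_finite _ 4).
- apply sum_eq. intros; unfold twist_cos; ring.
- intros n Hn. unfold twist_cos. rewrite H by exact Hn. ring.
Qed.
Lemma ray_im_finite th p t : (forall n, (4 < n)%nat -> p n = 0) ->
  ray_im th p t = sum_f_R0 (fun k => p k * (t ^ k * sin (INR k * th))) 4.
Proof.
intro H. unfold ray_im. rewrite (PSeries_finite _ 4).
- apply sum_eq. intros; unfold twist_sin; ring.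
- intros n Hn. unfold twist_sin. rewrite H by exact Hn. ring.
Qed.
Lemma factor1_deg n : (4 < n)%nat -> factor1 n = 0.
Proof. destruct n as [|[|n]]; [lia|lia|reflexivity]. Qed.
Lemma factor2_deg n : (4 < n)%nat -> factor2 n = 0.
Proof. destruct n as [|[|[|[|[|n]]]]]; try lia; reflexivity. Qed.
Lemma factor3_deg n : (4 < n)%nat -> factor3 n = 0.
Proof. destruct n as [|[|n]]; [lia|lia|reflexivity]. Qed.

(** The exact bound is [sqrt 2 < 10/7]. *)
Lemma cos_sin_bound t k th : Rabs t < 1 ->
  -10/7 <= t^k * cos (INR k * th) + t^k * sin (INR k * th) <= 10/7 /\
  -10/7 <= t^k * cos (INR k * th) - t^k * sin (INR k * th) <= 10/7.
Proof.
intro Ht. set (b := INR k * th).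
assert (H : (t^k)^2 <= 1).
{ rewrite <- pow2_abs, <- RPow_abs. assert (0 <= Rabs t) by apply Rabs_pos.
  assert (0 <= Rabs t ^ k) by (apply pow_le; lra).
  assert (Rabs t ^ k <= 1) by (rewrite <- (pow1 k); apply pow_incr; lra). nra. }
assert (CS := sin2_cos2 b). unfold Rsqr in CS.
set (C := t^k * cos b). set (S := t^k * sin b).
assert (C*C + S*S <= 1).
{ unfold C, S. apply Rle_trans with ((t^k)^2 * (sin b * sin b + cos b * cos b)); [right; ring|rewrite CS; lra]. }
clearbody C S.
assert (H1 := pow2_ge_0 (C - S)). assert (H2 := pow2_ge_0 (C + S)).
assert (P : (C + S)^2 <= (10/7)^2) by lra. assert (M : (C - S)^2 <= (10/7)^2) by lra.
rewrite <- !Rsqr_pow2 in P, M. apply Rsqr_le_abs_0 in P. apply Rsqr_le_abs_0 in M.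
rewrite (Rabs_right (10/7)) in P, M by lra. apply Rabs_le_between in P. apply Rabs_le_between in M.
lra.
Qed.

(** The other coefficients add up to [34/12 < (7/10) (50/12)], so the values lie
    within [PI / 4] of the positive axis. *)
Lemma factor2_im_lt_re th t : Rabs t < 1 -> Rabs (ray_im th factor2 t) < ray_re th factor2 t.
Proof.
intro Ht. rewrite (ray_re_finite th factor2 t factor2_deg), (ray_im_finite th factor2 t factor2_deg).
assert (H := fun k => cos_sin_bound t k th Ht).
cbn [sum_f_R0 factor2].
apply Rabs_def1; destruct (H 1%nat), (H 2%nat), (H 3%nat), (H 4%nat);
 change (t^0) with 1; change (INR 0) with 0; rewrite (Rmult_0_l th), cos_0, sin_0; lra.
Qed.
Lemma factor3_im_lt_re th t : Rabs t < 1 -> Rabs (ray_im th factor3 t) < ray_re th factor3 t.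
Proof.
intro Ht. rewrite (ray_re_finite th factor3 t factor3_deg), (ray_im_finite th factor3 t factor3_deg).
assert (H := fun k => cos_sin_bound t k th Ht).
cbn [sum_f_R0 factor3].
apply Rabs_def1; destruct (H 1%nat);
 change (t^0) with 1; change (INR 0) with 0; rewrite (Rmult_0_l th), cos_0, sin_0; lra.
Qed.
Lemma factor1_re_pos th t : Rabs t < 1 -> 0 < ray_re th factor1 t.
Proof.
intro Ht. rewrite (ray_re_finite th factor1 t factor1_deg). cbn [sum_f_R0 factor1].
change (t^0) with 1; change (INR 0) with 0; change (INR 1) with 1.
rewrite (Rmult_0_l th), (Rmult_1_l th), cos_0, pow_1.
assert (Hc : Rabs (t * cos th) < 1).
{ rewrite Rabs_mult. assert (Rabs (cos th) <= 1) by (apply Rabs_le, COS_bound).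
  assert (P := Rabs_pos t). assert (Q := Rabs_pos (cos th)). nra. }
apply Rabs_lt_between in Hc. lra.
Qed.
Lemma factor2_re_pos th t : Rabs t < 1 -> 0 < ray_re th factor2 t.
Proof. intro Ht. apply Rle_lt_trans with (2 := factor2_im_lt_re th t Ht), Rabs_pos. Qed.
Lemma factor3_re_pos th t : Rabs t < 1 -> 0 < ray_re th factor3 t.
Proof. intro Ht. apply Rle_lt_trans with (2 := factor3_im_lt_re th t Ht), Rabs_pos. Qed.

Lemma factor_values th t :
  let X := t * cos th in let V := t * sin th in
  (ray_re th factor1 t = 1 - X /\ ray_im th factor1 t = - V) /\
  (ray_re th factor2 t = (50 - 21*X + 3*(X^2 - V^2) + 7*(X^3 - 3*X*V^2) - 3*(X^4 - 6*X^2*V^2 + V^4))/12 /\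
   ray_im th factor2 t = (-21*V + 6*X*V + 7*(3*X^2*V - V^3) - 3*(4*X^3*V - 4*X*V^3))/12) /\
  (ray_re th factor3 t = 2 + X /\ ray_im th factor3 t = V).
Proof.
intros X V.
rewrite !(ray_re_finite th _ t factor1_deg), !(ray_re_finite th _ t factor2_deg), !(ray_re_finite th _ t factor3_deg).
rewrite !(ray_im_finite th _ t factor1_deg), !(ray_im_finite th _ t factor2_deg), !(ray_im_finite th _ t factor3_deg).
cbn [sum_f_R0 factor1 factor2 factor3].
assert (E2 : INR 2 * th = th + th) by (simpl; ring).
assert (E3 : INR 3 * th = th + th + th) by (simpl; ring).
assert (E4 : INR 4 * th = (th + th) + (th + th)) by (simpl; ring).
rewrite E2, E3, E4, ?cos_plus, ?sin_plus, ?cos_plus, ?sin_plus.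
change (INR 0) with 0. change (INR 1) with 1. rewrite (Rmult_0_l th), (Rmult_1_l th), cos_0, sin_0.
unfold X, V. repeat split; field.
Qed.

Definition delta_coefs (al : R) : nat -> R :=
  PS_mult (power_coefs al factor1) (PS_mult (power_coefs al factor2) (power_coefs (- al) factor3)).

Lemma on_disc_power_coefs al p : -1 <= al <= 1 -> 0 < p O ->
  (forall n, sum_f_R0 (fun i => Rabs (p (S i))) n <= p O) -> on_disc (power_coefs al p).
Proof. intros Ha H0 Hs. apply (on_disc_bounded _ (Rpower (p O) al)), power_coefs_bounded; auto. Qed.

Lemma sum_abs_finite (p : nat -> R) : (forall n, (4 < n)%nat -> p n = 0) ->
  forall n, sum_f_R0 (fun i => Rabs (p (S i))) n <= Rabs (p 1%nat) + Rabs (p 2%nat) + Rabs (p 3%nat) + Rabs (p 4%nat).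
Proof.
intros H n.
assert (P := fun i => Rabs_pos (p i)).
destruct n as [|[|[|n]]]; [simpl; generalize (P 2%nat) (P 3%nat) (P 4%nat); lra..|].
induction n as [|n IH]; [simpl; lra|].
rewrite tech5, (H (S (S (S (S (S n)))))), Rabs_R0 by lia. lra.
Qed.

Lemma on_disc_power_factor1 al : -1 <= al <= 1 -> on_disc (power_coefs al factor1).
Proof.
intro Ha. apply on_disc_power_coefs; [exact Ha|simpl; lra|]. intro n.
eapply Rle_trans; [apply (sum_abs_finite factor1 factor1_deg)|]. simpl. rewrite Rabs_R0, Rabs_left; lra.
Qed.
Lemma on_disc_power_factor2 al : -1 <= al <= 1 -> on_disc (power_coefs al factor2).
Proof.
intro Ha. apply on_disc_power_coefs; [exact Ha|simpl; lra|]. intro n.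
eapply Rle_trans; [apply (sum_abs_finite factor2 factor2_deg)|]. simpl.
rewrite (Rabs_left (-21/12)), (Rabs_right (3/12)), (Rabs_right (7/12)), (Rabs_left (-3/12)); lra.
Qed.
Lemma on_disc_power_factor3 al : -1 <= al <= 1 -> on_disc (power_coefs al factor3).
Proof.
intro Ha. apply on_disc_power_coefs; [exact Ha|simpl; lra|]. intro n.
eapply Rle_trans; [apply (sum_abs_finite factor3 factor3_deg)|]. simpl. rewrite Rabs_R0, Rabs_right; lra.
Qed.

Lemma on_disc_delta_coefs al : -1 <= al <= 1 -> on_disc (delta_coefs al).
Proof.
intro Ha. apply on_disc_mult; [now apply on_disc_power_factor1|].
apply on_disc_mult; [now apply on_disc_power_factor2|apply on_disc_power_factor3; lra].
Qed.

(** The arguments of the three factors are at most [PI/2], [PI/4] and [PI/4], so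
    [phi], their signed sum, is the principal argument of [delta]: the value of
    the series is the principal power, without any correction by multiples of
    [2 PI]. *)
Lemma ray_re_delta_coefs al th t : -1 <= al <= 1 -> Rabs t < 1 ->
  exists e m phi, 0 < e /\ 0 < m /\ Rabs phi < PI /\
   m * cos phi = delta_re (1 - t * cos th) ((t * sin th)^2) /\
   m * sin phi = - (t * sin th) * delta_im (1 - t * cos th) ((t * sin th)^2) /\
   ray_re th (delta_coefs al) t = e * cos (al * phi).
Proof.
intros Ha Ht.
assert (D1 := on_disc_power_factor1 al Ha). assert (D2 := on_disc_power_factor2 al Ha).
assert (D3 := on_disc_power_factor3 (- al) ltac:(lra)).
assert (P1 := power_series_polar al factor1 _ th t on_disc_factor1 D1
  (power_coefs_rec al factor1 ltac:(simpl; lra)) (factor1_re_pos th) eq_refl Ht).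
assert (P2 := power_series_polar al factor2 _ th t on_disc_factor2 D2
  (power_coefs_rec al factor2 ltac:(simpl; lra)) (factor2_re_pos th) eq_refl Ht).
assert (P3 := power_series_polar (- al) factor3 _ th t on_disc_factor3 D3
  (power_coefs_rec (- al) factor3 ltac:(simpl; lra)) (factor3_re_pos th) eq_refl Ht).
cbv zeta in P1, P2, P3.
destruct (atan_polar _ (ray_im th factor1 t) (factor1_re_pos th t Ht)) as [X1 Y1].
destruct (atan_polar _ (ray_im th factor2 t) (factor2_re_pos th t Ht)) as [X2 Y2].
destruct (atan_polar _ (ray_im th factor3 t) (factor3_re_pos th t Ht)) as [X3 Y3].
assert (A1 := atan_bound (ray_im th factor1 t / ray_re th factor1 t)).
assert (A2 := atan_lt_PI4 _ _ (factor2_re_pos th t Ht) (factor2_im_lt_re th t Ht)).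
assert (A3 := atan_lt_PI4 _ _ (factor3_re_pos th t Ht) (factor3_im_lt_re th t Ht)).
destruct (factor_values th t) as [[Vx1 Vy1] [[Vx2 Vy2] [Vx3 Vy3]]].
set (f1 := atan (ray_im th factor1 t / ray_re th factor1 t)) in *.
set (f2 := atan (ray_im th factor2 t / ray_re th factor2 t)) in *.
set (f3 := atan (ray_im th factor3 t / ray_re th factor3 t)) in *.
set (L1 := log_mod (ray_re th factor1 t) (ray_im th factor1 t)) in *.
set (L2 := log_mod (ray_re th factor2 t) (ray_im th factor2 t)) in *.
set (L3 := log_mod (ray_re th factor3 t) (ray_im th factor3 t)) in *.
exists (exp (al * L1) * exp (al * L2) * exp (- al * L3)), (exp L1 * exp L2 / exp L3), (f1 + f2 - f3).
assert (e1 := exp_pos L1). assert (e2 := exp_pos L2). assert (e3 := exp_pos L3).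
split; [repeat apply Rmult_lt_0_compat; apply exp_pos|].
split; [apply Rmult_lt_0_compat; [nra|now apply Rinv_0_lt_compat]|].
split; [apply Rabs_lt_between in A2; apply Rabs_lt_between in A3; apply Rabs_lt_between; lra|].
set (X := t * cos th) in *. set (V := t * sin th) in *.
assert (Q3 : sin f3 * sin f3 + cos f3 * cos f3 = 1) by apply sin2_cos2.
set (c3 := cos f3) in *. set (s3 := sin f3) in *.
set (dx := delta_re (1 - X) (V^2)). set (dy := - V * delta_im (1 - X) (V^2)).
rewrite Vx1 in X1. rewrite Vx2 in X2. rewrite Vx3 in X3.
rewrite Vy1 in Y1. rewrite Vy2 in Y2. rewrite Vy3 in Y3.
assert (R1 : exp L1 * exp L2 * cos (f1 + f2) = exp L3 * c3 * dx - exp L3 * s3 * dy).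
{ rewrite <- X3, <- Y3, cos_plus.
  transitivity ((exp L1 * cos f1) * (exp L2 * cos f2) - (exp L1 * sin f1) * (exp L2 * sin f2)); [ring|].
  rewrite <- X1, <- Y1, <- X2, <- Y2. unfold dx, dy, delta_re, delta_im. field. }
assert (R2 : exp L1 * exp L2 * sin (f1 + f2) = exp L3 * c3 * dy + exp L3 * s3 * dx).
{ rewrite <- X3, <- Y3, sin_plus.
  transitivity ((exp L1 * sin f1) * (exp L2 * cos f2) + (exp L1 * cos f1) * (exp L2 * sin f2)); [ring|].
  rewrite <- X1, <- Y1, <- X2, <- Y2. unfold dx, dy, delta_re, delta_im. field. }
split; [|split].
- rewrite cos_minus. fold c3 s3.
  transitivity (/ exp L3 * ((exp L1 * exp L2 * cos (f1 + f2)) * c3 + (exp L1 * exp L2 * sin (f1 + f2)) * s3));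
    [field; lra|]. rewrite R1, R2.
  transitivity (dx * (s3 * s3 + c3 * c3)); [field; lra|rewrite Q3; ring].
- rewrite sin_minus. fold c3 s3.
  transitivity (/ exp L3 * ((exp L1 * exp L2 * sin (f1 + f2)) * c3 - (exp L1 * exp L2 * cos (f1 + f2)) * s3));
    [field; lra|]. rewrite R1, R2.
  transitivity (dy * (s3 * s3 + c3 * c3)); [field; lra|rewrite Q3; ring].
- unfold delta_coefs. rewrite ray_re_mult, ray_re_mult, ray_im_mult by (auto; apply on_disc_mult; auto).
  destruct P1 as [-> ->], P2 as [-> ->], P3 as [-> ->].
  replace (al * (f1 + f2 - f3)) with (al * f1 + (al * f2 + - al * f3)) by ring.
  rewrite (cos_plus (al * f1)), cos_plus, sin_plus. ring.
Qed.

Lemma ray_re_delta_coefs_nonneg al th t : 0 < al <= alpha_max -> Rabs t < 1 ->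
  0 <= ray_re th (delta_coefs al) t.
Proof.
intros Ha Ht.
assert (Hm := alpha_max_approx).
destruct (ray_re_delta_coefs al th t ltac:(lra) Ht) as (e & m & phi & He & Hmm & Hphi & Hc & Hs & ->).
apply Rmult_le_pos; [lra|].
set (k := 699 * sqrt 6 / 512).
assert (Hk : 0 < k) by (unfold k; assert (0 < sqrt 6) by (apply sqrt_lt_R0; lra); lra).
assert (Hk2 : k^2 = 2931606/262144).
{ unfold k. transitivity (699^2 * (sqrt 6 * sqrt 6) / 512^2); [field|]. rewrite sqrt_sqrt by lra. field. }
assert (Hb : Rabs phi <= PI - atan k).
{ apply arg_bound; auto. apply (Rmult_le_reg_l m); [exact Hmm|]. rewrite Rmult_0_r.
  replace (m * (k * cos phi + Rabs (sin phi))) with (k * (m * cos phi) + Rabs (m * sin phi))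
    by (rewrite Rabs_mult, (Rabs_right m) by lra; ring).
  rewrite Hc, Hs, Rabs_mult, Rabs_Ropp.
  set (A := 1 - t * cos th). set (v := t * sin th).
  assert (Hdisc : v^2 <= 2 * A - A^2).
  { assert (CS := sin2_cos2 th). unfold Rsqr in CS. apply Rabs_lt_between in Ht.
    assert (v^2 + (t * cos th)^2 = t^2).
    { unfold v. transitivity (t^2 * (sin th * sin th + cos th * cos th)); [ring|rewrite CS; ring]. }
    unfold A. nra. }
  assert (HA : 0 <= A) by (assert (0 <= v^2) by apply pow2_ge_0; nra).
  assert (Hd := delta_im_nonneg A v HA Hdisc). rewrite (Rabs_right (delta_im _ _)) by lra.
  rewrite <- (pow2_abs v) in Hdisc |- *. apply sector_disc; auto; [lra|apply Rabs_pos]. }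
assert (HB := atan_bound k).
assert (Hal : al * (PI - atan k) <= PI / 2).
{ apply Rle_trans with (alpha_max * (PI - atan k)); [apply Rmult_le_compat_r; lra|].
  unfold alpha_max. fold k. right. field. lra. }
assert (Rabs (al * phi) <= PI / 2).
{ rewrite Rabs_mult, (Rabs_right al) by lra. apply Rle_trans with (2 := Hal).
  apply Rmult_le_compat_l; lra. }
apply Rabs_le_between in H. apply cos_ge_0; lra.
Qed.

Lemma Rabs_lt_1_locally : locally 0 (fun t => Rabs t < 1).
Proof.
exists (mkposreal 1 Rlt_0_1). intros y Hy. unfold ball in Hy; simpl in Hy. unfold AbsRing_ball in Hy.
unfold abs, minus, plus, opp in Hy; simpl in Hy. now rewrite Ropp_0, Rplus_0_r in Hy.
Qed.

Lemma power_coefs_real al p t : on_disc p -> on_disc (power_coefs al p) -> p O <> 0 ->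
  (forall s, Rabs s < 1 -> 0 < ray_re 0 p s) -> Rabs t < 1 ->
  PSeries (power_coefs al p) t = Rpower (PSeries p t) al.
Proof.
intros Hp Hc H0 Hpos Ht.
assert (E0 : forall c, ray_re 0 c t = PSeries c t).
{ intro c. apply PSeries_ext. intro n. unfold twist_cos. rewrite Rmult_0_r, cos_0. ring. }
assert (I0 : ray_im 0 p t = 0).
{ unfold ray_im. rewrite (PSeries_ext _ (fun _ => 0)), PSeries_const_0; [reflexivity|].
  intro n. unfold twist_sin. rewrite Rmult_0_r, sin_0. ring. }
destruct (power_series_polar al p _ 0 t Hp Hc (power_coefs_rec al p H0) Hpos eq_refl Ht) as [E _].
rewrite !E0, I0 in E. rewrite E, <- Rpower_log_mod by (rewrite <- E0; auto).
unfold Rdiv. rewrite Rmult_0_l, atan_0, Rmult_0_r, cos_0. ring.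
Qed.

(** Near 0 the two functions agree on the real axis, so they have the same
    derivatives at 0. *)
Lemma varpi4_delta_coefs al l : -1 <= al <= 1 -> varpi4 al l = delta_coefs al l.
Proof.
intro Ha. unfold varpi4.
assert (Hf : INR (Factorial.fact l) <> 0) by apply INR_fact_neq_0.
rewrite (Derive_n_ext_loc _ (PSeries (delta_coefs al))).
- rewrite Derive_n_coef; [field; exact Hf|].
  rewrite <- Rabs_R0. apply on_disc_delta_coefs; [exact Ha|]. rewrite Rabs_R0; lra.
- apply (filter_imp (fun t => Rabs t < 1)); [|exact Rabs_lt_1_locally].
  intros t Ht.
  assert (D1 := on_disc_power_factor1 al Ha). assert (D2 := on_disc_power_factor2 al Ha).
  assert (D3 := on_disc_power_factor3 (- al) ltac:(lra)).
  unfold delta_coefs. rewrite !PSeries_mult by (auto; apply on_disc_mult; auto).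
  assert (E0 : forall c, ray_re 0 c t = PSeries c t).
  { intro c. apply PSeries_ext. intro n. unfold twist_cos. rewrite Rmult_0_r, cos_0. ring. }
  rewrite (power_coefs_real al factor1), (power_coefs_real al factor2), (power_coefs_real (- al) factor3);
    auto using on_disc_factor1, on_disc_factor2, on_disc_factor3, factor1_re_pos, factor2_re_pos, factor3_re_pos; try (simpl; lra).
  rewrite <- !E0.
  assert (Q1 := factor1_re_pos 0 t Ht). assert (Q2 := factor2_re_pos 0 t Ht). assert (Q3 := factor3_re_pos 0 t Ht).
  rewrite Rpower_Ropp, <- Rmult_assoc, Rpower_mult_distr by assumption.
  assert (E : 25/12 - 4*t + 3*t^2 - 4/3*t^3 + 1/4*t^4 = ray_re 0 factor1 t * ray_re 0 factor2 t * / ray_re 0 factor3 t).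
  { destruct (factor_values 0 t) as [[V1 _] [[V2 _] [V3 _]]]. rewrite V3 in Q3.
    rewrite V1, V2, V3. rewrite sin_0, cos_0, Rmult_1_r, Rmult_0_r in *. field. lra. }
  rewrite E, <- (Rpower_mult_distr (_ * _)); [|nra|now apply Rinv_0_lt_compat].
  f_equal. unfold Rpower. rewrite ln_Rinv by assumption. rewrite <- exp_Ropp. f_equal. ring.
Qed.

Lemma varpi4_on_disc al : -1 <= al <= 1 -> on_disc (varpi4 al).
Proof.
intros Ha x Hx. rewrite (CV_radius_ext _ (delta_coefs al)) by (intro; now apply varpi4_delta_coefs).
now apply on_disc_delta_coefs.
Qed.

Lemma ray_re_varpi4_nonneg al th r : 0 < al <= alpha_max -> 0 <= r < 1 -> 0 <= ray_re th (varpi4 al) r.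
Proof.
intros Ha Hr. assert (H := alpha_max_approx).
rewrite (ray_re_ext th _ (delta_coefs al)) by (intro; apply varpi4_delta_coefs; lra).
apply ray_re_delta_coefs_nonneg; [exact Ha|]. rewrite Rabs_right; lra.
Qed.

(** * Finite sums *)

Lemma sum_scal x f n : sum_f_R0 (fun k => x * f k) n = x * sum_f_R0 f n.
Proof. rewrite scal_sum. apply sum_eq. intros; ring. Qed.

Lemma sum_exchange (f : nat -> nat -> R) n m :
  sum_f_R0 (fun i => sum_f_R0 (f i) m) n = sum_f_R0 (fun j => sum_f_R0 (fun i => f i j) n) m.
Proof.
induction n as [|n IH]; [reflexivity|]. simpl. rewrite IH, <- plus_sum. reflexivity.
Qed.

Lemma sum_prod f g n m :
  sum_f_R0 f n * sum_f_R0 g m = sum_f_R0 (fun i => sum_f_R0 (fun j => f i * g j) m) n.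
Proof.
rewrite Rmult_comm, scal_sum. apply sum_eq. intros. now rewrite sum_scal.
Qed.

Lemma sum_delta (f : nat -> R) (b : nat -> bool) k n :
  (forall i, (i <= n)%nat -> b i = true <-> i = k) ->
  sum_f_R0 (fun i => f i * (if b i then 1 else 0)) n = if Nat.leb k n then f k else 0.
Proof.
induction n as [|n IH]; intro H.
- simpl. destruct (b 0%nat) eqn:E; destruct (Nat.leb k 0) eqn:F;
   try apply Nat.leb_le in F; try apply Nat.leb_gt in F.
  + assert (0 = k)%nat by (apply H; auto). subst. ring.
  + assert (0 = k)%nat by (apply H; auto). lia.
  + assert (b 0%nat = true) by (apply H; lia). congruence.
  + ring.
- rewrite tech5, IH by (intros; apply H; lia).
  destruct (b (S n)) eqn:E.
  + assert (S n = k) by (apply H; auto). subst k.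
    rewrite (proj2 (Nat.leb_gt _ _)), Nat.leb_refl by lia. ring.
  + assert (k <> S n) by (intro; assert (b (S n) = true) by (apply H; auto); congruence).
    destruct (Nat.leb k n) eqn:F; destruct (Nat.leb k (S n)) eqn:G; try ring;
    try apply Nat.leb_le in F; try apply Nat.leb_gt in F;
    try apply Nat.leb_le in G; try apply Nat.leb_gt in G; lia.
Qed.

Lemma is_lim_seq_sum (f : nat -> nat -> R) (l : nat -> R) n :
  (forall k, (k <= n)%nat -> is_lim_seq (fun N => f N k) (l k)) ->
  is_lim_seq (fun N => sum_f_R0 (f N) n) (sum_f_R0 l n).
Proof.
induction n as [|n IH]; intro H; [apply H; lia|].
simpl. apply is_lim_seq_plus'; [apply IH; intros; apply H; lia|apply H; lia].
Qed.

Lemma is_RInt_sum (f : nat -> R -> R) (I : nat -> R) a b n :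
  (forall k, is_RInt (f k) a b (I k)) ->
  is_RInt (fun x => sum_f_R0 (fun k => f k x) n) a b (sum_f_R0 I n).
Proof.
intro H. induction n as [|n IH]; [apply H|].
simpl. apply (is_RInt_plus (V := R_NormedModule)); auto.
Qed.

Definition ind (b : bool) : R := if b then 1 else 0.

(** * Positivity of Toeplitz forms *)

Lemma is_RInt_cos_int z :
  is_RInt (fun x => cos (IZR z * x)) 0 (2 * PI) (2 * PI * ind (Z.eqb z 0)).
Proof.
destruct (Z.eqb_spec z 0) as [->|Hz]; unfold ind.
- apply (is_RInt_ext (fun _ => 1)).
  + intros. rewrite Rmult_0_l, cos_0. reflexivity.
  + evar_last; [apply (is_RInt_const (V := R_NormedModule))|].
    unfold scal; simpl; unfold mult; simpl. ring.
- assert (Hz' : IZR z <> 0) by (apply not_0_IZR; exact Hz).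
  replace (2 * PI * 0) with (sin (IZR z * (2 * PI)) / IZR z - sin (IZR z * 0) / IZR z).
  + apply (is_RInt_derive (V := R_CompleteNormedModule) (fun x => sin (IZR z * x) / IZR z)).
    * intros x _. auto_derive; [exact I|]. field. exact Hz'.
    * intros x _. apply (ex_derive_continuous (V := R_NormedModule)). auto_derive. exact I.
  + rewrite Rmult_0_r, sin_0, (sin_eq_0_1 (IZR z * (2 * PI))).
    * field; exact Hz'.
    * exists (z * 2)%Z. rewrite mult_IZR. ring.
Qed.

Lemma is_RInt_cos_cos l m j :
  is_RInt (fun x => cos (INR l * x) * cos (INR m * x - INR j * x)) 0 (2 * PI)
   (PI * (ind (Nat.eqb (j + l) m) + ind (Nat.eqb (m + l) j))).
Proof.
assert (H := is_RInt_plus (V := R_NormedModule) _ _ _ _ _ _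
   (is_RInt_cos_int (Z.of_nat l + Z.of_nat m - Z.of_nat j)) (is_RInt_cos_int (Z.of_nat l - Z.of_nat m + Z.of_nat j))).
apply (is_RInt_scal (V := R_NormedModule) _ _ _ (/2)) in H.
revert H. unfold scal, plus; simpl; unfold mult; simpl. intro H.
replace (PI * _) with (/ 2 *
      (2 * PI * ind (Z.eqb (Z.of_nat l + Z.of_nat m - Z.of_nat j) 0) +
       2 * PI * ind (Z.eqb (Z.of_nat l - Z.of_nat m + Z.of_nat j) 0))).
- refine (is_RInt_ext _ _ _ _ _ _ H). intros x _. unfold plus; simpl.
  rewrite !plus_IZR, !minus_IZR, !plus_IZR, <- !INR_IZR_INZ.
  replace ((INR l + INR m - INR j) * x) with (INR l * x + (INR m * x - INR j * x)) by ring.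
  replace ((INR l - INR m + INR j) * x) with (INR l * x - (INR m * x - INR j * x)) by ring.
  rewrite cos_plus, (cos_minus (INR l * x)). simpl. field.
- replace (Z.eqb (Z.of_nat l + Z.of_nat m - Z.of_nat j) 0) with (Nat.eqb (m + l) j)
    by (apply Bool.eq_iff_eq_true; rewrite Nat.eqb_eq, Z.eqb_eq; lia).
  replace (Z.eqb (Z.of_nat l - Z.of_nat m + Z.of_nat j) 0) with (Nat.eqb (j + l) m)
    by (apply Bool.eq_iff_eq_true; rewrite Nat.eqb_eq, Z.eqb_eq; lia).
  field.
Qed.

(** Entry of the symmetric Toeplitz matrix of the symbol
    [2 sum_l c_l cos (l x)]: the diagonal, where both alternatives hold, receives
    [2 c_0]. *)
Definition toeplitz_kernel (c : nat -> R) (j m : nat) : R :=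
  (if Nat.leb j m then c (m - j)%nat else 0) + (if Nat.leb m j then c (j - m)%nat else 0).

Definition toeplitz (n : nat) (c y w : nat -> R) : R :=
  sum_f_R0 (fun j => sum_f_R0 (fun m => toeplitz_kernel c j m * y m * w j) n) n.

Definition trig_cos (n : nat) (v : nat -> R) (x : R) : R := sum_f_R0 (fun k => v k * cos (INR k * x)) n.
Definition trig_sin (n : nat) (v : nat -> R) (x : R) : R := sum_f_R0 (fun k => v k * sin (INR k * x)) n.
(** The real part of the product of the discrete Fourier transform of [y] with
    the conjugate of that of [w]. *)
Definition cross (n : nat) (y w : nat -> R) (x : R) : R :=
  trig_cos n y x * trig_cos n w x + trig_sin n y x * trig_sin n w x.

Lemma cross_expand n y w x :
  cross n y w x = sum_f_R0 (fun j => sum_f_R0 (fun m => y m * w j * cos (INR m * x - INR j * x)) n) n.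
Proof.
unfold cross, trig_cos, trig_sin. rewrite !sum_prod, <- plus_sum, sum_exchange.
apply sum_eq; intros m Hm. rewrite <- plus_sum. apply sum_eq; intros j Hj. rewrite cos_minus. ring.
Qed.

Lemma is_RInt_cos_cross n y w l :
  is_RInt (fun x => cos (INR l * x) * cross n y w x) 0 (2 * PI)
   (sum_f_R0 (fun j => sum_f_R0 (fun m =>
      y m * w j * (PI * (ind (Nat.eqb (j + l) m) + ind (Nat.eqb (m + l) j)))) n) n).
Proof.
apply (is_RInt_ext (fun x => sum_f_R0 (fun j => sum_f_R0 (fun m =>
   y m * w j * (cos (INR l * x) * cos (INR m * x - INR j * x))) n) n)).
- intros x _. rewrite cross_expand, <- sum_scal. apply sum_eq; intros.
  rewrite <- sum_scal. apply sum_eq; intros. ring.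
- apply is_RInt_sum; intro j. apply is_RInt_sum; intro m.
  apply (is_RInt_scal (V := R_NormedModule)), is_RInt_cos_cos.
Qed.

(** Orthogonality of the cosines: integration against the truncated symbol
    recovers the Toeplitz form as soon as the truncation reaches the size of the
    matrix. *)
Lemma is_RInt_poly_cross a n y w L : (n <= L)%nat ->
  is_RInt (fun x => trig_cos L a x * cross n y w x) 0 (2 * PI) (PI * toeplitz n a y w).
Proof.
intro HL.
evar_last.
- apply (is_RInt_ext (fun x => sum_f_R0 (fun l => a l * (cos (INR l * x) * cross n y w x)) L)).
  + intros x _. unfold trig_cos. rewrite (Rmult_comm _ (cross n y w x)), <- sum_scal.
    apply sum_eq; intros. ring.
  + apply is_RInt_sum. intro l. apply (is_RInt_scal (V := R_NormedModule)), is_RInt_cos_cross.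
- cbv beta. unfold scal; simpl; unfold mult; simpl. unfold toeplitz.
  transitivity (sum_f_R0 (fun j => sum_f_R0 (fun m => sum_f_R0 (fun l =>
    PI * y m * w j * (a l * ind (Nat.eqb (j + l) m) + a l * ind (Nat.eqb (m + l) j))) L) n) n).
  + rewrite sum_exchange with (m := n) (n := n).
    transitivity (sum_f_R0 (fun l => sum_f_R0 (fun j => sum_f_R0 (fun m =>
     PI * y m * w j * (a l * ind (Nat.eqb (j + l) m) + a l * ind (Nat.eqb (m + l) j))) n) n) L).
    * apply sum_eq; intros l Hl. rewrite <- sum_scal. apply sum_eq; intros j Hj.
      rewrite <- sum_scal. apply sum_eq; intros m Hm. ring.
    * rewrite sum_exchange. rewrite sum_exchange with (m := n) (n := n).
      apply sum_eq; intros j Hj. apply sum_exchange.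
  + rewrite <- sum_scal. apply sum_eq; intros j Hj. rewrite <- sum_scal. apply sum_eq; intros m Hm.
    rewrite sum_scal, plus_sum. unfold ind, toeplitz_kernel.
    assert (E : forall p q, (p <= n)%nat -> (q <= n)%nat ->
      sum_f_R0 (fun l => a l * (if Nat.eqb (p + l) q then 1 else 0)) L
      = if Nat.leb p q then a (q - p)%nat else 0).
    { intros p q Hp Hq. destruct (Nat.leb p q) eqn:E.
      - apply Nat.leb_le in E. rewrite (sum_delta _ _ (q - p)).
        + rewrite (proj2 (Nat.leb_le _ _)) by lia. reflexivity.
        + intros i Hi. rewrite Nat.eqb_eq. lia.
      - apply Nat.leb_gt in E. rewrite (sum_eq _ (fun _ => 0 * 1)).
        + rewrite sum_scal. ring.
        + intros i Hi. rewrite (proj2 (Nat.eqb_neq _ _)) by lia. ring. }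
    rewrite !E by assumption. ring.
Qed.

(** Inside the disc the truncated sums converge uniformly in the angle, so they
    are almost nonnegative. *)
Lemma truncation_lower_bound c r (eps : posreal) n : on_disc c -> 0 <= r < 1 ->
  (forall th, 0 <= ray_re th c r) ->
  exists L, (n <= L)%nat /\ forall x, - eps <= trig_cos L (fun l => c l * r ^ l) x.
Proof.
intros Hc Hr Hre.
assert (Hr1 : Rabs r < 1) by (rewrite Rabs_right; lra).
assert (Ha := CV_disk_inside c r (Hc r Hr1)).
destruct (Series_correct _ Ha (ball (Series (fun k => Rabs (c k * r ^ k))) eps)) as [N HN];
  [apply locally_ball|].
exists (n + N)%nat. split; [lia|]. intro x.
specialize (HN (n + N)%nat ltac:(lia)). rewrite sum_n_Reals in HN.
unfold ball in HN; simpl in HN; unfold AbsRing_ball, abs, minus, plus, opp in HN; simpl in HN.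
set (L := (n + N)%nat) in *.
set (f := fun k => c k * r ^ k * cos (INR k * x)).
assert (Hf : forall k, Rabs (f k) <= Rabs (c k * r ^ k)).
{ intro k. unfold f. rewrite Rabs_mult. rewrite <- (Rmult_1_r (Rabs (c k * r ^ k))) at 2.
  apply Rmult_le_compat_l; [apply Rabs_pos|]. apply Rabs_le, COS_bound. }
assert (Ef : ex_series (fun k => Rabs (f k))).
{ apply (ex_series_le (V := R_CompleteNormedModule)) with (2 := Ha). intro k.
  change (Rabs (Rabs (f k)) <= Rabs (c k * r ^ k)). rewrite Rabs_Rabsolu. apply Hf. }
assert (E : ray_re x c r = sum_f_R0 f L + Series (fun k => f (S L + k)%nat)).
{ transitivity (Series f).
  - apply Series_ext. intro k. unfold f, twist_cos. ring.
  - apply (Series_incr_n f (S L)); [lia|]. now apply ex_series_Rabs. }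
assert (E2 := Series_incr_n (fun k => Rabs (c k * r ^ k)) (S L) ltac:(lia) Ha).
simpl pred in E2.
assert (Htail : Rabs (Series (fun k => f (S L + k)%nat)) <= Series (fun k => Rabs (c (S L + k)%nat * r ^ (S L + k)))).
{ eapply Rle_trans; [apply Series_Rabs; apply (ex_series_incr_n (fun k => Rabs (f k))); exact Ef|].
  apply Series_le; [intro k; split; [apply Rabs_pos|apply Hf]|].
  apply (ex_series_incr_n (fun k => Rabs (c k * r ^ k))). exact Ha. }
specialize (Hre x). rewrite E in Hre. change (trig_cos L _ x) with (sum_f_R0 f L).
rewrite E2 in HN.
assert (Hp : 0 <= Series (fun k => Rabs (c (S L + k)%nat * r ^ (S L + k))))
  by (eapply Rle_trans; [apply Rabs_pos|exact Htail]).
set (tl := Series (fun k => Rabs (c (S L + k)%nat * r ^ (S L + k)))) in *.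
apply Rabs_lt_between in HN. apply Rabs_le_between in Htail. lra.
Qed.

(** For [r < 1] the form with coefficients [c_l r^l] is, up to an arbitrarily small
    error, the integral of a product of nonnegative functions; then let [r] tend
    to 1, where only finitely many coefficients are involved. *)
Lemma toeplitz_nonneg n c y w : on_disc c ->
  (forall th r, 0 <= r < 1 -> 0 <= ray_re th c r) ->
  (forall x, 0 <= cross n y w x) -> 0 <= toeplitz n c y w.
Proof.
intros Hc Hre Hcross.
assert (Hr : forall r, 0 <= r < 1 -> 0 <= toeplitz n (fun l => c l * r ^ l) y w).
{ intros r Hr. set (a := fun l => c l * r ^ l).
  (* [PI * s] is the integral of the cross spectrum alone *)
  set (s := toeplitz n (fun l => if Nat.eqb l 0 then 1 else 0) y w).
  apply Rnot_lt_le. intro Hneg.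
  set (eps := - toeplitz n a y w / (2 * (1 + Rabs s))).
  assert (Hs := Rabs_pos s).
  assert (Heps : 0 < eps) by (apply Rdiv_lt_0_compat; lra).
  destruct (truncation_lower_bound c r (mkposreal eps Heps) n Hc Hr (fun th => Hre th r Hr))
    as (L & HL & Hlow). fold a in Hlow. simpl in Hlow.
  assert (I1 := is_RInt_poly_cross a n y w L HL).
  assert (I2 := is_RInt_poly_cross (fun l => if Nat.eqb l 0 then 1 else 0) n y w n (Nat.le_refl n)).
  fold s in I2.
  apply (is_RInt_scal (V := R_NormedModule) _ _ _ eps) in I2.
  assert (I3 := is_RInt_plus (V := R_NormedModule) _ _ _ _ _ _ I1 I2).
  assert (0 <= PI * toeplitz n a y w + eps * (PI * s)).
  { apply (is_RInt_le (fun _ => 0)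
      (fun x => plus (trig_cos L a x * cross n y w x)
        (scal eps (trig_cos n (fun l => if Nat.eqb l 0 then 1 else 0) x * cross n y w x))) 0 (2 * PI)).
    - assert (H := PI_RGT_0). lra.
    - evar_last; [apply (is_RInt_const (V := R_NormedModule))|].
      unfold scal; simpl; unfold mult; simpl. ring.
    - exact I3.
    - intros x _. unfold plus, scal; simpl; unfold mult; simpl.
      assert (E : trig_cos n (fun l => if Nat.eqb l 0 then 1 else 0) x = 1).
      { unfold trig_cos. rewrite (sum_eq _ (fun i => cos (INR i * x) * (if Nat.eqb i 0 then 1 else 0)))
          by (intros; ring).
        rewrite (sum_delta _ _ 0) by (intros; apply Nat.eqb_eq). simpl. now rewrite Rmult_0_l, cos_0. }
      rewrite E. specialize (Hlow x). specialize (Hcross x). nra. }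
  assert (HPI := PI_RGT_0).
  assert (H1 : 0 <= toeplitz n a y w + eps * s) by nra.
  assert (eps * s <= eps * Rabs s) by (apply Rmult_le_compat_l; [lra|apply Rle_abs]).
  assert (eps * (2 * (1 + Rabs s)) = - toeplitz n a y w) by (unfold eps; field; lra).
  nra. }
apply (is_lim_seq_le (fun _ => 0) (fun N => toeplitz n (fun l => c l * (1 - / INR (S N)) ^ l) y w) 0
        (toeplitz n c y w)).
- intro N. apply Hr. assert (0 < INR (S N)) by (apply lt_0_INR; lia).
  assert (1 <= INR (S N)) by (rewrite S_INR; assert (H1 := pos_INR N); lra).
  assert (0 < / INR (S N)) by now apply Rinv_0_lt_compat.
  assert (/ INR (S N) <= 1) by (rewrite <- Rinv_1; apply Rinv_le_contravar; lra). lra.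
- apply is_lim_seq_const.
- assert (Hl : forall l, is_lim_seq (fun N => c l * (1 - / INR (S N)) ^ l) (c l)).
  { intro l. replace (Finite (c l)) with (Rbar_mult (c l) (1 ^ l)) by (simpl; rewrite pow1; f_equal; ring).
    apply is_lim_seq_scal_l.
    apply (is_lim_seq_continuous (fun x => x ^ l)).
    - apply derivable_continuous_pt, derivable_pt_pow.
    - replace (Finite 1) with (Rbar_minus 1 0) by (simpl; f_equal; ring).
      apply is_lim_seq_minus'; [apply is_lim_seq_const|].
      apply (is_lim_seq_incr_1 (fun N => / INR N)).
      replace (Finite 0) with (Rbar_inv p_infty) by reflexivity.
      apply is_lim_seq_inv; [apply is_lim_seq_INR|discriminate]. }
  unfold toeplitz. apply is_lim_seq_sum; intros j _. apply is_lim_seq_sum; intros m _.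
  assert (Hk : forall b l, is_lim_seq (fun N => if (b : bool) then c l * (1 - / INR (S N)) ^ l else 0)
     (Finite (if b then c l else 0))) by (intros [|] l; [apply Hl|apply is_lim_seq_const]).
  apply (is_lim_seq_scal_r _ (w j) (toeplitz_kernel c j m * y m)).
  apply (is_lim_seq_scal_r _ (y m) (toeplitz_kernel c j m)).
  unfold toeplitz_kernel. apply is_lim_seq_plus'; apply Hk.
Qed.

(** Test with [y] the first unit vector and [w] its sum with [e] times the [l]-th
    one, [|e| <= 1]: the cross spectrum [1 + e cos (l x)] is nonnegative. *)
Lemma caratheodory_bound c l : on_disc c ->
  (forall th r, 0 <= r < 1 -> 0 <= ray_re th c r) -> Rabs (c l) <= 2 * c 0%nat.
Proof.
intros Hc Hre.
set (d := fun (i k : nat) => if Nat.eqb k i then 1 else 0).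
assert (H : forall e, -1 <= e <= 1 -> 0 <= 2 * c 0%nat + e * (toeplitz_kernel c l 0)).
{ intros e He.
  assert (D : forall (f : nat -> R) i, (i <= l)%nat -> sum_f_R0 (fun k => f k * d i k) l = f i).
  { intros f i Hi. unfold d. rewrite (sum_delta _ _ i) by (intros; apply Nat.eqb_eq).
    now rewrite (proj2 (Nat.leb_le _ _)). }
  assert (T := toeplitz_nonneg l c (d 0%nat) (fun k => d 0%nat k + e * d l k) Hc Hre).
  replace (2 * c 0%nat + e * toeplitz_kernel c l 0) with
    (toeplitz l c (d 0%nat) (fun k => d 0%nat k + e * d l k)).
  - apply T. intro x. unfold cross, trig_cos, trig_sin.
    rewrite !(sum_eq (fun k => (d 0%nat k + e * d l k) * _)
       (fun k => cos (INR k * x) * d 0%nat k + (e * cos (INR k * x)) * d l k)) by (intros; ring).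
    rewrite (sum_eq (fun k => d 0%nat k * cos (INR k * x))
       (fun k => cos (INR k * x) * d 0%nat k)) by (intros; ring).
    rewrite (sum_eq (fun k => d 0%nat k * sin (INR k * x))
       (fun k => sin (INR k * x) * d 0%nat k)) by (intros; ring).
    rewrite plus_sum, !D by lia. simpl INR. rewrite Rmult_0_l, cos_0, sin_0.
    assert (CB := COS_bound (INR l * x)). nra.
  - unfold toeplitz. rewrite (sum_eq _ (fun j => toeplitz_kernel c j 0 * d 0%nat j
      + (e * toeplitz_kernel c j 0) * d l j)).
    + rewrite plus_sum, !D by lia. unfold toeplitz_kernel at 1. simpl. ring.
    + intros j Hj. rewrite (sum_eq _ (fun m => (toeplitz_kernel c j m * (d 0%nat j + e * d l j)) * d 0%nat m))
        by (intros; ring). rewrite D by lia. ring. }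
assert (H1 := H 1 ltac:(lra)). assert (H2 := H (-1) ltac:(lra)).
destruct l as [|l]; unfold toeplitz_kernel in *; simpl in *; apply Rabs_le; lra.
Qed.

(** * Stability of the Fourier modes *)

Lemma is_series_fst (a : nat -> C) (l : C) :
  is_series (V := C_R_NormedModule) a l -> is_series (fun n => fst (a n)) (fst l).
Proof.
intro H. unfold is_series in *.
apply (filterlim_ext (fun n => fst (sum_n (G := C_R_NormedModule) a n))).
- intro n. induction n as [|n IH]; [now rewrite !sum_O|]. rewrite !sum_Sn, <- IH. reflexivity.
- eapply filterlim_comp; [exact H|]. apply (continuous_fst (U := R_UniformSpace) (V := R_UniformSpace)).
Qed.

Lemma is_series_snd (a : nat -> C) (l : C) :
  is_series (V := C_R_NormedModule) a l -> is_series (fun n => snd (a n)) (snd l).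
Proof.
intro H. unfold is_series in *.
apply (filterlim_ext (fun n => snd (sum_n (G := C_R_NormedModule) a n))).
- intro n. induction n as [|n IH]; [now rewrite !sum_O|]. rewrite !sum_Sn, <- IH. reflexivity.
- eapply filterlim_comp; [exact H|]. apply (continuous_snd (U := R_UniformSpace) (V := R_UniformSpace)).
Qed.

(** Abel's theorem applies when the radius is exactly 1; otherwise the sum is
    continuous at 1. *)
Lemma series_nonneg_of_abel a W : on_disc a -> is_series a W ->
  (forall r, 0 <= r < 1 -> 0 <= PSeries a r) -> 0 <= W.
Proof.
intros Ha HW Hpos.
assert (Hp : is_pseries a 1 W).
{ apply (is_series_ext a); [|exact HW]. intro n. rewrite pow_n_pow, pow1.
  unfold scal; simpl; unfold mult; simpl. ring. }
assert (HR : Rbar_le 1 (CV_radius a)).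
{ destruct (Rbar_le_lt_dec 1 (CV_radius a)) as [h|h]; [exact h|exfalso].
  assert (H0 := CV_radius_ge_0 a). destruct (CV_radius a) as [R| |] eqn:E; simpl in h, H0; try easy.
  assert (H1 := Ha R). rewrite E in H1. simpl in H1. rewrite Rabs_right in H1 by lra. lra. }
assert (Hlim : filterlim (PSeries a) (at_left 1) (locally (PSeries a 1))).
{ destruct (Rbar_le_lt_or_eq_dec _ _ HR) as [h|h].
  - apply (filterlim_filter_le_1 (F := locally 1) (PSeries a)).
    + apply filter_le_within.
    + apply (proj1 (continuity_pt_filterlim _ _)). apply PSeries_continuity.
      rewrite Rabs_right by lra. exact h.
  - assert (H := Abel a). rewrite <- h in H. apply H; simpl; try lra; auto. now exists W. }
rewrite (is_pseries_unique _ _ _ Hp) in Hlim.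
apply (filterlim_le (F := at_left 1) (fun _ => 0) (PSeries a) (Finite 0) (Finite W)); auto.
- exists (mkposreal 1 Rlt_0_1). intros y Hy Hy1. apply Hpos.
  unfold ball in Hy; simpl in Hy; unfold AbsRing_ball, abs, minus, plus, opp in Hy; simpl in Hy.
  apply Rabs_lt_between in Hy. lra.
- apply filterlim_const.
Qed.

Lemma nu_pos al da h : 0 < al < 1 -> 0 < da -> 0 < nu al da h.
Proof.
intros Ha Hd. unfold nu. apply Rdiv_lt_0_compat; [exact Hd|]. apply Rmult_lt_0_compat; [|apply exp_pos].
apply Rmult_lt_0_compat; [lra|]. assert (HPI := PI_RGT_0). apply cos_gt_0; nra.
Qed.

(** [|P + Q|^2 - |P - Q|^2] is four times the real part of [P conj Q]. *)
Lemma Cmod_cayley (P Q xi : C) :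
  P <> 0%C -> 0 <= fst P * fst Q + snd P * snd Q ->
  ((P + Q) * xi = P - Q)%C -> Cmod xi <= 1.
Proof.
intros HP Hpq E.
assert (HP2 : 0 < fst P ^ 2 + snd P ^ 2).
{ assert (0 < Cmod P) by now apply Cmod_gt_0. unfold Cmod in H.
  apply Rnot_le_lt. intro h. rewrite sqrt_neg_0 in H by exact h. lra. }
assert (Hle : Cmod (P - Q) <= Cmod (P + Q)).
{ unfold Cmod. apply sqrt_le_1_alt. destruct P as [p1 p2], Q as [q1 q2]. simpl in *. nra. }
assert (Hpos : 0 < Cmod (P + Q)).
{ unfold Cmod. apply sqrt_lt_R0. destruct P as [p1 p2], Q as [q1 q2]. simpl in *. nra. }
rewrite <- E, Cmod_mult in Hle.
apply (Rmult_le_reg_l (Cmod (P + Q))); [exact Hpos|]. lra.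
Qed.

Lemma Cavg_mode d1 d2 h xi th k j : d2 <> 0 ->
  Cavg d1 d2 h (mode xi th k) j =
  (Cpow xi k * ((5/6 + cos th / 6)%R, (- (d1 * h / (12 * d2)) * sin th)%R)
    * (cos (IZR j * th), sin (IZR j * th)))%C.
Proof.
intro Hd. unfold Cavg, mode.
rewrite minus_IZR, plus_IZR.
replace ((IZR j - 1) * th) with (IZR j * th - th) by ring.
replace ((IZR j + 1) * th) with (IZR j * th + th) by ring.
rewrite cos_minus, cos_plus, sin_minus, sin_plus.
destruct (Cpow xi k) as [x y]. unfold a1, a2, a3, RtoC, Cmult, Cplus; simpl.
f_equal; field; exact Hd.
Qed.

(** The two one-sided series need not have real coefficients, but their termwise
    sum is a real series times the fixed complex number [xi^k a]. *)
Lemma frac_series_mode al d1 d2 h xi th k : 0 < d2 -> 0 < al <= alpha_max ->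
  let a : C := ((5/6 + cos th / 6)%R, (- (d1 * h / (12 * d2)) * sin th)%R) in
  forall S, is_frac_series al d1 d2 h (mode xi th k) 0 S ->
  is_series (fun l => fst (Cpow xi k * a)%C * (2 * (varpi4 al l * cos (INR l * th)))) (fst S) /\
  is_series (fun l => snd (Cpow xi k * a)%C * (2 * (varpi4 al l * cos (INR l * th)))) (snd S).
Proof.
intros Hd Hal a S (Sl & Sr & Hl & Hr & ->).
assert (H := is_series_plus (V := C_R_NormedModule) _ _ _ _ Hl Hr).
assert (E : forall l, plus (G := C_R_NormedModule) (RtoC (varpi4 al l) * Cavg d1 d2 h (mode xi th k) (0 - Z.of_nat l))%C
   (RtoC (varpi4 al l) * Cavg d1 d2 h (mode xi th k) (0 + Z.of_nat l))%C =
   ((fst (Cpow xi k * a)%C * (2 * (varpi4 al l * cos (INR l * th))))%R,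
    (snd (Cpow xi k * a)%C * (2 * (varpi4 al l * cos (INR l * th))))%R)).
{ intro l. rewrite !Cavg_mode by lra. fold a. rewrite minus_IZR, plus_IZR, <- INR_IZR_INZ.
  replace ((0 - INR l) * th) with (- (INR l * th)) by ring.
  replace ((0 + INR l) * th) with (INR l * th) by ring.
  rewrite cos_neg, sin_neg. generalize (Cpow xi k * a)%C. intros [u v].
  unfold plus; simpl. unfold prod_plus, plus; simpl. f_equal; ring. }
split.
- apply is_series_fst in H. apply (is_series_ext _ _ _ (fun l => f_equal fst (E l))) in H. exact H.
- apply is_series_snd in H. apply (is_series_ext _ _ _ (fun l => f_equal snd (E l))) in H. exact H.
Qed.

(** The mode turns the two one-sided series into the same real nonnegative number
    [W], multiplied by the symbol [a] of the average.  Then [xi] is the Cayley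
    quotient of [P] and [Q], and the real part of [P conj Q] splits into the part
    of [W] and a local part, nonnegative because [beta >= d1^2 / (12 d2)]. *)
Lemma von_neumann_stable al d1 d2 da : 0 < al <= alpha_max -> 0 < d1 -> 0 < d2 -> 0 < da ->
  unconditionally_stable al d1 d2 da.
Proof.
intros Hal Hd1 Hd2 Hda tau h th xi Htau Hh _ HE.
assert (Hm := alpha_max_approx).
destruct (HE 0%nat 0%Z) as (S1 & S0 & H1 & H0 & E). clear HE.
set (a := (((5/6 + cos th / 6)%R, (- (d1 * h / (12 * d2)) * sin th)%R)) : C).
destruct (frac_series_mode _ _ _ _ _ _ _ Hd2 Hal _ H1) as [F1 G1].
destruct (frac_series_mode _ _ _ _ _ _ _ Hd2 Hal _ H0) as [F0 G0].
fold a in F1, G1, F0, G0.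
assert (CB := COS_bound th).
assert (Har : 2/3 <= fst a) by (simpl; lra).
assert (E0 : (Cpow xi 0 * a)%C = a) by (simpl; ring).
assert (E1 : (Cpow xi 1 * a)%C = (xi * a)%C) by (simpl; ring).
rewrite E0 in F0, G0. rewrite E1 in F1, G1.
set (W := fst S0 / fst a).
assert (HW : is_series (fun l => 2 * (varpi4 al l * cos (INR l * th))) W).
{ apply (is_series_scal (/ fst a)) in F0.
  replace W with (scal (/ fst a) (fst S0)) by (unfold W, scal; simpl; unfold mult; simpl; field; lra).
  refine (is_series_ext _ _ _ _ F0). intro l. unfold scal; simpl; unfold mult; simpl.
  simpl in Har. field. lra. }
assert (U : forall x y, is_series (fun l => x * (2 * (varpi4 al l * cos (INR l * th)))) y -> y = x * W).
{ intros x y Hy. apply (is_series_scal x) in HW. apply is_series_unique in HW. apply is_series_unique in Hy.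
  etransitivity; [symmetry; exact Hy|exact HW]. }
assert (HS0 : S0 = (RtoC W * a)%C).
{ apply U in F0. apply U in G0. destruct S0 as [u v]. simpl fst in F0 at 1. simpl snd in G0 at 1.
  rewrite F0, G0. unfold RtoC, Cmult; simpl. f_equal; ring. }
assert (HS1 : S1 = (xi * (RtoC W * a))%C).
{ apply U in F1. apply U in G1. destruct S1 as [u v]. simpl fst in F1 at 1. simpl snd in G1 at 1.
  rewrite F1, G1. unfold RtoC, Cmult; simpl. f_equal; ring. }
assert (HW0 : 0 <= W).
{ assert (0 <= / 2 * W); [|lra].
  apply (series_nonneg_of_abel (twist_cos th (varpi4 al))).
  - apply on_disc_twist_cos, varpi4_on_disc. lra.
  - apply (is_series_scal (/ 2)) in HW. refine (is_series_ext _ _ _ _ HW).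
    intro l. unfold twist_cos, scal; simpl; unfold mult; simpl. field.
  - intros r Hr. now apply ray_re_varpi4_nonneg. }
assert (Hnu := nu_pos al da h ltac:(lra) Hda).
set (bt := d2 / h^2 + d1^2 / (12 * d2)).
set (P := (RtoC (2 / tau) * a)%C).
set (Q := ((2 * bt * (1 - cos th))%R, (d1 / h * sin th)%R) : C).
apply (Cmod_cayley P (Q + RtoC (nu al da h * W) * a)%C xi).
- intro h0. apply (f_equal fst) in h0. unfold P, RtoC, Cmult in h0. cbn [fst snd] in h0.
  assert (0 < 2 / tau) by (apply Rdiv_lt_0_compat; lra). nra.
- assert (Ht : 0 < 2 / tau) by (apply Rdiv_lt_0_compat; lra).
  assert (HnW : 0 <= nu al da h * W) by (apply Rmult_le_pos; lra).
  set (x := d1^2 / (12 * d2)) in *. assert (Hx : 0 <= x) by (unfold x; apply Rdiv_le_0_compat; nra).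
  assert (Hbt : x <= bt) by (unfold bt; assert (0 <= d2 / h^2) by (apply Rdiv_le_0_compat; nra); lra).
  match goal with |- 0 <= ?g => replace g with (2 / tau *
   ((5/6 + cos th/6) * (2 * bt * (1 - cos th)) - x * (sin th * sin th)
     + nu al da h * W * (fst a * fst a + snd a * snd a))) end.
  + apply Rmult_le_pos; [lra|]. apply Rplus_le_le_0_compat.
    * assert (CS := sin2_cos2 th). unfold Rsqr in CS. replace (sin th * sin th) with ((1 - cos th) * (1 + cos th)) by lra.
      assert (0 <= (1 - cos th) * ((5/6 + cos th / 6) * 2 * (bt - x))) by (apply Rmult_le_pos; nra).
      assert (0 <= x * ((1 - cos th) * (1 - cos th))) by (apply Rmult_le_pos; nra). nra.
    * apply Rmult_le_pos; [exact HnW|]. nra.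
  + unfold P, Q, x, a, RtoC, Cmult, Cplus; simpl. field. lra.
- assert (Hh2 : h <> 0) by lra.
  rewrite HS0, HS1 in E. revert E. unfold mode, b1, b2, b3, a1, a2, a3.
  replace (0 - 1)%Z with (-1)%Z by reflexivity. replace (0 + 1)%Z with 1%Z by reflexivity.
  replace (IZR (-1) * th) with (- th) by (simpl; ring).
  rewrite cos_neg, sin_neg, !Rmult_1_l, !Rmult_0_l, cos_0, sin_0.
  destruct xi as [x y]. unfold P, Q, a, bt. unfold RtoC, Cpow, Cminus, Cmult, Cplus, Copp; simpl.
  intro E. injection E as Ex Ey.
  apply injective_projections; simpl.
  + match type of Ex with ?l = ?r => apply Rminus_diag_eq in Ex end.
    apply Rminus_diag_uniq. etransitivity; [|exact Ex]. field. repeat split; lra.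
  + apply Rminus_diag_eq in Ey.
    apply Rminus_diag_uniq. etransitivity; [|exact Ey]. field. repeat split; lra.
Qed.

(** * Sums and norms of grid functions *)

(** The sums include the end points [0] and [M], where the grid functions of
    interest vanish: this makes the shifts below exact. *)
Definition gsum (M : nat) (f : Z -> R) : R := sum_f_R0 (fun j => f (Z.of_nat j)) M.
Definition gnorm (M : nat) (f : Z -> R) : R := sqrt (gsum M (fun j => f j * f j)).
Definition inside (M : nat) (v : Z -> R) : Prop :=
  forall j, (j <= 0)%Z \/ (Z.of_nat M <= j)%Z -> v j = 0.

Lemma gsum_ext M f g : (forall j, (0 <= j <= Z.of_nat M)%Z -> f j = g j) -> gsum M f = gsum M g.
Proof. intro H. apply sum_eq. intros; apply H. lia. Qed.
Lemma gsum_plus M f g : gsum M (fun j => f j + g j) = gsum M f + gsum M g.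
Proof. apply plus_sum. Qed.
Lemma gsum_scal M x f : gsum M (fun j => x * f j) = x * gsum M f.
Proof. apply (sum_scal x (fun j => f (Z.of_nat j))). Qed.
Lemma gsum_le M f g : (forall j, (0 <= j <= Z.of_nat M)%Z -> f j <= g j) -> gsum M f <= gsum M g.
Proof. intro H. apply sum_Rle. intros; apply H. lia. Qed.
Lemma gsum_nonneg M f : (forall j, 0 <= f j) -> 0 <= gsum M f.
Proof. intro H. apply cond_pos_sum. intro; apply H. Qed.
Lemma gsum_abs M f : Rabs (gsum M f) <= gsum M (fun j => Rabs (f j)).
Proof. apply Rsum_abs. Qed.
Lemma gsum_const M x : gsum M (fun _ => x) = INR (S M) * x.
Proof. unfold gsum. rewrite sum_cte. ring. Qed.

Lemma gsum_shift M f : f (-1)%Z = 0 -> f (Z.of_nat M) = 0 ->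
  gsum M (fun j => f (j - 1)%Z) = gsum M f.
Proof.
intros H0 HM.
assert (H : forall n, gsum n (fun j => f (j - 1)%Z) = f (-1)%Z + gsum n f - f (Z.of_nat n)).
{ unfold gsum. induction n as [|n IH].
  - simpl. ring.
  - rewrite !tech5, IH. replace (Z.of_nat (S n) - 1)%Z with (Z.of_nat n) by lia. ring. }
rewrite H, H0, HM. ring.
Qed.

Lemma gsum_shift_prod M v w : inside M v -> inside M w ->
  gsum M (fun j => v (j - 1)%Z * w j) = gsum M (fun j => v j * w (j + 1)%Z).
Proof.
intros Hv Hw.
rewrite <- (gsum_shift M (fun j => v j * w (j + 1)%Z)).
- apply gsum_ext; intros. now replace (j - 1 + 1)%Z with j by lia.
- rewrite (Hv (-1)%Z) by lia. ring.
- rewrite (Hv (Z.of_nat M)) by lia. ring.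
Qed.

Lemma gsum_sq_nonneg M f : 0 <= gsum M (fun j => f j * f j).
Proof. apply gsum_nonneg. intro; apply Rle_0_sqr. Qed.
Lemma gnorm_nonneg M f : 0 <= gnorm M f.
Proof. apply sqrt_pos. Qed.
Lemma gnorm_sq M f : gnorm M f * gnorm M f = gsum M (fun j => f j * f j).
Proof. apply sqrt_sqrt, gsum_sq_nonneg. Qed.

Lemma gsum_cauchy_schwarz M f g : Rabs (gsum M (fun j => f j * g j)) <= gnorm M f * gnorm M g.
Proof.
set (p := gnorm M f). set (q := gnorm M g).
assert (Hp := gnorm_nonneg M f). assert (Hq := gnorm_nonneg M g). fold p in Hp. fold q in Hq.
set (s := gsum M (fun j => f j * g j)).
assert (H : forall x y, 0 <= x * x * (p * p) + 2 * x * y * s + y * y * (q * q)).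
{ intros x y. unfold p, q, s. rewrite !gnorm_sq, <- !gsum_scal, <- !gsum_plus.
  apply gsum_nonneg. intro j. match goal with |- 0 <= ?e => replace e with ((x * f j + y * g j) * (x * f j + y * g j)) by ring end.
  apply Rle_0_sqr. }
apply Rabs_le.
destruct (Req_dec p 0) as [P0|P0]; destruct (Req_dec q 0) as [Q0|Q0].
- assert (H1 := H 1 1). assert (H2 := H 1 (-1)). rewrite P0, Q0 in *. lra.
- assert (H1 := H (- (q * q)) s). rewrite P0 in *. assert (0 < q * q) by nra.
  assert (s * s <= 0) by (apply (Rmult_le_reg_l (q * q)); lra). assert (s = 0) by nra. lra.
- assert (H1 := H s (- (p * p))). rewrite Q0 in *. assert (0 < p * p) by nra.
  assert (s * s <= 0) by (apply (Rmult_le_reg_l (p * p)); lra). assert (s = 0) by nra. lra.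
- assert (H1 := H q p). assert (H2 := H q (- p)).
  assert (Hpq : 0 < p * q) by (apply Rmult_lt_0_compat; lra).
  split; apply (Rmult_le_reg_l (2 * (p * q))); lra.
Qed.

Lemma gnorm_plus M f g : gnorm M (fun j => f j + g j) <= gnorm M f + gnorm M g.
Proof.
assert (Hp := gnorm_nonneg M f). assert (Hq := gnorm_nonneg M g).
apply Rsqr_incr_0; [|apply gnorm_nonneg|lra].
unfold Rsqr. rewrite gnorm_sq.
assert (H := gsum_cauchy_schwarz M f g). apply Rabs_le_between in H.
rewrite (gsum_ext M _ (fun j => f j * f j + (2 * (f j * g j) + g j * g j))) by (intros; ring).
rewrite !gsum_plus, gsum_scal, <- !gnorm_sq. lra.
Qed.

Lemma gsum_abs_le_norm M f : gsum M (fun j => Rabs (f j)) <= sqrt (INR (S M)) * gnorm M f.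
Proof.
assert (H := gsum_cauchy_schwarz M (fun _ => 1) (fun j => Rabs (f j))).
replace (gnorm M (fun _ => 1)) with (sqrt (INR (S M))) in H
  by (unfold gnorm; rewrite gsum_const; f_equal; ring).
replace (gnorm M (fun j => Rabs (f j))) with (gnorm M f) in H.
- rewrite (gsum_ext M _ (fun j => Rabs (f j))) in H by (intros; ring).
  apply Rle_trans with (2 := H), Rle_abs.
- unfold gnorm. f_equal. apply gsum_ext; intros. rewrite <- Rabs_mult, Rabs_right; [reflexivity|].
  apply Rle_ge, Rle_0_sqr.
Qed.

Definition gdiff (v : Z -> R) (j : Z) : R := v (j + 1)%Z - v j.

Lemma gnorm_gdiff_sq M v : inside M v ->
  gnorm M (gdiff v) * gnorm M (gdiff v) =
  2 * gsum M (fun j => v j * v j) - 2 * gsum M (fun j => v j * v (j + 1)%Z).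
Proof.
intro Hv. rewrite gnorm_sq.
assert (E : gsum M (fun j => v (j + 1)%Z * v (j + 1)%Z) = gsum M (fun j => v j * v j)).
{ rewrite <- (gsum_shift M (fun j => v (j + 1)%Z * v (j + 1)%Z)).
  - apply gsum_ext; intros. now replace (j - 1 + 1)%Z with j by lia.
  - rewrite (Hv (-1 + 1)%Z) by lia. ring.
  - rewrite (Hv (Z.of_nat M + 1)%Z) by lia. ring. }
rewrite (gsum_ext M _ (fun j => v (j + 1)%Z * v (j + 1)%Z + (v j * v j + (-2) * (v j * v (j + 1)%Z))))
  by (intros; unfold gdiff; ring).
rewrite !gsum_plus, gsum_scal, E. ring.
Qed.

Lemma gnorm_gdiff_back M v : inside M v -> gnorm M (fun j => v j - v (j - 1)%Z) = gnorm M (gdiff v).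
Proof.
intro Hv. unfold gnorm. f_equal. rewrite <- (gsum_shift M (fun j => gdiff v j * gdiff v j)).
- apply gsum_ext; intros. unfold gdiff. now replace (j - 1 + 1)%Z with j by lia.
- unfold gdiff. rewrite (Hv (-1 + 1)%Z), (Hv (-1)%Z) by lia. ring.
- unfold gdiff. rewrite (Hv (Z.of_nat M + 1)%Z), (Hv (Z.of_nat M)) by lia. ring.
Qed.

(** The lower bound is the upper one for the sequence with alternating signs. *)
Lemma gsum_neighbours_ge M v : inside M v ->
  - gsum M (fun j => v j * v j) <= gsum M (fun j => v j * v (j + 1)%Z) <= gsum M (fun j => v j * v j).
Proof.
intro Hv. split.
- assert (Hw : inside M (fun j => (if Z.even j then 1 else -1) * v j)) by (intros j Hj; rewrite Hv by exact Hj; ring).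
  assert (H := gnorm_gdiff_sq M _ Hw).
  assert (P := Rle_0_sqr (gnorm M (gdiff (fun j => (if Z.even j then 1 else -1) * v j)))). unfold Rsqr in P.
  set (w := fun j => (if Z.even j then 1 else -1) * v j) in *.
  assert (E1 : gsum M (fun j => w j * w j) = gsum M (fun j => v j * v j))
    by (apply gsum_ext; intros; unfold w; destruct (Z.even j); ring).
  assert (E2 : gsum M (fun j => w j * w (j + 1)%Z) = -1 * gsum M (fun j => v j * v (j + 1)%Z)).
  { rewrite <- gsum_scal. apply gsum_ext. intros j _. unfold w. rewrite Z.even_add.
    simpl (Z.even 1). destruct (Z.even j); simpl; ring. }
  rewrite E1, E2 in H. lra.
- assert (H := gnorm_gdiff_sq M v Hv).
  assert (P := Rle_0_sqr (gnorm M (gdiff v))). unfold Rsqr in P. lra.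
Qed.

Lemma gnorm_gdiff_le M v : inside M v -> gnorm M (gdiff v) <= 2 * gnorm M v.
Proof.
intro Hv. assert (H := gnorm_gdiff_sq M v Hv). assert (P := gsum_neighbours_ge M v Hv).
rewrite <- gnorm_sq in H, P. assert (Q := gnorm_nonneg M v).
apply Rsqr_incr_0; [unfold Rsqr; lra|apply gnorm_nonneg|lra].
Qed.

(** A grid function that vanishes at [0] is the sum of its increments. *)
Lemma abs_le_gsum_gdiff M v j : inside M v -> (0 <= j <= Z.of_nat M)%Z ->
  Rabs (v j) <= gsum M (fun i => Rabs (gdiff v i)).
Proof.
intros Hv Hj. rewrite <- (Z2Nat.id j) in * by lia. set (n := Z.to_nat j) in *. clearbody n. clear j.
destruct n as [|n].
- rewrite Hv by lia. rewrite Rabs_R0. apply gsum_nonneg. intro; apply Rabs_pos.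
- assert (H : forall k, v (Z.of_nat (S k)) = gsum k (gdiff v)).
  { induction k as [|k IH].
    - unfold gsum, gdiff; simpl. rewrite (Hv 0%Z) by lia. ring.
    - unfold gsum. rewrite tech5. fold (gsum k (gdiff v)). rewrite <- IH. unfold gdiff.
      replace (Z.of_nat (S k) + 1)%Z with (Z.of_nat (S (S k))) by lia. ring. }
  rewrite H. apply Rle_trans with (1 := gsum_abs _ _).
  assert (Hmono : forall f k l, (forall i : Z, 0 <= f i) -> gsum k f <= gsum (k + l) f).
  { intros f k l Hf. induction l as [|l IH]; [rewrite Nat.add_0_r; lra|].
    rewrite Nat.add_succ_r. unfold gsum in *. rewrite tech5.
    assert (P := Hf (Z.of_nat (S (k + l)))). lra. }
  replace M with (n + (M - n))%nat by lia. apply Hmono. intro; apply Rabs_pos.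
Qed.

Lemma gsum_abs_poincare M v : inside M v ->
  gsum M (fun j => Rabs (v j)) <= INR (S M) * (sqrt (INR (S M)) * gnorm M (gdiff v)).
Proof.
intro Hv. apply Rle_trans with (gsum M (fun _ => gsum M (fun i => Rabs (gdiff v i)))).
- apply gsum_le. intros. now apply abs_le_gsum_gdiff.
- rewrite gsum_const. apply Rmult_le_compat_l; [apply pos_INR|]. apply gsum_abs_le_norm.
Qed.

Lemma gnorm_poincare M v : inside M v -> gnorm M v <= INR (S M) * gnorm M (gdiff v).
Proof.
intro Hv. assert (Hn := pos_INR (S M)). assert (Hg := gnorm_nonneg M (gdiff v)).
apply Rsqr_incr_0; [|apply gnorm_nonneg|nra].
unfold Rsqr. rewrite gnorm_sq.
set (s := sqrt (INR (S M)) * gnorm M (gdiff v)).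
apply Rle_trans with (gsum M (fun _ => s * s)).
- apply gsum_le. intros j Hj.
  assert (H := abs_le_gsum_gdiff M v j Hv Hj). assert (H2 := gsum_abs_le_norm M (gdiff v)). fold s in H2.
  assert (P := Rabs_pos (v j)).
  replace (v j * v j) with (Rabs (v j) * Rabs (v j))
    by (rewrite <- Rabs_mult; apply Rabs_right, Rle_ge, Rle_0_sqr).
  apply Rmult_le_compat; lra.
- rewrite gsum_const. unfold s.
  replace (_ * _) with (INR (S M) * ((sqrt (INR (S M)) * sqrt (INR (S M))) * (gnorm M (gdiff v) * gnorm M (gdiff v)))) by ring.
  rewrite sqrt_sqrt by exact Hn. right. ring.
Qed.

(** * The operators of the scheme on a finite grid *)

(** The antisymmetric part of the three-point average is [skew / 2] times a
    difference of the two neighbours, see [avg_split]. *)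
Definition skew (d1 d2 h : R) : R := d1 * h / (12 * d2).

Lemma avg_split d1 d2 h v j : d2 <> 0 ->
  avg d1 d2 h v j = 5/6 * v j + 1/12 * (v (j - 1)%Z + v (j + 1)%Z)
                    + skew d1 d2 h / 2 * (v (j - 1)%Z - v (j + 1)%Z).
Proof. intro H. unfold avg, a1, a2, a3, skew. field. exact H. Qed.

Lemma gsum_shift_prod_r M v w : inside M v -> inside M w ->
  gsum M (fun j => v (j + 1)%Z * w j) = gsum M (fun j => v j * w (j - 1)%Z).
Proof.
intros Hv Hw. rewrite (gsum_ext M (fun j => v j * w (j - 1)%Z) (fun j => w (j - 1)%Z * v j)) by (intros; ring).
rewrite gsum_shift_prod by assumption. apply gsum_ext; intros; ring.
Qed.

Definition avg_energy (M : nat) (v : Z -> R) : R :=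
  5/6 * gsum M (fun j => v j * v j) + 1/6 * gsum M (fun j => v j * v (j + 1)%Z).

Lemma avg_energy_bounds M v : inside M v ->
  2/3 * (gnorm M v * gnorm M v) <= avg_energy M v <= gnorm M v * gnorm M v.
Proof.
intro Hv. rewrite gnorm_sq. unfold avg_energy. assert (H := gsum_neighbours_ge M v Hv). lra.
Qed.

Lemma gsum_avg_self d1 d2 h M v : d2 <> 0 -> inside M v ->
  gsum M (fun j => avg d1 d2 h v j * v j) = avg_energy M v.
Proof.
intros Hd Hv.
rewrite (gsum_ext M _ (fun j => 5/6 * (v j * v j) + ((1/12 + skew d1 d2 h / 2) * (v (j - 1)%Z * v j)
   + (1/12 - skew d1 d2 h / 2) * (v j * v (j + 1)%Z)))) by (intros; rewrite avg_split by exact Hd; ring).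
rewrite !gsum_plus, !gsum_scal, gsum_shift_prod by assumption. unfold avg_energy. field.
Qed.

(** The symmetric part of the average telescopes between two time levels; the
    antisymmetric part leaves a term that involves only the difference [d] and
    the gradient of [w]. *)
Lemma gsum_avg_telescope d1 d2 h M e f : d2 <> 0 -> inside M e -> inside M f ->
  let d := fun j => f j - e j in let w := fun j => f j + e j in
  gsum M (fun j => avg d1 d2 h d j * w j) =
  avg_energy M f - avg_energy M e
  + skew d1 d2 h / 2 * gsum M (fun j => d j * (w (j + 1)%Z - w (j - 1)%Z)).
Proof.
intros Hd He Hf d w.
assert (Hid : inside M d) by (intros j Hj; unfold d; rewrite He, Hf by exact Hj; ring).
assert (Hiw : inside M w) by (intros j Hj; unfold w; rewrite He, Hf by exact Hj; ring).
set (k := skew d1 d2 h / 2).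
rewrite (gsum_ext M _ (fun j => 5/6 * (d j * w j) + ((1/12 + k) * (d (j - 1)%Z * w j)
   + (1/12 - k) * (d (j + 1)%Z * w j)))) by (intros; rewrite avg_split by exact Hd; unfold k; ring).
rewrite (gsum_ext M (fun j => d j * (w (j + 1)%Z - w (j - 1)%Z))
   (fun j => d j * w (j + 1)%Z + (-1) * (d j * w (j - 1)%Z))) by (intros; ring).
rewrite !gsum_plus, !gsum_scal, gsum_shift_prod, gsum_shift_prod_r by assumption.
assert (E1 : gsum M (fun j => d j * w j) = gsum M (fun j => f j * f j) - gsum M (fun j => e j * e j)).
{ rewrite (gsum_ext M _ (fun j => f j * f j + (-1) * (e j * e j))) by (intros; unfold d, w; ring).
  rewrite gsum_plus, gsum_scal. ring. }
assert (E2 : gsum M (fun j => d j * w (j + 1)%Z) + gsum M (fun j => d j * w (j - 1)%Z) =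
   2 * (gsum M (fun j => f j * f (j + 1)%Z) - gsum M (fun j => e j * e (j + 1)%Z))).
{ rewrite <- (gsum_shift_prod_r M d w) by assumption. rewrite <- gsum_plus.
  rewrite (gsum_ext M _ (fun j => 2 * (f j * f (j + 1)%Z) + (-2) * (e j * e (j + 1)%Z)))
    by (intros; unfold d, w; ring).
  rewrite gsum_plus, !gsum_scal. ring. }
rewrite E1. unfold avg_energy.
replace (gsum M (fun j => d j * w (j - 1)%Z)) with
  (2 * (gsum M (fun j => f j * f (j + 1)%Z) - gsum M (fun j => e j * e (j + 1)%Z)) - gsum M (fun j => d j * w (j + 1)%Z)) by lra.
field.
Qed.

Definition diffusion (d1 d2 h : R) (v : Z -> R) (j : Z) : R :=
  b1 d1 d2 h * v (j - 1)%Z + b2 d1 d2 h * v j + b3 d1 d2 h * v (j + 1)%Z.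
Definition beta (d1 d2 h : R) : R := d2 / h^2 + d1^2 / (12 * d2).

Lemma gsum_diffusion_self d1 d2 h M v : inside M v ->
  gsum M (fun j => diffusion d1 d2 h v j * v j) = - (beta d1 d2 h * (gnorm M (gdiff v) * gnorm M (gdiff v))).
Proof.
intro Hv. rewrite gnorm_gdiff_sq by exact Hv.
rewrite (gsum_ext M _ (fun j => b1 d1 d2 h * (v (j - 1)%Z * v j) + (b2 d1 d2 h * (v j * v j)
  + b3 d1 d2 h * (v j * v (j + 1)%Z)))) by (intros; unfold diffusion; ring).
rewrite !gsum_plus, !gsum_scal, gsum_shift_prod by assumption. unfold b1, b2, b3, beta. ring.
Qed.

Lemma gsum_diffusion_bound d1 d2 h M v g : 0 < d1 -> 0 < d2 -> 0 < h -> inside M v ->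
  Rabs (gsum M (fun j => diffusion d1 d2 h v j * g j))
  <= 2 * (beta d1 d2 h + d1 / (2 * h)) * (gnorm M (gdiff v) * gnorm M g).
Proof.
intros H1 H2 Hh Hv. set (B := beta d1 d2 h). set (G := d1 / (2 * h)).
assert (HG : 0 <= G) by (apply Rdiv_le_0_compat; lra).
assert (HB : 0 <= B).
{ unfold B, beta. apply Rplus_le_le_0_compat; apply Rdiv_le_0_compat; nra. }
rewrite (gsum_ext M _ (fun j => (B - G) * (gdiff v j * g j) + (- (B + G)) * ((v j - v (j - 1)%Z) * g j)))
  by (intros; unfold diffusion, b1, b2, b3, gdiff, B, G, beta; ring).
rewrite gsum_plus, !gsum_scal.
assert (C1 := gsum_cauchy_schwarz M (gdiff v) g).
assert (C2 := gsum_cauchy_schwarz M (fun j => v j - v (j - 1)%Z) g).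
rewrite gnorm_gdiff_back in C2 by exact Hv.
set (K := gnorm M (gdiff v) * gnorm M g) in *.
apply Rle_trans with (1 := Rabs_triang _ _). rewrite !Rabs_mult.
assert (Rabs (B - G) <= B + G) by (apply Rabs_le; lra).
assert (Rabs (- (B + G)) = B + G) by (rewrite Rabs_Ropp, Rabs_right; lra).
assert (P1 := Rabs_pos (B - G)). assert (P2 := Rabs_pos (gsum M (fun j => gdiff v j * g j))).
rewrite H0. nra.
Qed.

Lemma frac_sum_toeplitz al d1 d2 h M v j : (j <= M)%nat ->
  frac_sum al d1 d2 h M v j =
  sum_f_R0 (fun m => toeplitz_kernel (varpi4 al) j m * avg d1 d2 h v (Z.of_nat m)) M.
Proof.
intro Hj. unfold frac_sum. set (c := varpi4 al). set (y := avg d1 d2 h v).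
rewrite (sum_eq (fun m => toeplitz_kernel c j m * y (Z.of_nat m))
  (fun m => (if Nat.leb j m then c (m - j)%nat else 0) * y (Z.of_nat m)
          + (if Nat.leb m j then c (j - m)%nat else 0) * y (Z.of_nat m)))
  by (intros; unfold toeplitz_kernel; ring).
rewrite plus_sum, Rplus_comm. f_equal.
- transitivity (sum_f_R0 (fun l => sum_f_R0 (fun m => c l * y (Z.of_nat m) * ind (Nat.eqb m (j + l))) M) (M - j)).
  + apply sum_eq. intros l Hl. unfold ind. rewrite (sum_delta _ _ (j + l)) by (intros; apply Nat.eqb_eq).
    rewrite (proj2 (Nat.leb_le _ _)) by lia. now rewrite Nat2Z.inj_add.
  + rewrite sum_exchange. apply sum_eq. intros m Hm. unfold ind.
    destruct (Nat.leb j m) eqn:E.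
    * apply Nat.leb_le in E. rewrite (sum_delta _ _ (m - j)) by (intros; rewrite Nat.eqb_eq; lia).
      now rewrite (proj2 (Nat.leb_le _ _)) by lia.
    * apply Nat.leb_gt in E. rewrite (sum_eq _ (fun _ => 0 * 0)); [rewrite sum_scal; ring|].
      intros i Hi. rewrite (proj2 (Nat.eqb_neq _ _)) by lia. ring.
- transitivity (sum_f_R0 (fun l => sum_f_R0 (fun m => c l * y (Z.of_nat m) * ind (Nat.eqb m (j - l))) M) j).
  + apply sum_eq. intros l Hl. unfold ind. rewrite (sum_delta _ _ (j - l)) by (intros; apply Nat.eqb_eq).
    rewrite (proj2 (Nat.leb_le _ _)) by lia. now rewrite Nat2Z.inj_sub by lia.
  + rewrite sum_exchange. apply sum_eq. intros m Hm. unfold ind.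
    destruct (Nat.leb m j) eqn:E.
    * apply Nat.leb_le in E. rewrite (sum_delta _ _ (j - m)) by (intros; rewrite Nat.eqb_eq; lia).
      now rewrite (proj2 (Nat.leb_le _ _)) by lia.
    * apply Nat.leb_gt in E. rewrite (sum_eq _ (fun _ => 0 * 0)); [rewrite sum_scal; ring|].
      intros i Hi. rewrite (proj2 (Nat.eqb_neq _ _)) by lia. ring.
Qed.

Definition frac_form (al d1 d2 h : R) (M : nat) (v g : Z -> R) : R :=
  sum_f_R0 (fun j => frac_sum al d1 d2 h M v j * g (Z.of_nat j)) M.

Lemma frac_form_toeplitz al d1 d2 h M v g :
  frac_form al d1 d2 h M v g =
  toeplitz M (varpi4 al) (fun m => avg d1 d2 h v (Z.of_nat m)) (fun j => g (Z.of_nat j)).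
Proof.
apply sum_eq. intros j Hj. rewrite frac_sum_toeplitz by exact Hj.
rewrite Rmult_comm, <- sum_scal. apply sum_eq. intros; ring.
Qed.

(** The symbol of the average has real part [5/6 + cos x / 6 > 0], and the form
    only sees the real part because the kernel is symmetric. *)
Lemma frac_form_nonneg al d1 d2 h M v : 0 < al <= alpha_max -> d2 <> 0 -> inside M v ->
  0 <= frac_form al d1 d2 h M v v.
Proof.
intros Ha Hd Hv. assert (Hm := alpha_max_approx). rewrite frac_form_toeplitz.
apply toeplitz_nonneg; [apply varpi4_on_disc; lra|intros; now apply ray_re_varpi4_nonneg|].
intro x. unfold cross, trig_cos, trig_sin.
set (Cv := gsum M (fun j => v j * cos (IZR j * x))). set (Sv := gsum M (fun j => v j * sin (IZR j * x))).
assert (Sh : forall F : Z -> R, gsum M (fun j => v (j - 1)%Z * F j) = gsum M (fun j => v j * F (j + 1)%Z)).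
{ intro F. rewrite <- (gsum_shift M (fun j => v j * F (j + 1)%Z)).
  - apply gsum_ext; intros. now replace (j - 1 + 1)%Z with j by lia.
  - rewrite Hv by lia. ring.
  - rewrite Hv by lia. ring. }
assert (Sh' : forall F : Z -> R, gsum M (fun j => v (j + 1)%Z * F j) = gsum M (fun j => v j * F (j - 1)%Z)).
{ intro F. rewrite <- (gsum_shift M (fun j => v (j + 1)%Z * F j)).
  - apply gsum_ext; intros. now replace (j - 1 + 1)%Z with j by lia.
  - rewrite Hv by lia. ring.
  - rewrite Hv by lia. ring. }
assert (Ec : sum_f_R0 (fun k => avg d1 d2 h v (Z.of_nat k) * cos (INR k * x)) M =
  (5/6 + cos x / 6) * Cv - skew d1 d2 h * sin x * Sv).
{ transitivity (gsum M (fun j => avg d1 d2 h v j * cos (IZR j * x))).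
  { apply sum_eq; intros. now rewrite INR_IZR_INZ. }
  rewrite (gsum_ext M _ (fun j => 5/6 * (v j * cos (IZR j * x)) +
     ((1/12 + skew d1 d2 h / 2) * (v (j - 1)%Z * cos (IZR j * x))
     + (1/12 - skew d1 d2 h / 2) * (v (j + 1)%Z * cos (IZR j * x))))) by (intros; rewrite avg_split by exact Hd; ring).
  rewrite !gsum_plus, !gsum_scal, Sh, Sh'.
  rewrite (gsum_ext M (fun j => v j * cos (IZR (j + 1) * x))
     (fun j => cos x * (v j * cos (IZR j * x)) + (- sin x) * (v j * sin (IZR j * x)))).
  2:{ intros. rewrite plus_IZR. replace ((IZR j + 1) * x) with (IZR j * x + x) by ring. rewrite cos_plus. ring. }
  rewrite (gsum_ext M (fun j => v j * cos (IZR (j - 1) * x))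
     (fun j => cos x * (v j * cos (IZR j * x)) + sin x * (v j * sin (IZR j * x)))).
  2:{ intros. rewrite minus_IZR. replace ((IZR j - 1) * x) with (IZR j * x - x) by ring. rewrite cos_minus. ring. }
  rewrite !gsum_plus, !gsum_scal. fold Cv Sv. field. }
assert (Es : sum_f_R0 (fun k => avg d1 d2 h v (Z.of_nat k) * sin (INR k * x)) M =
  (5/6 + cos x / 6) * Sv + skew d1 d2 h * sin x * Cv).
{ transitivity (gsum M (fun j => avg d1 d2 h v j * sin (IZR j * x))).
  { apply sum_eq; intros. now rewrite INR_IZR_INZ. }
  rewrite (gsum_ext M _ (fun j => 5/6 * (v j * sin (IZR j * x)) +
     ((1/12 + skew d1 d2 h / 2) * (v (j - 1)%Z * sin (IZR j * x))
     + (1/12 - skew d1 d2 h / 2) * (v (j + 1)%Z * sin (IZR j * x))))) by (intros; rewrite avg_split by exact Hd; ring).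
  rewrite !gsum_plus, !gsum_scal, Sh, Sh'.
  rewrite (gsum_ext M (fun j => v j * sin (IZR (j + 1) * x))
     (fun j => cos x * (v j * sin (IZR j * x)) + sin x * (v j * cos (IZR j * x)))).
  2:{ intros. rewrite plus_IZR. replace ((IZR j + 1) * x) with (IZR j * x + x) by ring. rewrite sin_plus. ring. }
  rewrite (gsum_ext M (fun j => v j * sin (IZR (j - 1) * x))
     (fun j => cos x * (v j * sin (IZR j * x)) + (- sin x) * (v j * cos (IZR j * x)))).
  2:{ intros. rewrite minus_IZR. replace ((IZR j - 1) * x) with (IZR j * x - x) by ring. rewrite sin_minus. ring. }
  rewrite !gsum_plus, !gsum_scal. fold Cv Sv. field. }
rewrite Ec, Es.
replace (sum_f_R0 (fun k => v (Z.of_nat k) * cos (INR k * x)) M) with Cv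
  by (apply sum_eq; intros; now rewrite INR_IZR_INZ).
replace (sum_f_R0 (fun k => v (Z.of_nat k) * sin (INR k * x)) M) with Sv
  by (apply sum_eq; intros; now rewrite INR_IZR_INZ).
replace (_ + _) with ((5/6 + cos x / 6) * (Cv * Cv + Sv * Sv)) by ring.
assert (CB := COS_bound x). apply Rmult_le_pos; [lra|nra].
Qed.

(** Crude, as it replaces the kernel by its supremum, but sufficient: on fine
    grids it enters with a factor [skew] of size [h], and the resulting order
    [h^(- 1 - al)] is below the order [h^(- 2)] of the diffusion. *)
Lemma frac_form_bound al d1 d2 h M v g : 0 < al <= alpha_max -> 0 < d1 -> 0 < d2 -> 0 < h -> inside M v ->
  Rabs (frac_form al d1 d2 h M v g) <=
  4 * varpi4 al 0 * (1 + skew d1 d2 h) * (gsum M (fun j => Rabs (v j)) * gsum M (fun j => Rabs (g j))).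
Proof.
intros Ha H1 H2 Hh Hv. assert (Hm := alpha_max_approx). rewrite frac_form_toeplitz.
assert (HK : forall j m, Rabs (toeplitz_kernel (varpi4 al) j m) <= 4 * varpi4 al 0).
{ intros j m.
  assert (Hc : forall l, Rabs (varpi4 al l) <= 2 * varpi4 al 0).
  { intro l. apply caratheodory_bound; [apply varpi4_on_disc; lra|intros; now apply ray_re_varpi4_nonneg]. }
  assert (P := Rabs_pos (varpi4 al 0)). assert (Q := Hc 0%nat).
  unfold toeplitz_kernel. apply Rle_trans with (1 := Rabs_triang _ _).
  assert (Hb : forall (b : bool) l, Rabs (if b then varpi4 al l else 0) <= 2 * varpi4 al 0)
    by (intros [|] l; [apply Hc|rewrite Rabs_R0; lra]).
  assert (B1 := Hb (Nat.leb j m) (m - j)%nat). assert (B2 := Hb (Nat.leb m j) (j - m)%nat). lra. }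
assert (H4 : 0 <= 4 * varpi4 al 0) by (eapply Rle_trans; [apply Rabs_pos|apply (HK 0%nat 0%nat)]).
assert (Hs : 0 <= skew d1 d2 h) by (unfold skew; apply Rdiv_le_0_compat; nra).
set (Gg := gsum M (fun j => Rabs (g j))). set (Gv := gsum M (fun j => Rabs (v j))).
assert (HGg : 0 <= Gg) by (apply gsum_nonneg; intro; apply Rabs_pos).
assert (HGv : 0 <= Gv) by (apply gsum_nonneg; intro; apply Rabs_pos).
assert (Hav : gsum M (fun j => Rabs (avg d1 d2 h v j)) <= (1 + skew d1 d2 h) * Gv).
{ apply Rle_trans with (gsum M (fun j => 5/6 * Rabs (v j) + ((1/12 + skew d1 d2 h / 2) * Rabs (v (j - 1)%Z)
    + (1/12 + skew d1 d2 h / 2) * Rabs (v (j + 1)%Z)))).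
  - apply gsum_le. intros j _. rewrite avg_split by lra.
    set (k := skew d1 d2 h / 2). assert (Hk : 0 <= k) by (unfold k; lra).
    replace (_ + _) with (5/6 * v j + ((1/12 + k) * v (j - 1)%Z + (1/12 - k) * v (j + 1)%Z)) by ring.
    apply Rle_trans with (1 := Rabs_triang _ _). rewrite Rabs_mult, (Rabs_right (5/6)) by lra.
    apply Rplus_le_compat_l. apply Rle_trans with (1 := Rabs_triang _ _).
    rewrite !Rabs_mult, (Rabs_right (1/12 + k)) by lra. apply Rplus_le_compat_l.
    apply Rmult_le_compat_r; [apply Rabs_pos|]. apply Rabs_le. lra.
  - rewrite !gsum_plus, !gsum_scal.
    rewrite (gsum_shift M (fun j => Rabs (v j))) by (rewrite Hv by lia; apply Rabs_R0).
    rewrite <- (gsum_shift M (fun j => Rabs (v (j + 1)%Z))) by (rewrite Hv by lia; apply Rabs_R0).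
    rewrite (gsum_ext M (fun j => Rabs (v (j - 1 + 1)%Z)) (fun j => Rabs (v j)))
      by (intros; now replace (j - 1 + 1)%Z with j by lia).
    fold Gv. lra. }
unfold toeplitz. apply Rle_trans with (1 := Rsum_abs _ _).
apply Rle_trans with (sum_f_R0 (fun j => sum_f_R0 (fun m =>
   (4 * varpi4 al 0 * Rabs (g (Z.of_nat j))) * Rabs (avg d1 d2 h v (Z.of_nat m))) M) M).
- apply sum_Rle. intros j Hj. apply Rle_trans with (1 := Rsum_abs _ _). apply sum_Rle. intros m Hm'.
  rewrite !Rabs_mult. specialize (HK j m).
  assert (P := Rabs_pos (g (Z.of_nat j))). assert (Q := Rabs_pos (avg d1 d2 h v (Z.of_nat m))).
  assert (0 <= Rabs (avg d1 d2 h v (Z.of_nat m)) * Rabs (g (Z.of_nat j))) by nra. nra.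
- rewrite (sum_eq _ (fun j => (4 * varpi4 al 0 * gsum M (fun j => Rabs (avg d1 d2 h v j))) * Rabs (g (Z.of_nat j)))).
  + rewrite sum_scal. fold (gsum M (fun j => Rabs (g j))). fold Gg.
    replace (4 * varpi4 al 0 * (1 + skew d1 d2 h) * (Gv * Gg)) with (4 * varpi4 al 0 * ((1 + skew d1 d2 h) * Gv) * Gg) by ring.
    apply Rmult_le_compat_r; [exact HGg|]. apply Rmult_le_compat_l; [exact H4|exact Hav].
  + intros j Hj. rewrite sum_scal. unfold gsum. ring.
Qed.

Lemma avg_lin d1 d2 h x u v j :
  avg d1 d2 h (fun i => u i + x * v i) j = avg d1 d2 h u j + x * avg d1 d2 h v j.
Proof. unfold avg. ring. Qed.

Lemma frac_sum_lin al d1 d2 h M x u v j :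
  frac_sum al d1 d2 h M (fun i => u i + x * v i) j
  = frac_sum al d1 d2 h M u j + x * frac_sum al d1 d2 h M v j.
Proof.
unfold frac_sum. rewrite Rmult_plus_distr_l, <- !sum_scal.
match goal with |- ?A + ?B = ?C + ?D + (?E + ?F) =>
  transitivity ((C + E) + (D + F)); [|ring] end.
rewrite <- !plus_sum. f_equal; apply sum_eq; intros; rewrite avg_lin; ring.
Qed.

Lemma diffusion_lin d1 d2 h x u v j :
  diffusion d1 d2 h (fun i => u i + x * v i) j = diffusion d1 d2 h u j + x * diffusion d1 d2 h v j.
Proof. unfold diffusion. ring. Qed.

Definition space_form (al d1 d2 da h : R) (M : nat) (v g : Z -> R) : R :=
  - gsum M (fun j => diffusion d1 d2 h v j * g j) + nu al da h * frac_form al d1 d2 h M v g.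

(** A bound for the norm of the spatial operator from the gradient norm to the
    dual of the Euclidean norm; see [space_form_bound]. *)
Definition space_bound (al d1 d2 da h : R) (M : nat) : R :=
  2 * (beta d1 d2 h + d1 / (2 * h))
  + nu al da h * (4 * varpi4 al 0 * (1 + skew d1 d2 h)) * INR (S M) ^ 2.

Lemma space_form_lin al d1 d2 da h M x u v g :
  space_form al d1 d2 da h M (fun i => u i + x * v i) g
  = space_form al d1 d2 da h M u g + x * space_form al d1 d2 da h M v g.
Proof.
unfold space_form, frac_form.
rewrite (gsum_ext M _ (fun j => diffusion d1 d2 h u j * g j + x * (diffusion d1 d2 h v j * g j)))
  by (intros; rewrite diffusion_lin; ring).
rewrite (sum_eq _ (fun j => frac_sum al d1 d2 h M u j * g (Z.of_nat j) + x * (frac_sum al d1 d2 h M v j * g (Z.of_nat j))))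
  by (intros; rewrite frac_sum_lin; ring).
rewrite gsum_plus, gsum_scal, plus_sum, sum_scal. ring.
Qed.

Lemma space_form_coercive al d1 d2 da h M v :
  0 < al <= alpha_max -> 0 < d2 -> 0 < da -> inside M v ->
  beta d1 d2 h * (gnorm M (gdiff v) * gnorm M (gdiff v)) <= space_form al d1 d2 da h M v v.
Proof.
intros Ha H2 Hda Hv. assert (Hm := alpha_max_approx). unfold space_form.
rewrite gsum_diffusion_self by exact Hv.
assert (P := frac_form_nonneg al d1 d2 h M v Ha ltac:(lra) Hv).
assert (Q := nu_pos al da h ltac:(lra) Hda).
assert (0 <= nu al da h * frac_form al d1 d2 h M v v) by (apply Rmult_le_pos; lra). lra.
Qed.

Lemma varpi4_0_nonneg al : 0 < al <= alpha_max -> 0 <= varpi4 al 0.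
Proof.
intro Ha. assert (Hm := alpha_max_approx).
assert (H : Rabs (varpi4 al 0) <= 2 * varpi4 al 0).
{ apply caratheodory_bound; [apply varpi4_on_disc; lra|intros; now apply ray_re_varpi4_nonneg]. }
assert (P := Rabs_pos (varpi4 al 0)). lra.
Qed.

Lemma skew_nonneg d1 d2 h : 0 < d1 -> 0 < d2 -> 0 < h -> 0 <= skew d1 d2 h.
Proof. intros. unfold skew. apply Rdiv_le_0_compat; nra. Qed.
Lemma beta_ge d1 d2 h : 0 < d1 -> 0 < d2 -> d2 / h^2 <= beta d1 d2 h.
Proof. intros. unfold beta. assert (0 <= d1^2 / (12 * d2)) by (apply Rdiv_le_0_compat; nra). lra. Qed.
Lemma beta_pos d1 d2 h : 0 < d1 -> 0 < d2 -> 0 < h -> 0 < beta d1 d2 h.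
Proof.
intros. apply Rlt_le_trans with (2 := beta_ge d1 d2 h H H0). apply Rdiv_lt_0_compat; nra.
Qed.

Lemma space_form_bound al d1 d2 da h M v g :
  0 < al <= alpha_max -> 0 < d1 -> 0 < d2 -> 0 < da -> 0 < h -> inside M v ->
  Rabs (space_form al d1 d2 da h M v g) <= space_bound al d1 d2 da h M * (gnorm M (gdiff v) * gnorm M g).
Proof.
intros Ha H1 H2 Hda Hh Hv. assert (Hm := alpha_max_approx).
assert (Q := nu_pos al da h ltac:(lra) Hda).
assert (B1 := gsum_diffusion_bound d1 d2 h M v g H1 H2 Hh Hv).
assert (B2 := frac_form_bound al d1 d2 h M v g Ha H1 H2 Hh Hv).
assert (P1 := gsum_abs_poincare M v Hv). assert (P2 := gsum_abs_le_norm M g).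
assert (c0 := varpi4_0_nonneg al Ha). assert (sk := skew_nonneg d1 d2 h H1 H2 Hh).
assert (Hn := pos_INR (S M)). assert (Hq := sqrt_pos (INR (S M))).
assert (Hqq := sqrt_sqrt (INR (S M)) Hn).
assert (Hgv := gnorm_nonneg M (gdiff v)). assert (Hgg := gnorm_nonneg M g).
unfold space_form, space_bound. set (n := INR (S M)) in *.
assert (P3 : gsum M (fun j => Rabs (v j)) * gsum M (fun j => Rabs (g j)) <= n^2 * (gnorm M (gdiff v) * gnorm M g)).
{ apply Rle_trans with ((n * (sqrt n * gnorm M (gdiff v))) * (sqrt n * gnorm M g)).
  - apply Rmult_le_compat; try assumption; apply gsum_nonneg; intro; apply Rabs_pos.
  - right. transitivity (n * (sqrt n * sqrt n) * (gnorm M (gdiff v) * gnorm M g)); [ring|]. rewrite Hqq. ring. }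
apply Rle_trans with (1 := Rabs_triang _ _). rewrite Rabs_Ropp, Rabs_mult, (Rabs_right (nu al da h)) by lra.
set (K := 4 * varpi4 al 0 * (1 + skew d1 d2 h)) in *.
assert (HK : 0 <= K) by (unfold K; apply Rmult_le_pos; lra).
assert (nu al da h * Rabs (frac_form al d1 d2 h M v g) <= nu al da h * (K * (n^2 * (gnorm M (gdiff v) * gnorm M g)))).
{ apply Rmult_le_compat_l; [lra|]. apply Rle_trans with (1 := B2). apply Rmult_le_compat_l; assumption. }
lra.
Qed.

Lemma space_bound_nonneg al d1 d2 da h M :
  0 < al <= alpha_max -> 0 < d1 -> 0 < d2 -> 0 < da -> 0 < h -> 0 <= space_bound al d1 d2 da h M.
Proof.
intros Ha H1 H2 Hda Hh. assert (Hm := alpha_max_approx).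
assert (Q := nu_pos al da h ltac:(lra) Hda). assert (c0 := varpi4_0_nonneg al Ha).
assert (sk := skew_nonneg d1 d2 h H1 H2 Hh). assert (bp := beta_pos d1 d2 h H1 H2 Hh).
assert (0 < d1 / (2 * h)) by (apply Rdiv_lt_0_compat; lra).
unfold space_bound. apply Rplus_le_le_0_compat; [lra|].
apply Rmult_le_pos; [|apply pow2_ge_0]. apply Rmult_le_pos; [lra|]. apply Rmult_le_pos; lra.
Qed.

(** * Energy estimates for one time step *)

(** The error equation for consecutive errors [e] and [f]. *)
Definition residual (al d1 d2 da tau h : R) (M : nat) (e f : Z -> R) (j : nat) : R :=
  2 / tau * avg d1 d2 h (fun i => f i - e i) (Z.of_nat j)
  - diffusion d1 d2 h (fun i => f i + e i) (Z.of_nat j)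
  + nu al da h * frac_sum al d1 d2 h M (fun i => f i + e i) j.

Lemma residual_tested al d1 d2 da tau h M e f g rho :
  0 <= rho -> inside M g ->
  (forall j, (1 <= j <= M - 1)%nat -> Rabs (residual al d1 d2 da tau h M e f j) <= 2 * rho) ->
  Rabs (2 / tau * gsum M (fun j => avg d1 d2 h (fun i => f i - e i) j * g j)
    + space_form al d1 d2 da h M (fun i => f i + e i) g)
  <= 2 * (rho * sqrt (INR (S M))) * gnorm M g.
Proof.
intros Hr Hg H.
match goal with |- Rabs ?x <= _ => replace x with
  (sum_f_R0 (fun j => residual al d1 d2 da tau h M e f j * g (Z.of_nat j)) M) end.
- apply Rle_trans with (1 := Rsum_abs _ _).
  apply Rle_trans with (sum_f_R0 (fun j => 2 * rho * Rabs (g (Z.of_nat j))) M).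
  + apply sum_Rle. intros j Hj. rewrite Rabs_mult.
    destruct (le_lt_dec 1 j); [destruct (le_lt_dec j (M - 1))|].
    * apply Rmult_le_compat_r; [apply Rabs_pos|]. apply H. lia.
    * rewrite Hg by lia. rewrite Rabs_R0. lra.
    * rewrite Hg by lia. rewrite Rabs_R0. lra.
  + rewrite sum_scal. assert (P := gsum_abs_le_norm M g). unfold gsum in P. nra.
- unfold space_form, frac_form, gsum.
  rewrite <- !sum_scal. rewrite (Rplus_comm (- _)), <- Rplus_assoc, <- plus_sum.
  rewrite <- (Rminus_def (sum_f_R0 _ _) (sum_f_R0 _ _)), <- minus_sum.
  apply sum_eq. intros j Hj. unfold residual. ring.
Qed.

Lemma le_of_mul_sq_le x y z : 0 <= x -> 0 < y -> 0 <= z -> y * (x * x) <= z * x -> y * x <= z.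
Proof.
intros Hx Hy Hz H. destruct (Req_dec x 0) as [->|Hx0]; [lra|].
apply (Rmult_le_reg_r x); lra.
Qed.

(** Test with [d = f - e] and write [f + e = d + 2 e]: the form is nonnegative at
    [(d, d)], so the estimate needs no restriction on [tau]. *)
Lemma norm_growth_of_step al d1 d2 da tau h M e f rho :
  0 < al <= alpha_max -> 0 < d1 -> 0 < d2 -> 0 < da -> 0 < h -> 0 < tau -> 0 <= rho ->
  inside M e -> inside M f ->
  (forall j, (1 <= j <= M - 1)%nat -> Rabs (residual al d1 d2 da tau h M e f j) <= 2 * rho) ->
  gnorm M f <= (1 + 3 * tau * space_bound al d1 d2 da h M) * gnorm M e
               + 3/2 * tau * (rho * sqrt (INR (S M))).
Proof.
intros Ha H1 H2 Hda Hh Ht Hr He Hf H.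
set (d := fun i => f i - e i).
assert (Hd : inside M d) by (intros j Hj; unfold d; rewrite He, Hf by exact Hj; ring).
assert (T := residual_tested _ _ _ _ _ _ _ e f d rho Hr Hd H). fold d in T.
rewrite gsum_avg_self in T by (auto; lra).
assert (E := avg_energy_bounds M d Hd).
assert (Hsf : space_form al d1 d2 da h M (fun i => f i + e i) d =
  space_form al d1 d2 da h M d d + 2 * space_form al d1 d2 da h M e d).
{ rewrite <- space_form_lin. unfold space_form, frac_form. f_equal; [f_equal; apply gsum_ext|f_equal; apply sum_eq]; intros.
  - unfold diffusion, d. ring.
  - f_equal. unfold frac_sum. f_equal; apply sum_eq; intros; unfold avg, d; ring. }
assert (C := space_form_coercive al d1 d2 da h M d Ha H2 Hda Hd).
assert (B := space_form_bound al d1 d2 da h M e d Ha H1 H2 Hda Hh He).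
assert (bp := beta_pos d1 d2 h H1 H2 Hh).
assert (L0 := space_bound_nonneg al d1 d2 da h M Ha H1 H2 Hda Hh).
assert (G2 := gnorm_gdiff_le M e He).
assert (Nd := gnorm_nonneg M d). assert (Ne := gnorm_nonneg M e).
assert (Ng := gnorm_nonneg M (gdiff e)).
assert (Hrr : 0 <= rho * sqrt (INR (S M))) by (apply Rmult_le_pos; [lra|apply sqrt_pos]).
rewrite Hsf in T. set (L := space_bound al d1 d2 da h M) in *. set (r := rho * sqrt (INR (S M))) in *.
assert (Hn := gnorm_plus M e d).
replace (gnorm M (fun j => e j + d j)) with (gnorm M f) in Hn
  by (unfold gnorm; f_equal; apply gsum_ext; intros; unfold d; ring).
apply Rabs_le_between in T. apply Rabs_le_between in B.
assert (0 <= beta d1 d2 h * (gnorm M (gdiff d) * gnorm M (gdiff d))).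
{ apply Rmult_le_pos; [lra|]. apply Rle_0_sqr. }
assert (B' : L * (gnorm M (gdiff e) * gnorm M d) <= L * (2 * gnorm M e * gnorm M d)).
{ apply Rmult_le_compat_l; [exact L0|]. apply Rmult_le_compat_r; assumption. }
assert (Hti : 0 < 2 / tau) by (apply Rdiv_lt_0_compat; lra).
assert (Hen : 2 / tau * (2/3 * (gnorm M d * gnorm M d)) <= 2 / tau * avg_energy M d)
  by (apply Rmult_le_compat_l; lra).
assert (K : 2 / tau * (2/3) * gnorm M d <= 4 * L * gnorm M e + 2 * r).
{ apply le_of_mul_sq_le; [exact Nd|lra| |].
  - apply Rplus_le_le_0_compat; [apply Rmult_le_pos; lra|lra].
  - lra. }
assert (gnorm M d <= 3/4 * tau * (4 * L * gnorm M e + 2 * r)).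
{ replace (gnorm M d) with (3/4 * tau * (2 / tau * (2/3) * gnorm M d)) by (field; lra).
  apply Rmult_le_compat_l; lra. }
lra.
Qed.

(** Testing with [d] bounds [d / tau] by the gradient of [w]; testing with [w]
    gives the energy balance, in which the term of the antisymmetric part of the
    average is then dominated by the diffusion. *)
Lemma energy_growth_of_step al d1 d2 da tau h M e f rho :
  0 < al <= alpha_max -> 0 < d1 -> 0 < d2 -> 0 < da -> 0 < h -> 0 < tau -> 0 <= rho ->
  inside M e -> inside M f ->
  3 * skew d1 d2 h * space_bound al d1 d2 da h M <= beta d1 d2 h ->
  (forall j, (1 <= j <= M - 1)%nat -> Rabs (residual al d1 d2 da tau h M e f j) <= 2 * rho) ->
  avg_energy M f <= avg_energy M e
     + tau * (((3 * skew d1 d2 h + 2 * INR (S M)) * (rho * sqrt (INR (S M))))^2 / (4 * beta d1 d2 h)).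
Proof.
intros Ha H1 H2 Hda Hh Ht Hr He Hf Hab H.
set (d := fun i => f i - e i). set (w := fun i => f i + e i).
assert (Hd : inside M d) by (intros j Hj; unfold d; rewrite He, Hf by exact Hj; ring).
assert (Hw : inside M w) by (intros j Hj; unfold w; rewrite He, Hf by exact Hj; ring).
assert (T := residual_tested _ _ _ _ _ _ _ e f d rho Hr Hd H). fold d w in T.
rewrite gsum_avg_self in T by (auto; lra).
assert (T2 := residual_tested _ _ _ _ _ _ _ e f w rho Hr Hw H). fold d w in T2.
assert (Tel := gsum_avg_telescope d1 d2 h M e f ltac:(lra) He Hf). cbv zeta in Tel. fold d w in Tel.
rewrite Tel in T2. clear Tel.
assert (E := avg_energy_bounds M d Hd).
assert (C := space_form_coercive al d1 d2 da h M w Ha H2 Hda Hw).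
assert (B := space_form_bound al d1 d2 da h M w d Ha H1 H2 Hda Hh Hw).
assert (bp := beta_pos d1 d2 h H1 H2 Hh).
assert (L0 := space_bound_nonneg al d1 d2 da h M Ha H1 H2 Hda Hh).
assert (sk := skew_nonneg d1 d2 h H1 H2 Hh).
assert (Nd := gnorm_nonneg M d). assert (Ng := gnorm_nonneg M (gdiff w)).
assert (Hrr : 0 <= rho * sqrt (INR (S M))) by (apply Rmult_le_pos; [lra|apply sqrt_pos]).
assert (Po := gnorm_poincare M w Hw). assert (Hn := pos_INR (S M)).
assert (S1 : Rabs (gsum M (fun j => d j * (w (j + 1)%Z - w (j - 1)%Z))) <= 2 * (gnorm M d * gnorm M (gdiff w))).
{ rewrite (gsum_ext M _ (fun j => d j * gdiff w j + d j * (w j - w (j - 1)%Z))) by (intros; unfold gdiff; ring).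
  rewrite gsum_plus. apply Rle_trans with (1 := Rabs_triang _ _).
  assert (A1 := gsum_cauchy_schwarz M d (gdiff w)).
  assert (A2 := gsum_cauchy_schwarz M d (fun j => w j - w (j - 1)%Z)).
  rewrite gnorm_gdiff_back in A2 by exact Hw. lra. }
set (L := space_bound al d1 d2 da h M) in *. set (r := rho * sqrt (INR (S M))) in *.
set (n := INR (S M)) in *. set (k := skew d1 d2 h) in *. set (b := beta d1 d2 h) in *.
set (G := gnorm M (gdiff w)) in *. set (D := gnorm M d) in *.
set (SS := gsum M (fun j => d j * (w (j + 1)%Z - w (j - 1)%Z))) in *.
apply Rabs_le_between in T. apply Rabs_le_between in T2. apply Rabs_le_between in B. apply Rabs_le_between in S1.
assert (Hti : 0 < 2 / tau) by (apply Rdiv_lt_0_compat; lra).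
assert (Hen : 2 / tau * (2/3 * (D * D)) <= 2 / tau * avg_energy M d) by (apply Rmult_le_compat_l; lra).
assert (HLG : 0 <= L * G) by (apply Rmult_le_pos; lra).
assert (K : 2 / tau * (2/3) * D <= L * G + 2 * r).
{ apply le_of_mul_sq_le; [exact Nd|lra|lra|]. lra. }
assert (K1 : 2 / tau * D <= 3/2 * (L * G + 2 * r)) by lra.
assert (K2 : 2 / tau * (k / 2 * SS) >= - (k * (3/2 * (L * G + 2 * r)) * G)).
{ assert (0 <= D * G) by (apply Rmult_le_pos; lra).
  assert (- (k * (D * G)) <= k / 2 * SS).
  { assert (0 <= k * (SS + 2 * (D * G))) by (apply Rmult_le_pos; lra). lra. }
  assert (2 / tau * (- (k * (D * G))) <= 2 / tau * (k / 2 * SS)) by (apply Rmult_le_compat_l; lra).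
  assert (0 <= k * G) by (apply Rmult_le_pos; lra).
  assert ((k * G) * (2 / tau * D) <= (k * G) * (3/2 * (L * G + 2 * r))) by (apply Rmult_le_compat_l; lra).
  lra. }
assert (K3 : 2 * r * gnorm M w <= 2 * r * (n * G)) by (apply Rmult_le_compat_l; lra).
assert (K4 : 3/2 * k * L * (G * G) <= b / 2 * (G * G)).
{ apply Rmult_le_compat_r; [apply Rle_0_sqr|]. lra. }
set (s := (3 * k + 2 * n) * r).
assert (K5 : 2 / tau * (avg_energy M f - avg_energy M e) <= - (b / 2) * (G * G) + s * G).
{ unfold s. lra. }
assert (K6 : - (b / 2) * (G * G) + s * G <= s^2 / (2 * b)).
{ assert (0 <= (b * G - s)^2 / (2 * b)) by (apply Rdiv_le_0_compat; [apply pow2_ge_0|lra]).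
  assert ((b * G - s)^2 / (2 * b) = b / 2 * (G * G) - s * G + s^2 / (2 * b)) by (field; lra). lra. }
replace (avg_energy M f) with (avg_energy M e + tau / 2 * (2 / tau * (avg_energy M f - avg_energy M e))) by (field; lra).
apply Rplus_le_compat_l. replace (tau * _) with (tau / 2 * (s^2 / (2 * b))) by (field; lra).
apply Rmult_le_compat_l; lra.
Qed.

(** With [h] proportional to [1 / M], the three parts of the left side are of
    order [h^(-1)], [1] and [h^(- 1 - al)], against [h^(-2)] on the right. *)
Lemma skew_absorbed al d1 d2 da l : 0 < al <= alpha_max -> 0 < d1 -> 0 < d2 -> 0 < da -> 0 < l ->
  exists M0 : nat, forall M : nat, (1 <= M)%nat -> (M0 <= M)%nat -> let h := l / INR M in
  3 * skew d1 d2 h * space_bound al d1 d2 da h M <= beta d1 d2 h.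
Proof.
intros Ha H1 H2 Hda Hl. assert (Hm := alpha_max_approx).
assert (c0 := varpi4_0_nonneg al Ha).
set (kp := d1 / (12 * d2)). assert (Hkp : 0 < kp) by (apply Rdiv_lt_0_compat; lra).
set (cs := 2 * cos (PI * al / 2)).
assert (Hcs : 0 < cs).
{ unfold cs. assert (HPI := PI_RGT_0). apply Rmult_lt_0_compat; [lra|]. apply cos_gt_0; nra. }
set (C := 288 * kp * varpi4 al 0 * l^2 * (da / cs)).
assert (HC : 0 <= C).
{ unfold C. assert (0 < da / cs) by now apply Rdiv_lt_0_compat.
  apply Rmult_le_pos; [|lra]. apply Rmult_le_pos; [|apply pow2_ge_0]. apply Rmult_le_pos; lra. }
(* The bound [/ (18 * kp)] treats the diffusive part of [space_bound], the bounds
   [1] and [d2 / (9 * kp * d1)] the convective part and the last one the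
   fractional part. *)
set (h0 := Rmin (Rmin 1 (/ (18 * kp))) (Rmin (d2 / (9 * kp * d1)) (Rpower (d2 / (C + 1)) (/ (1 - al))))).
assert (Hh0 : 0 < h0).
{ unfold h0. repeat apply Rmin_glb_lt; [lra|apply Rinv_0_lt_compat; lra|apply Rdiv_lt_0_compat; [lra|]|apply exp_pos].
  apply Rmult_lt_0_compat; [|lra]. lra. }
destruct (INR_unbounded (l / h0)) as [M0 HM0].
exists M0. intros M HM1 HM h.
assert (HMp : 1 <= INR M) by (apply (le_INR 1); lia).
assert (Hh : 0 < h) by (apply Rdiv_lt_0_compat; lra).
assert (Hhh0 : h <= h0).
{ unfold h. apply Rle_div_l; [lra|]. apply le_INR in HM.
  assert (l / h0 < INR M) by lra. apply Rlt_div_l in H; [lra|lra]. }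
unfold h0 in Hhh0.
assert (h <= 1) by (eapply Rle_trans; [exact Hhh0|]; eapply Rle_trans; [apply Rmin_l|apply Rmin_l]).
assert (Ha1 : h <= / (18 * kp)) by (eapply Rle_trans; [exact Hhh0|]; eapply Rle_trans; [apply Rmin_l|apply Rmin_r]).
assert (Ha2 : h <= d2 / (9 * kp * d1)) by (eapply Rle_trans; [exact Hhh0|]; eapply Rle_trans; [apply Rmin_r|apply Rmin_l]).
assert (Ha3 : h <= Rpower (d2 / (C + 1)) (/ (1 - al))) by (eapply Rle_trans; [exact Hhh0|]; eapply Rle_trans; [apply Rmin_r|apply Rmin_r]).
assert (Hk : skew d1 d2 h = kp * h) by (unfold skew, kp; field; lra).
assert (Hk18 : 18 * (kp * h) <= 1).
{ apply (Rmult_le_compat_l (18 * kp)) in Ha1; [|lra]. rewrite Rinv_r in Ha1; lra. }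
assert (Hk2 : 9 * kp * d1 * h^2 <= d2).
{ assert (9 * kp * d1 * h <= d2).
  { apply Rle_div_r in Ha2; [lra|]. apply Rmult_lt_0_compat; lra. }
  assert (0 < kp * d1) by (apply Rmult_lt_0_compat; lra).
  assert (0 <= 9 * kp * d1 * h) by (apply Rmult_le_pos; lra).
  replace (9 * kp * d1 * h^2) with (9 * kp * d1 * h * h) by ring. nra. }
assert (Hnh : nu al da h * h = da / cs * Rpower h (1 - al)).
{ unfold nu. fold cs. assert (R0 : 0 < Rpower h al) by apply exp_pos.
  replace (Rpower h (1 - al)) with (h / Rpower h al).
  - field. lra.
  - unfold Rminus. rewrite Rpower_plus, Rpower_1, Rpower_Ropp by exact Hh. reflexivity. }
assert (HRp : (C + 1) * Rpower h (1 - al) <= d2).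
{ apply Rle_trans with ((C + 1) * (d2 / (C + 1))); [|right; field; lra].
  apply Rmult_le_compat_l; [lra|].
  replace (d2 / (C + 1)) with (Rpower (Rpower (d2 / (C + 1)) (/ (1 - al))) (1 - al)).
  - apply Rle_Rpower_l; [lra|lra].
  - rewrite Rpower_mult, Rinv_l, Rpower_1; [reflexivity|apply Rdiv_lt_0_compat; lra|lra]. }
assert (Hn2 : INR (S M) * h <= 2 * l).
{ rewrite S_INR. assert (INR M * h = l) by (unfold h; field; lra).
  assert (h <= l) by (unfold h; apply Rle_div_l; nra). lra. }
assert (Hn0 : 0 <= INR (S M) * h) by (apply Rmult_le_pos; [apply pos_INR|lra]).
assert (bp := beta_pos d1 d2 h H1 H2 Hh). assert (bg := beta_ge d1 d2 h H1 H2).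
assert (Rp0 : 0 < Rpower h (1 - al)) by apply exp_pos.
assert (Hh2 : 0 < h^2) by nra.
assert (Hkk : 0 < kp * h) by nra.
unfold space_bound. rewrite Hk.
assert (I1 : 3 * (kp * h) * (2 * beta d1 d2 h) <= beta d1 d2 h / 3) by nra.
assert (I2 : 3 * (kp * h) * (2 * (d1 / (2 * h))) <= d2 / h^2 / 3).
{ replace (3 * (kp * h) * (2 * (d1 / (2 * h)))) with (3 * kp * d1) by (field; lra).
  apply (Rmult_le_reg_r (3 * h^2)); [lra|]. replace (d2 / h^2 / 3 * (3 * h^2)) with d2 by (field; lra). lra. }
assert (I3 : 3 * (kp * h) * (nu al da h * (4 * varpi4 al 0 * (1 + kp * h)) * INR (S M) ^ 2) <= d2 / h^2 / 3).
{ apply (Rmult_le_reg_r (3 * h^2)); [lra|]. replace (d2 / h^2 / 3 * (3 * h^2)) with d2 by (field; lra).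
  replace (3 * (kp * h) * (nu al da h * (4 * varpi4 al 0 * (1 + kp * h)) * INR (S M) ^ 2) * (3 * h ^ 2))
    with (36 * kp * varpi4 al 0 * (nu al da h * h) * ((1 + kp * h) * (INR (S M) * h)^2)) by ring.
  rewrite Hnh.
  assert (J : (1 + kp * h) * (INR (S M) * h)^2 <= 8 * l^2).
  { assert ((INR (S M) * h)^2 <= 4 * l^2) by nra. assert (0 <= (INR (S M) * h)^2) by apply pow2_ge_0. nra. }
  apply Rle_trans with (36 * kp * varpi4 al 0 * (da / cs * Rpower h (1 - al)) * (8 * l^2)).
  - apply Rmult_le_compat_l; [|exact J].
    assert (0 < da / cs) by now apply Rdiv_lt_0_compat.
    apply Rmult_le_pos; [apply Rmult_le_pos; lra|]. apply Rmult_le_pos; lra.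
  - unfold C in HRp. lra. }
lra.
Qed.

(** * Truncation error *)

Lemma sum_extend a d n : (d <= n)%nat -> (forall k, (d < k <= n)%nat -> a k = 0) ->
  sum_f_R0 a n = sum_f_R0 a d.
Proof.
intros Hd H. induction Hd as [|n Hd IH]; [reflexivity|].
rewrite tech5, IH, H by (try intros; try apply H; lia). ring.
Qed.

Definition two_sided (c : nat -> R) (v : Z -> R) (i : Z) (l : nat) : R :=
  c l * (v (i - Z.of_nat l)%Z + v (i + Z.of_nat l)%Z).

(** For a grid function supported inside the grid the averaged infinite series
    and the sums of the scheme have the same nonzero terms. *)
Lemma avg_two_sided al d1 d2 h M v j : inside M v -> (1 <= j <= M - 1)%nat ->
  avg d1 d2 h (fun i => Series (two_sided (varpi4 al) v i)) (Z.of_nat j) = frac_sum al d1 d2 h M v j.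
Proof.
intros Hv Hj. set (c := varpi4 al).
assert (E : forall i, (0 <= i <= Z.of_nat M)%Z -> Series (two_sided c v i) = sum_f_R0 (two_sided c v i) M).
{ intros i Hi. apply Series_finite. intros n Hn. unfold two_sided. rewrite !Hv by lia. ring. }
unfold avg at 1. rewrite !E by lia. unfold frac_sum. fold c.
rewrite <- (sum_extend (fun l => c l * avg d1 d2 h v (Z.of_nat j - Z.of_nat l)) j M)
  by (try lia; intros k Hk; unfold avg; rewrite !Hv by lia; ring).
rewrite <- (sum_extend (fun l => c l * avg d1 d2 h v (Z.of_nat j + Z.of_nat l)) (M - j) M)
  by (try lia; intros k Hk; unfold avg; rewrite !Hv by lia; ring).
rewrite <- !sum_scal, <- !plus_sum. apply sum_eq. intros l Hl. unfold two_sided, avg.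
replace (Z.of_nat j - 1 - Z.of_nat l)%Z with (Z.of_nat j - Z.of_nat l - 1)%Z by lia.
replace (Z.of_nat j - 1 + Z.of_nat l)%Z with (Z.of_nat j + Z.of_nat l - 1)%Z by lia.
replace (Z.of_nat j + 1 - Z.of_nat l)%Z with (Z.of_nat j - Z.of_nat l + 1)%Z by lia.
replace (Z.of_nat j + 1 + Z.of_nat l)%Z with (Z.of_nat j + Z.of_nat l + 1)%Z by lia.
ring.
Qed.

Lemma avg_bound d1 d2 h x j B : 0 < d1 -> 0 < d2 -> 0 < h ->
  Rabs (x (j - 1)%Z) <= B -> Rabs (x j) <= B -> Rabs (x (j + 1)%Z) <= B ->
  Rabs (avg d1 d2 h x j) <= (1 + skew d1 d2 h) * B.
Proof.
intros H1 H2 Hh Hm H0 Hp. assert (sk := skew_nonneg d1 d2 h H1 H2 Hh).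
rewrite avg_split by lra. set (k := skew d1 d2 h / 2). assert (Hk : 0 <= k) by (unfold k; lra).
replace (skew d1 d2 h) with (2 * k) by (unfold k; field).
apply Rabs_le_between in Hm. apply Rabs_le_between in H0. apply Rabs_le_between in Hp.
assert (0 <= k * (B - x (j - 1)%Z)) by (apply Rmult_le_pos; lra).
assert (0 <= k * (B + x (j - 1)%Z)) by (apply Rmult_le_pos; lra).
assert (0 <= k * (B - x (j + 1)%Z)) by (apply Rmult_le_pos; lra).
assert (0 <= k * (B + x (j + 1)%Z)) by (apply Rmult_le_pos; lra).
apply Rabs_le. lra.
Qed.

(** This identity is where the values of the coefficients [a_i] and [b_i] come
    from. *)
Lemma compact_identity d1 d2 a h (ut : R -> R) (gx : R -> R) j : d2 <> 0 -> h <> 0 ->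
  (d2 + d1^2 * h^2 / (12 * d2)) * delta2 h ut (node a h j) - d1 * mu_delta h ut (node a h j)
  - (gx (node a h j) + h^2 / 12 * (delta2 h gx (node a h j) - d1 / d2 * mu_delta h gx (node a h j)))
  = diffusion d1 d2 h (fun i => ut (node a h i)) j - avg d1 d2 h (fun i => gx (node a h i)) j.
Proof.
intros H2 Hh.
assert (Ep : node a h j + h = node a h (j + 1)) by (unfold node; rewrite plus_IZR; ring).
assert (Em : node a h j - h = node a h (j - 1)) by (unfold node; rewrite minus_IZR; ring).
unfold delta2, mu_delta, diffusion, avg, a1, a2, a3, b1, b2, b3. rewrite Ep, Em. field. auto.
Qed.

Lemma inside_node a b M (f : R -> R) : (1 <= M)%nat -> a < b ->
  (forall x, x < a \/ b < x -> f x = 0) -> f a = 0 -> f b = 0 ->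
  inside M (fun i => f (node a ((b - a) / INR M) i)).
Proof.
intros HM Hab Hout Ha Hb j Hj.
assert (HMp : 1 <= INR M) by (apply (le_INR 1); lia).
set (h := (b - a) / INR M). assert (Hh : 0 < h) by (apply Rdiv_lt_0_compat; lra).
assert (HMh : INR M * h = b - a) by (unfold h; field; lra).
unfold node. destruct Hj as [Hj|Hj].
- destruct (Z.eq_dec j 0) as [->|Hj0]; [rewrite Rmult_0_l, Rplus_0_r; exact Ha|].
  apply Hout. left. assert (IZR j < 0) by (apply IZR_lt; lia). nra.
- destruct (Z.eq_dec j (Z.of_nat M)) as [->|Hj0].
  + rewrite <- INR_IZR_INZ, HMh. now replace (a + (b - a)) with b by ring.
  + apply Hout. right. assert (INR M < IZR j) by (rewrite INR_IZR_INZ; apply IZR_lt; lia). nra.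
Qed.

(** The properties of the error [e] of a numerical solution that the energy
    estimates start from. *)
Definition truncated_by (alpha d1 d2 da a b T : R) (phi : R -> R) (s u : R -> R -> R)
    (M : nat) (K : R) : Prop :=
  forall N U, (1 <= N)%nat -> scheme_solution alpha d1 d2 da a b T phi s M N U ->
    let tau := T / INR N in let h := (b - a) / INR M in
    let e := fun k j => u (node a h j) (INR k * tau) - U k j in
    (forall k, (k <= N)%nat -> inside M (e k)) /\ (forall j, e O j = 0) /\
    (forall k j, (k < N)%nat -> (1 <= j <= M - 1)%nat ->
       Rabs (residual alpha d1 d2 da tau h M (e k) (e (S k)) j) <= 2 * (K * (tau^2 + h^4))).

(** The average over three neighbouring nodes of the time discretization error
    contains the average of the flux, replaced by the local operator through the
    compact approximation, and the average of the Riesz derivative, replaced by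
    the sums of the scheme. *)
Lemma truncation_error alpha d1 d2 da a b T phi s u :
  0 < d1 -> 0 < d2 -> 0 < da -> a < b -> 0 < T ->
  exact_solution alpha d1 d2 da a b T phi s u -> zero_extended a b T u ->
  crank_nicolson_consistent alpha d1 d2 da a b T s u -> compact_consistent d1 d2 a b T u ->
  riesz_consistent alpha a b T u ->
  exists K, 0 <= K /\ forall M, (1 <= M)%nat -> truncated_by alpha d1 d2 da a b T phi s u M K.
Proof.
intros H1 H2 Hda Hab HT Hex Hz [K1 HCN] [K2 Hco] [K3 Hri].
set (kl := skew d1 d2 (b - a)).
assert (Hkl : 0 <= kl) by (apply skew_nonneg; lra).
exists ((1 + kl) * (Rabs K1 + da * Rabs K3) + Rabs K2).
assert (A1 := Rabs_pos K1). assert (A2 := Rabs_pos K2). assert (A3 := Rabs_pos K3).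
assert (A4 : 0 <= da * Rabs K3) by (apply Rmult_le_pos; lra).
split; [assert (0 <= (1 + kl) * (Rabs K1 + da * Rabs K3)) by (apply Rmult_le_pos; lra); lra|].
intros M HM N U HN (Hsch & Hini & Hbd) tau h e.
assert (HMp : 1 <= INR M) by (apply (le_INR 1); lia).
assert (HNp : 1 <= INR N) by (apply (le_INR 1); lia).
assert (Hh : 0 < h) by (apply Rdiv_lt_0_compat; lra).
assert (Htau : 0 < tau) by (apply Rdiv_lt_0_compat; lra).
assert (Htime : forall k, (k <= N)%nat -> 0 <= INR k * tau <= T).
{ intros k Hk. apply le_INR in Hk. assert (0 <= INR k) by apply pos_INR.
  assert (E : INR N * tau = T) by (unfold tau; field; lra). split; [nra|]. rewrite <- E. nra. }
set (ug := fun k i => u (node a h i) (INR k * tau)).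
assert (Hug : forall k, (k <= N)%nat -> inside M (ug k)).
{ intros k Hk. specialize (Htime k Hk). destruct Hex as (_ & _ & Hb). destruct (Hb _ Htime) as [Hba Hbb].
  apply (inside_node a b M (fun x => u x (INR k * tau))); auto. }
assert (Hin : forall k, (k <= N)%nat -> inside M (e k)).
{ intros k Hk j Hj. unfold e. assert (P := Hug k Hk j Hj). unfold ug in P.
  rewrite P, (Hbd k j Hk Hj). ring. }
split; [exact Hin|]. split.
{ intro j. destruct (Z_le_gt_dec j 0) as [Hj|Hj]; [apply (Hin O); lia|].
  destruct (Z_le_gt_dec (Z.of_nat M) j) as [Hj'|Hj']; [apply (Hin O); lia|].
  unfold e. assert (P := Hini (Z.to_nat j) ltac:(lia)). rewrite Z2Nat.id in P by lia. fold h in P.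
  rewrite P. destruct Hex as (_ & Hi & _). simpl (INR 0). rewrite Rmult_0_l, Hi; [ring|].
  unfold node. assert (E : INR M * h = b - a) by (unfold h; field; lra).
  assert (0 < IZR j) by (apply IZR_lt; lia).
  assert (IZR j < INR M) by (rewrite INR_IZR_INZ; apply IZR_lt; lia). nra. }
intros k j Hk Hj. set (J := Z.of_nat j).
set (sh := fun i : Z => s (node a h i) (INR k * tau + tau / 2)).
set (gk := fun m i => g_flux d1 d2 u (node a h i) (INR m * tau)).
set (rz := fun m i => riesz alpha a b (fun y => u y (INR m * tau)) (node a h i)).
set (sr := fun m i => Series (two_sided (varpi4 alpha) (ug m) i)).
set (ru := fun m i => da * rz m i + nu alpha da h * sr m i).
set (cn := fun i => (ug (S k) i - ug k i) / tau - ((gk (S k) i + da * rz (S k) i) + (gk k i + da * rz k i)) / 2 - sh i).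
assert (Hcn : forall i, (0 <= i <= Z.of_nat M)%Z -> Rabs (cn i) <= Rabs K1 * tau^2).
{ intros i Hi. assert (P := HCN M N (Z.to_nat i) k HM HN ltac:(lia) Hk). cbv zeta in P.
  rewrite Z2Nat.id in P by lia. fold tau in P. fold h in P.
  eapply Rle_trans; [|eapply Rle_trans; [exact P|apply Rmult_le_compat_r; [apply pow2_ge_0|apply Rle_abs]]].
  right. f_equal. unfold cn, ug, gk, rz, sh, space_op, g_flux. field. lra. }
assert (Hru : forall m i, (m <= N)%nat -> (0 <= i <= Z.of_nat M)%Z -> Rabs (ru m i) <= da * Rabs K3 * h^4).
{ intros m i Hm Hi. assert (P := Hri M N (Z.to_nat i) m HM HN ltac:(lia) Hm). cbv zeta in P.
  rewrite Z2Nat.id in P by lia. fold tau in P. fold h in P.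
  assert (Es : Series (fun l => varpi4 alpha l * (u (node a h i - INR l * h) (INR m * tau) + u (node a h i + INR l * h) (INR m * tau))) = sr m i).
  { apply Series_ext. intro l. unfold two_sided, ug, node. rewrite minus_IZR, plus_IZR, <- INR_IZR_INZ.
    do 2 f_equal; f_equal; ring. }
  rewrite Es in P. fold (rz m i) in P.
  replace (ru m i) with (da * (rz m i - - (1 / (2 * cos (PI * alpha / 2) * Rpower h alpha)) * sr m i))
    by (unfold ru, nu, Rdiv; ring).
  rewrite Rabs_mult, (Rabs_right da), (Rmult_assoc da (Rabs K3)) by lra. apply Rmult_le_compat_l; [lra|].
  eapply Rle_trans; [exact P|]. apply Rmult_le_compat_r; [apply pow_le; lra|apply Rle_abs]. }
assert (Hg : forall m, (m <= N)%nat -> Rabs (diffusion d1 d2 h (ug m) J - avg d1 d2 h (gk m) J) <= Rabs K2 * h^4).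
{ intros m Hm. assert (P := Hco M N j m HM HN Hj Hm). cbv zeta in P. fold tau in P. fold h in P. fold J in P.
  rewrite (compact_identity d1 d2 a h (fun y => u y (INR m * tau)) (fun y => g_flux d1 d2 u y (INR m * tau))) in P by lra.
  eapply Rle_trans; [exact P|]. apply Rmult_le_compat_r; [apply pow_le; lra|apply Rle_abs]. }
assert (Hsr : forall m, (m <= N)%nat -> frac_sum alpha d1 d2 h M (ug m) j = avg d1 d2 h (sr m) J).
{ intros m Hm. symmetry. apply avg_two_sided; auto. }
assert (Eres : residual alpha d1 d2 da tau h M (e k) (e (S k)) j =
  2 * avg d1 d2 h cn J
  - (diffusion d1 d2 h (ug (S k)) J - avg d1 d2 h (gk (S k)) J)
  - (diffusion d1 d2 h (ug k) J - avg d1 d2 h (gk k) J)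
  + avg d1 d2 h (ru (S k)) J + avg d1 d2 h (ru k) J).
{ assert (P := Hsch j k Hj Hk). cbv zeta in P. fold tau in P. fold h in P. fold J in P.
  unfold residual. fold J.
  assert (F1 : frac_sum alpha d1 d2 h M (fun i => e (S k) i + e k i) j =
    avg d1 d2 h (sr (S k)) J + avg d1 d2 h (sr k) J
    - frac_sum alpha d1 d2 h M (U (S k)) j - frac_sum alpha d1 d2 h M (U k) j).
  { rewrite <- !Hsr by lia.
    transitivity (frac_sum alpha d1 d2 h M (fun i => (ug (S k) i + 1 * ug k i) + (-1) * (U (S k) i + 1 * U k i)) j).
    - unfold frac_sum. f_equal; apply sum_eq; intros; unfold avg, e, ug; ring.
    - rewrite (frac_sum_lin alpha d1 d2 h M (-1) (fun i => ug (S k) i + 1 * ug k i) (fun i => U (S k) i + 1 * U k i)).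
      rewrite !frac_sum_lin. ring. }
  rewrite F1.
  fold sh in P.
  assert (P' : 2 / tau * avg d1 d2 h (fun i => U (S k) i - U k i) J - diffusion d1 d2 h (fun i => U (S k) i + U k i) J
     + nu alpha da h * (frac_sum alpha d1 d2 h M (U (S k)) j + frac_sum alpha d1 d2 h M (U k) j) = 2 * avg d1 d2 h sh J).
  { unfold avg, diffusion. unfold Rdiv in P |- *. lra. }
  replace (2 / tau * avg d1 d2 h (fun i => e (S k) i - e k i) J) with
    (2 / tau * avg d1 d2 h (fun i => ug (S k) i - ug k i) J - 2 / tau * avg d1 d2 h (fun i => U (S k) i - U k i) J)
    by (unfold avg, e, ug; ring).
  replace (diffusion d1 d2 h (fun i => e (S k) i + e k i) J) with
    (diffusion d1 d2 h (ug (S k)) J + diffusion d1 d2 h (ug k) J - diffusion d1 d2 h (fun i => U (S k) i + U k i) J)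
    by (unfold diffusion, e, ug; ring).
  assert (Q : 2 / tau * avg d1 d2 h (fun i => ug (S k) i - ug k i) J
     + nu alpha da h * (avg d1 d2 h (sr (S k)) J + avg d1 d2 h (sr k) J) - 2 * avg d1 d2 h sh J
    = 2 * avg d1 d2 h cn J + avg d1 d2 h (gk (S k)) J + avg d1 d2 h (gk k) J
      + avg d1 d2 h (ru (S k)) J + avg d1 d2 h (ru k) J).
  { unfold avg, cn, ru. field. lra. }
  lra. }
rewrite Eres.
assert (HJ : (1 <= J <= Z.of_nat M - 1)%Z) by (unfold J; lia).
assert (Hskh : skew d1 d2 h <= kl).
{ unfold kl, skew, Rdiv. apply Rmult_le_compat_r; [left; apply Rinv_0_lt_compat; lra|].
  apply Rmult_le_compat_l; [lra|]. unfold h. apply Rle_div_l; nra. }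
assert (Hsk0 := skew_nonneg d1 d2 h H1 H2 Hh).
assert (B1 := avg_bound d1 d2 h cn J _ H1 H2 Hh (Hcn (J - 1)%Z ltac:(lia)) (Hcn J ltac:(lia)) (Hcn (J + 1)%Z ltac:(lia))).
assert (Bru : forall m, (m <= N)%nat -> Rabs (avg d1 d2 h (ru m) J) <= (1 + kl) * (da * Rabs K3 * h^4)).
{ intros m Hm. eapply Rle_trans; [apply (avg_bound d1 d2 h (ru m) J (da * Rabs K3 * h^4)); auto; apply Hru; auto; lia|].
  apply Rmult_le_compat_r; [|lra]. apply Rmult_le_pos; [lra|apply pow_le; lra]. }
assert (B1' : Rabs (avg d1 d2 h cn J) <= (1 + kl) * (Rabs K1 * tau^2)).
{ eapply Rle_trans; [exact B1|]. apply Rmult_le_compat_r; [|lra]. apply Rmult_le_pos; [lra|apply pow2_ge_0]. }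
assert (B2 := Bru (S k) ltac:(lia)). assert (B3 := Bru k ltac:(lia)).
assert (B4 := Hg (S k) ltac:(lia)). assert (B5 := Hg k ltac:(lia)).
apply Rabs_le_between in B1'. apply Rabs_le_between in B2. apply Rabs_le_between in B3.
apply Rabs_le_between in B4. apply Rabs_le_between in B5.
assert (T2 : 0 <= tau^2) by apply pow2_ge_0. assert (T4 : 0 <= h^4) by (apply pow_le; lra).
assert (0 <= (1 + kl) * Rabs K1 * h^4) by (apply Rmult_le_pos; [apply Rmult_le_pos; lra|lra]).
assert (0 <= (1 + kl) * (da * Rabs K3) * tau^2) by (apply Rmult_le_pos; [apply Rmult_le_pos; lra|lra]).
assert (0 <= Rabs K2 * tau^2) by (apply Rmult_le_pos; lra).
apply Rabs_le. lra.
Qed.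

(** * Convergence *)

Lemma gronwall (y : nat -> R) x bd N : 0 <= x -> 0 <= bd -> y O = 0 ->
  (forall k, (k < N)%nat -> y (S k) <= (1 + x) * y k + bd) ->
  forall k, (k <= N)%nat -> y k <= INR k * bd * exp (INR k * x).
Proof.
intros Hx Hb H0 H. induction k as [|k IH]; intro Hk.
- rewrite H0. simpl. lra.
- apply Rle_trans with (1 := H k ltac:(lia)). specialize (IH ltac:(lia)).
  rewrite S_INR. replace ((INR k + 1) * x) with (INR k * x + x) by ring. rewrite exp_plus.
  assert (He := exp_ineq1_le x). assert (Hp := exp_pos (INR k * x)). assert (Hp' := exp_pos x).
  assert (Hk0 := pos_INR k).
  assert (1 <= exp (INR k * x) * exp x).
  { rewrite <- exp_plus. rewrite <- exp_0. assert (0 <= INR k * x + x) by nra.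
    destruct H1 as [h|<-]; [left; now apply exp_increasing|right; reflexivity]. }
  assert (0 <= INR k * bd * exp (INR k * x)) by (apply Rmult_le_pos; [apply Rmult_le_pos|]; lra).
  assert ((1 + x) * y k <= exp x * (INR k * bd * exp (INR k * x))).
  { apply Rle_trans with ((1 + x) * (INR k * bd * exp (INR k * x))); [apply Rmult_le_compat_l; lra|].
    apply Rmult_le_compat_r; lra. }
  assert (bd <= bd * (exp (INR k * x) * exp x)) by nra. lra.
Qed.

Lemma sum_n_m_interior (F : nat -> R) M : (1 <= M)%nat -> F O = 0 -> F M = 0 ->
  sum_n_m F 1 (M - 1) = sum_f_R0 F M.
Proof.
intros HM H0 HF. destruct M as [|m]; [lia|]. replace (S m - 1)%nat with m by lia.
rewrite <- sum_n_Reals. unfold sum_n. rewrite (sum_Sn_m F 0 (S m)), (sum_n_Sm F 1 m) by lia.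
rewrite H0, HF. unfold plus; simpl. rewrite Rplus_0_l, Rplus_0_r. reflexivity.
Qed.

Definition convergent_on (alpha d1 d2 da a b T : R) phi s u (M : nat) (K : R) : Prop :=
  forall (N : nat) (U : nat -> Z -> R), (1 <= N)%nat ->
    scheme_solution alpha d1 d2 da a b T phi s M N U ->
    let tau := T / INR N in let h := (b - a) / INR M in
    forall k : nat, (k <= N)%nat ->
      sqrt (h * sum_n_m (fun j : nat =>
              (Rabs (u (node a h (Z.of_nat j)) (INR k * tau) - U k (Z.of_nat j)))^2) 1 (M - 1))
      <= K * (tau^2 + h^4).

(** The constant depends on [M], through the norm of the spatial operator. *)
Lemma convergent_on_each_grid alpha d1 d2 da a b T phi s u M K :
  0 < alpha <= alpha_max -> 0 < d1 -> 0 < d2 -> 0 < da -> a < b -> 0 < T -> (1 <= M)%nat ->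
  0 <= K -> truncated_by alpha d1 d2 da a b T phi s u M K ->
  exists C, 0 <= C /\ convergent_on alpha d1 d2 da a b T phi s u M C.
Proof.
intros Ha H1 H2 Hda Hab HT HM HK Htr.
assert (HMp : 1 <= INR M) by (apply (le_INR 1); lia).
set (h := (b - a) / INR M). assert (Hh : 0 < h) by (apply Rdiv_lt_0_compat; lra).
set (L := space_bound alpha d1 d2 da h M).
assert (L0 : 0 <= L) by (apply space_bound_nonneg; auto).
set (q := sqrt (INR (S M))). assert (Hq : 0 <= q) by apply sqrt_pos.
set (Cst := sqrt h * (T * (3/2 * (K * q)) * exp (3 * T * L))).
assert (HKq : 0 <= K * q) by (apply Rmult_le_pos; lra).
exists Cst. split.
{ apply Rmult_le_pos; [apply sqrt_pos|]. apply Rmult_le_pos; [|left; apply exp_pos]. apply Rmult_le_pos; lra. }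
intros N U HN Hsch tau h' k Hk. change h' with h. clear h'.
destruct (Htr N U HN Hsch) as (Hin & He0 & Hres). fold tau in Hin, He0, Hres. fold h in Hin, He0, Hres.
set (e := fun k j => u (node a h j) (INR k * tau) - U k j).
change (forall k, (k <= N)%nat -> inside M (e k)) in Hin. change (forall j, e O j = 0) in He0.
change (forall k j, (k < N)%nat -> (1 <= j <= M - 1)%nat ->
  Rabs (residual alpha d1 d2 da tau h M (e k) (e (S k)) j) <= 2 * (K * (tau^2 + h^4))) in Hres.
assert (HNp : 1 <= INR N) by (apply (le_INR 1); lia).
assert (Htau : 0 < tau) by (apply Rdiv_lt_0_compat; lra).
assert (Hkt : INR k * tau <= T).
{ apply le_INR in Hk. assert (INR N * tau = T) by (unfold tau; field; lra). nra. }
assert (Hk0 := pos_INR k).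
set (rho := K * (tau^2 + h^4)) in *.
assert (Hsz : 0 <= tau^2 + h^4) by (assert (0 <= h^4) by (apply pow_le; lra); nra).
assert (Hrho : 0 <= rho) by (apply Rmult_le_pos; assumption).
assert (Hrq : 0 <= rho * q) by (apply Rmult_le_pos; assumption).
assert (G := gronwall (fun k => gnorm M (e k)) (3 * tau * L) (3/2 * tau * (rho * q)) N).
assert (HtL : 0 <= 3 * tau * L) by (apply Rmult_le_pos; lra).
assert (Htr' : 0 <= 3/2 * tau * (rho * q)) by (apply Rmult_le_pos; lra).
assert (Hbound : gnorm M (e k) <= INR k * (3/2 * tau * (rho * q)) * exp (INR k * (3 * tau * L))).
{ apply G; auto.
  - unfold gnorm. rewrite (gsum_ext M _ (fun _ => 0)) by (intros; rewrite He0; ring).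
    rewrite gsum_const, Rmult_0_r. apply sqrt_0.
  - intros i Hi. apply (norm_growth_of_step alpha d1 d2 da tau h M (e i) (e (S i)) rho); auto; try (apply Hin; lia). }
rewrite sum_n_m_interior; auto.
2:{ change (Rabs (e k (Z.of_nat 0)) ^ 2 = 0). rewrite (Hin k Hk) by lia. rewrite Rabs_R0. ring. }
2:{ change (Rabs (e k (Z.of_nat M)) ^ 2 = 0). rewrite (Hin k Hk) by lia. rewrite Rabs_R0. ring. }
replace (sum_f_R0 _ M) with (gsum M (fun j => e k j * e k j))
  by (apply sum_eq; intros; unfold e; rewrite pow2_abs; ring).
rewrite sqrt_mult by (try lra; apply gsum_sq_nonneg). fold (gnorm M (e k)).
unfold Cst. rewrite Rmult_assoc. apply Rmult_le_compat_l; [apply sqrt_pos|].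
apply Rle_trans with (1 := Hbound).
replace (T * (3/2 * (K * q)) * exp (3 * T * L) * (tau^2 + h^4)) with ((T * (3/2 * (rho * q))) * exp (3 * T * L))
  by (unfold rho; ring).
apply Rmult_le_compat.
- apply Rmult_le_pos; assumption.
- left; apply exp_pos.
- replace (INR k * (3/2 * tau * (rho * q))) with ((INR k * tau) * (3/2 * (rho * q))) by ring.
  apply Rmult_le_compat_r; lra.
- replace (INR k * (3 * tau * L)) with ((INR k * tau) * (3 * L)) by ring.
  assert (E : (INR k * tau) * (3 * L) <= 3 * T * L).
  { replace (3 * T * L) with (T * (3 * L)) by ring. apply Rmult_le_compat_r; lra. }
  destruct E as [E|E]; [left; now apply exp_increasing|right; now rewrite E].
Qed.

(** The increment of the energy is of order [tau (tau^2 + h^4)^2 / h], uniformly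
    in [h], and the factor [h] of the discrete norm compensates the [1 / h]. *)
Lemma convergent_on_fine_grids alpha d1 d2 da a b T phi s u :
  0 < alpha <= alpha_max -> 0 < d1 -> 0 < d2 -> 0 < da -> a < b -> 0 < T ->
  forall K, 0 <= K -> exists C, 0 <= C /\ forall M, (1 <= M)%nat ->
  truncated_by alpha d1 d2 da a b T phi s u M K ->
  3 * skew d1 d2 ((b - a) / INR M) * space_bound alpha d1 d2 da ((b - a) / INR M) M
    <= beta d1 d2 ((b - a) / INR M) ->
  convergent_on alpha d1 d2 da a b T phi s u M C.
Proof.
intros Ha H1 H2 Hda Hab HT K HK.
set (l := b - a). assert (Hl : 0 < l) by (unfold l; lra).
set (kl := skew d1 d2 l). assert (Hkl : 0 <= kl) by (apply skew_nonneg; lra).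
set (Cf := (3 * kl * l + 4 * l)^2 * (2 * l) * (3/2) * T / (4 * d2)).
assert (HCf : 0 <= Cf).
{ apply Rdiv_le_0_compat; [|lra]. apply Rmult_le_pos; [|lra].
  assert (0 <= (3 * kl * l + 4 * l)^2) by apply pow2_ge_0.
  apply Rmult_le_pos; [|lra]. apply Rmult_le_pos; lra. }
exists (K * sqrt Cf). split; [apply Rmult_le_pos; [exact HK|apply sqrt_pos]|].
intros M HM Htr Habs.
intros N U HN Hsch tau h k Hk.
change (3 * skew d1 d2 h * space_bound alpha d1 d2 da h M <= beta d1 d2 h) in Habs.
destruct (Htr N U HN Hsch) as (Hin & He0 & Hres). fold tau in Hin, He0, Hres. fold h in Hin, He0, Hres.
set (e := fun k j => u (node a h j) (INR k * tau) - U k j).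
change (forall k, (k <= N)%nat -> inside M (e k)) in Hin. change (forall j, e O j = 0) in He0.
change (forall k j, (k < N)%nat -> (1 <= j <= M - 1)%nat ->
  Rabs (residual alpha d1 d2 da tau h M (e k) (e (S k)) j) <= 2 * (K * (tau^2 + h^4))) in Hres.
assert (HMp : 1 <= INR M) by (apply (le_INR 1); lia).
assert (Hh : 0 < h) by (apply Rdiv_lt_0_compat; lra).
assert (HNp : 1 <= INR N) by (apply (le_INR 1); lia).
assert (Htau : 0 < tau) by (apply Rdiv_lt_0_compat; lra).
assert (Hkt : INR k * tau <= T).
{ apply le_INR in Hk. assert (INR N * tau = T) by (unfold tau; field; lra). nra. }
set (rho := K * (tau^2 + h^4)) in *.
assert (Hsz : 0 <= tau^2 + h^4) by (assert (0 <= h^4) by (apply pow_le; lra); nra).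
assert (Hrho : 0 <= rho) by (apply Rmult_le_pos; assumption).
assert (bp := beta_pos d1 d2 h H1 H2 Hh). assert (bg := beta_ge d1 d2 h H1 H2).
set (n := INR (S M)) in *. set (sk := skew d1 d2 h) in *. set (B := beta d1 d2 h) in *.
set (inc := ((3 * sk + 2 * n) * (rho * sqrt n))^2 / (4 * B)).
assert (Hn : 0 <= n) by apply pos_INR.
assert (Hsk : 0 <= sk) by (apply skew_nonneg; auto).
assert (Hinc : 0 <= inc) by (apply Rdiv_le_0_compat; [apply pow2_ge_0|lra]).
assert (Hen : forall i, (i <= N)%nat -> avg_energy M (e i) <= INR i * (tau * inc)).
{ induction i as [|i IH]; intro Hi.
  - simpl. rewrite Rmult_0_l. unfold avg_energy.
    rewrite (gsum_ext M _ (fun _ => 0)) by (intros; rewrite He0; ring).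
    rewrite (gsum_ext M (fun j => e O j * e O (j + 1)%Z) (fun _ => 0)) by (intros; rewrite He0; ring).
    rewrite gsum_const. lra.
  - assert (P := energy_growth_of_step alpha d1 d2 da tau h M (e i) (e (S i)) rho Ha H1 H2 Hda Hh Htau Hrho
      (Hin i ltac:(lia)) (Hin (S i) ltac:(lia)) Habs (fun j Hj => Hres i j ltac:(lia) Hj)).
    fold n sk B in P. fold inc in P. specialize (IH ltac:(lia)). rewrite S_INR. lra. }
assert (Hnorm : gnorm M (e k) * gnorm M (e k) <= 3/2 * (T * inc)).
{ assert (P := avg_energy_bounds M (e k) (Hin k Hk)). specialize (Hen k Hk).
  assert (INR k * (tau * inc) <= T * inc) by (replace (INR k * (tau * inc)) with ((INR k * tau) * inc) by ring; apply Rmult_le_compat_r; lra).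
  lra. }
rewrite sum_n_m_interior; auto.
2:{ change (Rabs (e k (Z.of_nat 0)) ^ 2 = 0). rewrite (Hin k Hk) by lia. rewrite Rabs_R0. ring. }
2:{ change (Rabs (e k (Z.of_nat M)) ^ 2 = 0). rewrite (Hin k Hk) by lia. rewrite Rabs_R0. ring. }
replace (sum_f_R0 _ M) with (gsum M (fun j => e k j * e k j))
  by (apply sum_eq; intros; unfold e; rewrite pow2_abs; ring).
rewrite <- gnorm_sq.
replace (K * sqrt Cf * (tau^2 + h^4)) with (sqrt Cf * rho) by (unfold rho; ring).
assert (HMh : INR M * h = l) by (unfold h, l; field; lra).
assert (Hhl : h <= l) by (rewrite <- HMh; nra).
assert (Hnh : n * h <= 2 * l) by (unfold n; rewrite S_INR; lra).
assert (Hnh0 : 0 <= n * h) by (apply Rmult_le_pos; lra).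
assert (Hskl : sk <= kl).
{ unfold sk, kl, skew, Rdiv. apply Rmult_le_compat_r; [left; apply Rinv_0_lt_compat; lra|].
  apply Rmult_le_compat_l; lra. }
assert (Hsh : 0 <= h * (3 * sk + 2 * n) <= 3 * kl * l + 4 * l).
{ assert (h * sk <= l * kl) by (apply Rmult_le_compat; lra).
  assert (0 <= h * sk) by (apply Rmult_le_pos; lra). lra. }
assert (HB : d2 <= B * h^2).
{ apply (Rmult_le_compat_r (h^2)) in bg; [|nra]. replace (d2 / h^2 * h^2) with d2 in bg by (field; lra). exact bg. }
assert (Hfin : h * (gnorm M (e k) * gnorm M (e k)) <= Cf * rho^2).
{ apply Rle_trans with (h * (3/2 * (T * inc))); [apply Rmult_le_compat_l; lra|].
  replace (h * (3/2 * (T * inc))) with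
    ((h * (3 * sk + 2 * n))^2 * (n * h) * (3/2) * T / (4 * (B * h^2)) * rho^2).
  2:{ unfold inc. rewrite (Rpow_mult_distr (3 * sk + 2 * n)), (Rpow_mult_distr rho).
      replace (sqrt n ^ 2) with n by (rewrite <- Rsqr_pow2; symmetry; apply Rsqr_sqrt; exact Hn).
      field. lra. }
  apply Rmult_le_compat_r; [apply pow2_ge_0|]. unfold Cf, Rdiv.
  apply Rmult_le_compat.
  - apply Rmult_le_pos; [|lra]. apply Rmult_le_pos; [|lra]. apply Rmult_le_pos; [apply pow2_ge_0|exact Hnh0].
  - left. apply Rinv_0_lt_compat. lra.
  - apply Rmult_le_compat_r; [lra|]. apply Rmult_le_compat_r; [lra|].
    apply Rmult_le_compat; [apply pow2_ge_0|exact Hnh0| |exact Hnh]. apply pow_incr. exact Hsh.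
  - apply Rinv_le_contravar; lra. }
apply Rle_trans with (sqrt (Cf * rho^2)); [now apply sqrt_le_1_alt|].
rewrite sqrt_mult, sqrt_pow2 by (try assumption; apply pow2_ge_0). lra.
Qed.

Lemma convergent_on_le alpha d1 d2 da a b T phi s u M C C' : C <= C' ->
  convergent_on alpha d1 d2 da a b T phi s u M C -> convergent_on alpha d1 d2 da a b T phi s u M C'.
Proof.
intros HC Hc N U HN Hsch tau h k Hk. eapply Rle_trans; [apply (Hc N U HN Hsch k Hk)|].
apply Rmult_le_compat_r; [|exact HC].
apply Rplus_le_le_0_compat; [apply pow2_ge_0|]. replace 4%nat with (2 * 2)%nat by reflexivity.
rewrite pow_mult. apply pow2_ge_0.
Qed.

(** The energy estimate covers all grids but finitely many in space, and the sum of
    the constants of the remaining ones is a common constant for them. *)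
Lemma scheme_convergent alpha d1 d2 da a b T phi s u :
  0 < alpha <= alpha_max -> 0 < d1 -> 0 < d2 -> 0 < da -> a < b -> 0 < T ->
  exact_solution alpha d1 d2 da a b T phi s u -> zero_extended a b T u ->
  crank_nicolson_consistent alpha d1 d2 da a b T s u -> compact_consistent d1 d2 a b T u ->
  riesz_consistent alpha a b T u ->
  convergent_2_4 alpha d1 d2 da a b T phi s u.
Proof.
intros Ha H1 H2 Hda Hab HT Hex Hz HCN Hco Hri.
destruct (truncation_error alpha d1 d2 da a b T phi s u) as (K & HK & Htr); auto.
destruct (skew_absorbed alpha d1 d2 da (b - a) Ha H1 H2 Hda ltac:(lra)) as [M0 HM0].
destruct (convergent_on_fine_grids alpha d1 d2 da a b T phi s u Ha H1 H2 Hda Hab HT K HK) as (Cf & HCf & Hfine).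
assert (Hsmall : forall m, exists C, 0 <= C /\ forall M, (1 <= M)%nat -> (M < m)%nat ->
   convergent_on alpha d1 d2 da a b T phi s u M C).
{ induction m as [|m (C & HC & IH)].
  - exists 0. split; [lra|]. intros; lia.
  - destruct (Nat.eq_dec m 0) as [->|Hm].
    + exists 0. split; [lra|]. intros; lia.
    + destruct (convergent_on_each_grid alpha d1 d2 da a b T phi s u m K) as (C' & HC' & Hm'); auto; try apply Htr; try lia.
      exists (C + C'). split; [lra|]. intros M HM HMm. destruct (Nat.eq_dec M m) as [->|].
      * apply (convergent_on_le _ _ _ _ _ _ _ _ _ _ m C'); [lra|exact Hm'].
      * apply (convergent_on_le _ _ _ _ _ _ _ _ _ _ M C); [lra|]. apply IH; lia. }
destruct (Hsmall M0) as (C & HC & Hs).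
exists (C + Cf). intros M N U HM HN Hsch tau h k Hk.
assert (Hc : convergent_on alpha d1 d2 da a b T phi s u M (C + Cf)).
{ destruct (le_lt_dec M0 M) as [h0|h0].
  - apply (convergent_on_le _ _ _ _ _ _ _ _ _ _ M Cf); [lra|]. apply Hfine; auto.
  - apply (convergent_on_le _ _ _ _ _ _ _ _ _ _ M C); [lra|]. now apply Hs. }
exact (Hc N U HN Hsch k Hk).
Qed.

Theorem theorem3p2 (alpha d1 d2 da a b T : R) (phi : R -> R) (s : R -> R -> R)
    (halpha : 0 < alpha <= alpha_max)
    (hd1 : 0 < d1) (hd2 : 0 < d2) (hda : 0 < da) (hab : a < b) (hT : 0 < T) :
  unconditionally_stable alpha d1 d2 da /\
  (forall u : R -> R -> R,
     exact_solution alpha d1 d2 da a b T phi s u ->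
     zero_extended a b T u ->
     crank_nicolson_consistent alpha d1 d2 da a b T s u ->
     compact_consistent d1 d2 a b T u ->
     riesz_consistent alpha a b T u ->
     convergent_2_4 alpha d1 d2 da a b T phi s u).
Proof.
split.
- now apply von_neumann_stable.
- intros u Hex Hz Hcn Hco Hri. now apply scheme_convergent.
Qed.
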